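(* Let $\sigma\in(0,2)$, $T>0$. Assume $F:\mathbb{R}\to\mathbb{R}$ satisfies $F(l_1)-F(l_2)\le L_F(l_1-l_2)^+$ for all $l_1,l_2\in\mathbb{R}$ for some constant $L_F$, that $f\in C_b(\mathbb{R}^N\times[0,T])$, $u_0\in C_b(\mathbb{R}^N)$, and that $\tau=\tau(h)\to0$ as $h\to0$ (with $T/\tau\in\mathbb{N}$). For $(x,t)\in\mathbb{R}^N\times[0,T]$, $r\in\mathbb{R}$ and bounded $U:\mathbb{R}^N\times[0,T]\to\mathbb{R}$ define $$S(h,x,t,r,U)=\begin{cases}\dfrac{r-U(x,t-\tau)}{\tau}-F\big(-(-\Delta_h)^{\sigma/2}U(x,t-\tau)\big)-f(x,t-\tau),&t\in[\tau,T],\\[4pt] r-u_0(x),&t\in[0,\tau).\end{cases}$$ Let $\phi\in C^2\cap C_b(\mathbb{R}^N\times[0,T])$, let $\eta_h\ge0$ be such that $\eta_h/\tau\to0$ as $h\to0$, and let $(x_0,t_0)\in\mathbb{R}^N\times[0,T]$. Write $E(x,t)=\phi_t(x,t)-F\big(-(-\Delta)^{\sigma/2}\phi(x,t)\big)-f(x,t)$. Then $$\liminf_{(h,t,x,\xi)\to(0,t_0,x_0,0)}S(h,x,t,\phi(x,t)+\xi-\eta_h,\phi+\xi)\ \ge\ \begin{cases}E(x_0,t_0),&t_0>0,\\ \min\{\phi(x_0,0)-(u_0)^*(x_0),\,E(x_0,0)\},&t_0=0,\end{cases}$$ and $$\limsup_{(h,t,x,\xi)\to(0,t_0,x_0,0)}S(h,x,t,\phi(x,t)+\xi+\eta_h,\phi+\xi)\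 \le\ \begin{cases}E(x_0,t_0),&t_0>0,\\ \max\{\phi(x_0,0)-(u_0)_*(x_0),\,E(x_0,0)\},&t_0=0.\end{cases}$$
   Context: $(\cdot)^+=\max\{0,\cdot\}$; $C_b$ denotes bounded continuous functions. $(u_0)_*(x)=\liminf_{y\to x}u_0(y)$, $(u_0)^*(x)=\limsup_{y\to x}u_0(y)$. In the limits $h>0$, $t\in[0,T]$, $x\in\mathbb{R}^N$, $\xi\in\mathbb{R}$. Fractional Laplacian: for $\phi\in C^2\cap C_b(\mathbb{R}^N)$, $-(-\Delta)^{\sigma/2}\phi(x)=\lim_{r\to0}\int_{|z|>r}(\phi(x+z)-\phi(x))\frac{c}{|z|^{N+\sigma}}dz$ with $c=\frac{2^\sigma\Gamma(\frac{N+\sigma}{2})}{\pi^{N/2}|\Gamma(-\frac\sigma2)|}$; for functions of $(x,t)$ it acts in $x$. Discrete operator: for bounded $\phi$, $-(-\Delta_h)^{\sigma/2}\phi(x)=\sum_{\mathbf j\in\mathbb{Z}^N\setminus\{0\}}(\phi(x+h\mathbf j)-\phi(x))\kappa_{\sigma,h,\mathbf j}$ (acting in $x$), where $\kappa_{\sigma,h,\mathbf j}=\frac{1}{h^\sigma}\frac{1}{|\Gamma(-\sigma/2)|}\int_0^\infty e^{-2Nt}\prod_{i=1}^NI_{|\mathbf j_i|}(2t)\frac{dt}{t^{1+\sigma/2}}\ge0$ and $I_m$ is the modified Bessel function of the first kind of order $m$. (Equivalently $-(-\Delta_h)^{\sigma/2}=\frac{1}{|\Gamma(-\sigma/2)|}\int_0^\infty(e^{t\Delta_h}-\mathrm{Id})\frac{dt}{t^{1+\sigma/2}}$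 with $\Delta_h$ the standard second order central difference Laplacian of step $h$.) *)

(* Defs.v *)
From HB Require Import structures.
From mathcomp Require Import all_boot all_order all_algebra.
From mathcomp Require Import all_classical all_reals all_analysis.
Import Order.TTheory GRing.Theory Num.Theory.
Import numFieldNormedType.Exports.
Set Implicit Arguments.
Unset Strict Implicit.
Unset Printing Implicit Defensive.
Local Open Scope classical_set_scope.
Local Open Scope ring_scope.

Section tuple_lebesgue_measure.
Context {R : realType}.
Local Notation mR := (measurableTypeR R).

Definition cons_pair n (p : mR * n.-tuple mR) : n.+1.-tuple mR :=
  [the n.+1.-tuple mR of p.1 :: p.2].

Lemma measurable_cons_pair n : measurable_fun setT (@cons_pair n).
Proof. by apply: measurable_cons. Qed.

Section cons_measure.
Context n (mu : {sigma_finite_measure set (n.-tuple mR) -> \bar R}).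
Local Open Scope ereal_scope.

Definition cons_measure : set (n.+1.-tuple mR) -> \bar R :=
  pushforward (@lebesgue_measure R \x mu) (@cons_pair n).

Let cons_measurable A : measurable A -> measurable (@cons_pair n @^-1` A).
Proof.
by move=> mA; rewrite -[X in measurable X]setTI; exact: measurable_cons_pair.
Qed.

Let cons_measure0 : cons_measure set0 = 0.
Proof. by rewrite /cons_measure /pushforward preimage_set0 measure0. Qed.

Let cons_measure_ge0 A : 0 <= cons_measure A.
Proof. by rewrite /cons_measure /pushforward; apply: integral_ge0. Qed.

Let cons_measure_sigma_additive : semi_sigma_additive cons_measure.
Proof.
move=> F mF tF mUF; rewrite /cons_measure /pushforward preimage_bigcup.
apply: measure_semi_sigma_additive.
- by move=> i; exact: cons_measurable.
- apply/trivIsetP => /= i j _ _ ij; rewrite -preimage_setI.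
  by move/trivIsetP : tF => /(_ _ _ _ _ ij) ->//; rewrite preimage_set0.
- by rewrite -preimage_bigcup; exact: cons_measurable.
Qed.

HB.instance Definition _ := isMeasure.Build _ _ _ cons_measure
  cons_measure0 cons_measure_ge0 cons_measure_sigma_additive.

Let cons_measure_sigma_finite : sigma_finite setT cons_measure.
Proof.
have /sigma_finiteP[F [FT ndF Foo]] := sigma_finiteT (@lebesgue_measure R).
have /sigma_finiteP[G [GT ndG Goo]] := sigma_finiteT mu.
pose g (t : n.+1.-tuple mR) : mR * n.-tuple mR := (thead t, [tuple of behead t]).
have mg : measurable_fun setT g.
  apply/measurable_fun_pairP; split; last exact: measurable_behead.
  exact: measurable_tnth.
have gK : cancel (@cons_pair n) g.
  by move=> [x t]; congr pair => //; apply: val_inj.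
exists (fun i => g @^-1` (F i `*` G i)).
  apply/esym; rewrite -subTset => t _.
  have [i _ Fi] : (\bigcup_i F i) (g t).1 by rewrite -FT.
  have [j _ Gj] : (\bigcup_i G i) (g t).2 by rewrite -GT.
  exists (maxn i j) => //; split.
    by move: Fi; exact/subsetPset/ndF/leq_maxl.
  by move: Gj; exact/subsetPset/ndG/leq_maxr.
move=> i; have [mFi Fioo] := Foo i; have [mGi Gioo] := Goo i; split.
  by rewrite -[X in measurable X]setTI; apply: mg => //; exact: measurableX.
rewrite /cons_measure /pushforward.
rewrite (_ : _ @^-1` _ = F i `*` G i); last first.
  rewrite -comp_preimage (_ : _ \o _ = id) ?preimage_id//.
  by apply/funext => p; exact: gK.
by rewrite product_measure1E// lte_mul_pinfty// ge0_fin_numE.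
Qed.

HB.instance Definition _ := Measure_isSigmaFinite.Build _ _ _ cons_measure
  cons_measure_sigma_finite.

End cons_measure.

(* N-dimensional Lebesgue measure (on Borel sets), as an iterated product of the
   one-dimensional one; it lives on tuples because the library puts a
   sigma-algebra on n.-tuple but none on 'rV[R]_n. *)
Fixpoint lebesgue_tuple n : {sigma_finite_measure set (n.-tuple mR) -> \bar R} :=
  if n is n'.+1 then cons_measure (lebesgue_tuple n')
  else \d_([tuple] : 0.-tuple mR).

End tuple_lebesgue_measure.

Section special_functions.
Context {R : realType}.

Definition gamma_integral (x : R) : R :=
  \int[lebesgue_measure]_(t in `]0, +oo[) (t `^ (x - 1) * expR (- t)).

(* For x <= 0 not an integer, the analytic continuation given by
   Gamma x = Gamma (x + n) / (x (x + 1) ... (x + n - 1)) with 0 < x + n < 1. *)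
Definition Gamma (x : R) : R :=
  let n := if 0 < x then 0%N else `|Num.floor x|%N in
  gamma_integral (x + n%:R) / \prod_(i < n) (x + i%:R).

Definition besselI (m : nat) (x : R) : R :=
  limn (series (fun k => (x / 2) ^+ (2 * k + m) / (k`! * (k + m)`!)%:R)).

(* Unordered sum; only meaningful when a is absolutely summable on D. *)
Definition family_sum (I : choiceType) (D : set I) (a : I -> R) : R :=
  fine (\esum_(i in D) ((EFin \o a)^\+ i)%E) -
  fine (\esum_(i in D) ((EFin \o a)^\- i)%E).

End special_functions.

Section operators.
Context {R : realType} {N : nat}.
Implicit Types (phi : 'rV[R]_N -> R) (x : 'rV[R]_N).

(* The library norm on 'rV[R]_N is the sup norm. *)
Definition enorm x : R := Num.sqrt (\sum_(i < N) x 0 i ^+ 2).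

Definition row_of_tuple (z : N.-tuple (measurableTypeR R)) : 'rV[R]_N :=
  \row_i tnth z i.

Definition frac_cst (sigma : R) : R :=
  2 `^ sigma * Gamma ((N%:R + sigma) / 2) /
  (pi `^ (N%:R / 2) * `|Gamma (- (sigma / 2))|).

(* - (- Delta)^(sigma / 2) phi x *)
Definition frac_lap (sigma : R) phi x : R :=
  lim ((\int[lebesgue_tuple N]_(z in [set z | r < enorm (row_of_tuple z)])
    ((phi (x + row_of_tuple z) - phi x) *
     (frac_cst sigma / enorm (row_of_tuple z) `^ (N%:R + sigma))))
    @[r --> 0^'+]).

Definition kappa (sigma h : R) (j : 'rV[int]_N) : R :=
  (h `^ sigma)^-1 * `|Gamma (- (sigma / 2))|^-1 *
  \int[lebesgue_measure]_(t in `]0, +oo[)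
    (expR (- (2 * N%:R * t)) * (\prod_(i < N) besselI (absz (j 0 i)) (2 * t)) /
     t `^ (1 + sigma / 2)).

(* - (- Delta_h)^(sigma / 2) phi x *)
Definition disc_frac_lap (sigma h : R) phi x : R :=
  family_sum [set j : 'rV[int]_N | j != 0]
    (fun j => (phi (x + h *: map_mx intr j) - phi x) * kappa sigma h j).

End operators.

Section parabolic.
Context {R : realType} {N : nat}.
Implicit Types (T t r h : R) (p : 'rV[R]_N * R) (U phi f : 'rV[R]_N * R -> R).

Definition cylinder T : set ('rV[R]_N * R) := [set p | 0 <= p.2 <= T].

Definition Cb_cylinder T U :=
  {within cylinder T, continuous U} /\ [bounded U p | p in cylinder T].

Definition dx (i : 'I_N) phi p : R :=
  'D_(delta_mx 0 i) (fun y => phi (y, p.2)) p.1.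

(* Difference quotient in time; the limits s -> p.2 below are taken with
   s in [0, T], so that they are one-sided at the times 0 and T. *)
Definition dt_quot phi p (s : R) : R := (s - p.2)^-1 * (phi (p.1, s) - phi p).

Definition dt T phi p : R :=
  lim (dt_quot phi p s @[s --> within `[0, T] p.2^']).

Definition C1_cylinder T phi :=
  [/\ {within cylinder T, continuous phi},
      forall i p, cylinder T p ->
        derivable (fun y => phi (y, p.2)) p.1 (delta_mx 0 i),
      forall p, cylinder T p ->
        cvg (dt_quot phi p s @[s --> within `[0, T] p.2^']),
      forall i, {within cylinder T, continuous (dx i phi)} &
      {within cylinder T, continuous (dt T phi)}].

Definition C2_cylinder T phi :=
  [/\ C1_cylinder T phi, forall i, C1_cylinder T (dx i phi) &
      C1_cylinder T (dt T phi)].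

Definition scheme (sigma : R) (F : R -> R) f (u0 : 'rV[R]_N -> R)
    (tau : R -> R) h (x : 'rV[R]_N) t r U : R :=
  if tau h <= t then
    (r - U (x, t - tau h)) / tau h
    - F (disc_frac_lap sigma h (fun y => U (y, t - tau h)) x)
    - f (x, t - tau h)
  else r - u0 x.

Definition equation (sigma T : R) (F : R -> R) f phi p : R :=
  dt T phi p - F (frac_lap sigma (fun y => phi (y, p.2)) p.1) - f p.

Definition usc_envelope (u : 'rV[R]_N -> R) (x : 'rV[R]_N) : \bar R :=
  limf_esup (EFin \o u) (nbhs x).

Definition lsc_envelope (u : 'rV[R]_N -> R) (x : 'rV[R]_N) : \bar R :=
  limf_einf (EFin \o u) (nbhs x).

(* (h, t, x, xi) -> (0, t0, x0, 0) with h > 0 and t in [0, T]. *)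
Definition scheme_limit T t0 (x0 : 'rV[R]_N) :
    set_system (R * R * 'rV[R]_N * R) :=
  within [set q | 0 < q.1.1.1 /\ 0 <= q.1.1.2 <= T]
    (nbhs ((0 : R), t0, x0, (0 : R))).

End parabolic.

(* Main.v *)
(* Both operators are subordinated: up to the factor 1/|Gamma(-sigma/2)| they equal
   int_0^oo t^(-1-sigma/2) (int D(z) p_t(z) dz) dt, where D is the symmetrised increment of
   the test function and p_t is the product of N one-dimensional kernels, the Gaussian heat
   kernel for the continuous operator and, for the discrete one, the transition probabilities
   of the continuous time random walk on hZ, spread over cells of side h.  The walk kernels
   converge to the Gaussian: the Bessel recurrence determines I_(m+1)/I_m up to explicit
   bounds, hence the limit and a domination of I_m/I_0, and total mass one fixes the
   normalisation.  Dominated convergence for fixed t uses the Cauchy-like domination of the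
   kernels; in t it uses that both kernels have second moment at most 2Nt, so that the inner
   integral is at most min(2M, Ct), where C bounds the second derivatives locally uniformly.
   The truncated singular integral of the fractional Laplacian is treated by the same
   formula.  The rest of the scheme is handled by the mean value theorem in time and by the
   Lipschitz bound on F that its one-sided bound implies. *)
Require Import Defs.
From mathcomp Require Import all_boot all_order all_algebra.
From mathcomp Require Import all_classical all_reals all_analysis.
From mathcomp Require Import measurable_realfun.
From mathcomp Require Import ring lra zify.
Import Order.TTheory GRing.Theory Num.Theory.
Import numFieldNormedType.Exports.
Set Implicit Arguments.
Unset Strict Implicit.
Unset Printing Implicit Defensive.
Local Open Scope classical_set_scope.
Local Open Scope ring_scope.

(** * Bessel functions *)

(** The two kernels are compared before the integration in [t]: at that stage both are products over
    the coordinates, and what remains is the limit of $I_m(2s)$ with $s=t/h^2$ and $m$ of order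
    $1/h$. Here $m$ and $s$ grow together, so an expansion of $I_m$ at fixed order does not apply;
    the product of the ratios $I_{i+1}/I_i$ over $i<m$ gives the Gaussian exponent $m^2/(4s)$ up to
    terms of size $m/s$ and $m^3/s^2$, both of order $h$. The factor $1/|\Gamma(-\sigma/2)|$ stands
    in front of both operators and is never evaluated; the rest of $c$ is a Gamma integral. The
    weight $t^{-1-\sigma/2}$ is not integrable at 0, and for $\sigma\ge1$ a first order increment,
    of size $\sqrt t$, does not compensate it. Hence the symmetrisation, and hence the role of a
    second moment that is linear in $t$ down to $t=0$ uniformly in $h$. Test function, point and
    mesh vary together, so dominated convergence runs along sequences with moving data, and the
    uniform statement follows by contradiction. *)

Section series_aux.
Context {R : realType}.
Implicit Types u v : R^nat.

Lemma esum_series u : (forall n, 0 <= u n) -> cvgn (series u) ->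
  \esum_(n in [set: nat]) (u n)%:E = (limn (series u))%:E.
Proof.
move=> u0 cu; rewrite -nneseries_esumT; last by move=> n; rewrite lee_fin.
rewrite -EFin_lim//; congr (limn _); apply/funext => n /=.
by rewrite /series/= sumEFin.
Qed.

End series_aux.

Section bessel.
Context {R : realType}.
Implicit Types (s t : R) (m k : nat).

(** Terms of the power series of $I_m(2s)$; the argument $2s$ is the one occurring in [kappa], and
    with it the powers of two disappear. *)
Definition bessel_coef m s k : R := s ^+ (2 * k + m) / (k`! * (k + m)`!)%:R.

Definition bes m s : R := limn (series (bessel_coef m s)).

Lemma besselIE m s : besselI m (2 * s) = bes m s.
Proof.
rewrite /besselI /bes; congr (limn (series _)); apply/funext => k.
by rewrite /bessel_coef mulrAC mulfV ?mul1r// pnatr_eq0.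
Qed.

Lemma bessel_coef_ge0 m s k : 0 <= s -> 0 <= bessel_coef m s k.
Proof. by move=> s0; rewrite divr_ge0 ?exprn_ge0 ?ler0n. Qed.

Lemma bessel_coef_le m s k : 0 <= s ->
  bessel_coef m s k <= s ^+ m / m`!%:R * exp_coeff (s ^+ 2) k.
Proof.
move=> s0; rewrite /bessel_coef /exp_coeff/= exprD exprM (mulrC (_ ^+ k)) -!mulrA.
apply: ler_wpM2l; first exact: exprn_ge0.
rewrite mulrCA; apply: ler_wpM2l; first by rewrite !exprn_ge0.
rewrite -invfM lef_pV2 ?posrE ?mulr_gt0 ?ltr0n ?muln_gt0 ?fact_gt0//.
rewrite -natrM ler_nat mulnC leq_mul2l.
by apply/orP; right; apply: leq_fact; rewrite leq_addl.
Qed.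

Lemma is_cvg_bessel m s : 0 <= s -> cvgn (series (bessel_coef m s)).
Proof.
move=> s0; apply: (@series_le_cvg _ _ (fun k => s ^+ m / m`!%:R * exp_coeff (s ^+ 2) k)).
- by move=> k; exact: bessel_coef_ge0.
- move=> k; apply: mulr_ge0; first by rewrite divr_ge0 ?exprn_ge0.
  by apply: exp_coeff_ge0; rewrite exprn_ge0.
- by move=> k; exact: bessel_coef_le.
- exact/is_cvg_seriesZ/is_cvg_series_exp_coeff.
Qed.

Lemma bes_ge0 m s : 0 <= s -> 0 <= bes m s.
Proof.
move=> s0; apply: limr_ge; first exact: is_cvg_bessel.
by apply: nearW => n; apply: sumr_ge0 => k _; exact: bessel_coef_ge0.
Qed.

Lemma bes_gt0 m s : 0 < s -> 0 < bes m s.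
Proof.
move=> s0; have s0' := ltW s0.
apply: (@lt_le_trans _ _ (bessel_coef m s 0)).
  by rewrite divr_gt0 ?exprn_gt0 ?ltr0n ?muln_gt0 ?fact_gt0.
have <- : series (bessel_coef m s) 1 = bessel_coef m s 0.
  by rewrite /series/= big_nat1.
apply: nondecreasing_cvgn_le; last exact: is_cvg_bessel.
apply: nondecreasing_series => k _ _; exact: bessel_coef_ge0.
Qed.

(** An identity between coefficients: once the series of index $m+2$ is delayed by one place, which
    is the role of [d], the $k$-th terms of all three series carry $s^{2k+m+1}$. *)
Lemma bes_rec m s : 0 <= s ->
  (m.+1)%:R * bes m.+1 s = s * (bes m s - bes m.+2 s).
Proof.
move=> s0; pose d := fun k : nat => if k is k'.+1 then bessel_coef m.+2 s k' else 0.
have cd : series d @ \oo --> bes m.+2 s.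
  rewrite -(cvg_shiftS (series d)).
  rewrite [X in X @ _ --> _](_ : _ = series (bessel_coef m.+2 s)); first exact: is_cvg_bessel.
  by apply/funext => n; rewrite /series/= big_nat_recl//= add0r.
have cL := @is_cvg_bessel m.+1 _ s0.
suff : m.+1%:R *: bessel_coef m.+1 s = s *: (bessel_coef m s - d).
  move=> e; rewrite -[LHS]/(_ *: bes _ _) /bes -lim_seriesZ// e.
  apply/cvg_lim => //; rewrite seriesZ seriesD seriesN; apply: cvgZr; apply: cvgB; last exact: cd.
  exact: is_cvg_bessel.
apply/funext => -[|k]; rewrite /= !fctE /=.
  rewrite subr0 /bessel_coef !muln0 !add0n fact0 !mul1n factS natrM exprS.
  change (m.+1%:R * (s * s ^+ m / (m.+1%:R * m`!%:R)) = s * (s ^+ m / m`!%:R)).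
  have h1 : m`!%:R != 0 :> R by rewrite pnatr_eq0 -lt0n fact_gt0.
  have h2 : m.+1%:R != 0 :> R by rewrite pnatr_eq0.
  by move: m.+1%:R m`!%:R (s ^+ m) h1 h2 => X Y Z h1 h2; field; rewrite h1 h2.
change (m.+1%:R * bessel_coef m.+1 s k.+1 = s * (bessel_coef m s k.+1 - bessel_coef m.+2 s k)).
rewrite /bessel_coef (_ : (2 * k.+1 + m.+1 = (2 * k + m.+2).+1)%N); last by lia.
rewrite (_ : (2 * k.+1 + m = 2 * k + m.+2)%N); last by lia.
rewrite (_ : (k.+1 + m.+1 = (k + m).+2)%N); last by lia.
rewrite (_ : (k.+1 + m = (k + m).+1)%N); last by lia.
rewrite (_ : (k + m.+2 = (k + m).+2)%N); last by lia.
rewrite exprS !factS !natrM; set S := s ^+ _.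
have h1 : k`!%:R != 0 :> R by rewrite pnatr_eq0 -lt0n fact_gt0.
have h2 : (k + m)`!%:R != 0 :> R by rewrite pnatr_eq0 -lt0n fact_gt0.
have h3 : k.+1%:R != 0 :> R by rewrite pnatr_eq0.
have h4 : (k + m).+1%:R != 0 :> R by rewrite pnatr_eq0.
have h5 : (k + m).+2%:R != 0 :> R by rewrite pnatr_eq0.
move: h1 h2 h3 h4 h5; rewrite -[k.+1]addn1 -[m.+1]addn1 -[(k + m).+2]addn2 -[(k + m).+1]addn1.
rewrite !natrD => h1 h2 h3 h4 h5.
by field; rewrite h1 h2 h3 h4 h5.
Qed.

Local Open Scope ereal_scope.

(** [Negz n] stands for $-(n+1)$, so the negative half contributes the values at [n.+1]. *)
Lemma esum_int (g : nat -> \bar R) : (forall n, 0 <= g n) ->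
  \esum_(m in [set: int]) g `|m|%N =
  \esum_(n in [set: nat]) g n + \esum_(n in [set: nat]) g n.+1.
Proof.
move=> g0; rewrite (esumID (range Posz)) ?setTI; last by move=> *.
rewrite (_ : ~` _ = range Negz); last first.
  apply/seteqP; split=> [[n|n]|_ [n _ <-]]; rewrite /=.
  - by move=> h; exfalso; apply: h; exists n.
  - by move=> _; exists n.
  - by case.
congr (_ + _); rewrite esum_image//.
- by move=> x y _ _ [].
- by move=> x y _ _ [].
Qed.

(** The product $e^s\cdot e^s$ is a double series over pairs $(i,j)$. The map [e] indexes the pairs
    by their difference $m=i-j$ and their minimum $k$; for fixed $m$ the sum over $k$ is the series
    of $I_{|m|}(2s)$. All terms are nonnegative, so the regrouping is free. *)
Lemma esum_bes s : (0 <= s)%R ->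
  \esum_(m in [set: int]) (bes `|m| s)%:E = (expR (2 * s))%:E.
Proof.
move=> s0; pose a (p : nat * nat) := (exp_coeff s p.1 * exp_coeff s p.2)%:E.
have a0 p : 0 <= a p by rewrite lee_fin mulr_ge0// exp_coeff_ge0.
transitivity (\esum_(p in [set: nat * nat]) a p).
  pose e (p : int * nat) : nat * nat :=
    match p.1 with Posz n => ((p.2 + n)%N, p.2) | Negz n => (p.2, (p.2 + n.+1)%N) end.
  rewrite (reindex_esum [set: int * nat] _ e); last first.
    split => // [[[n|n] k] [[n'|n'] k'] _ _|[i j] _].
    - by move=> [] /= h ?; subst k'; rewrite (addnI h).
    - by move=> [] /= h h'; exfalso; lia.
    - by move=> [] /= h h'; exfalso; lia.
    - by move=> [] /= h; subst k'; move=> /addnI[->].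
    - have [ij|ij] := leqP j i.
        by exists ((i - j)%N%:Z, j) => //; rewrite /e /= subnKC.
      exists (Negz (j - i).-1, i) => //; rewrite /e /= prednK ?subn_gt0//.
      by rewrite subnKC// ltnW.
  rewrite (_ : [set: int * nat] = [set: int] `*`` (fun=> [set: nat])); last first.
    by apply/seteqP; split.
  rewrite -(@esum_esum _ _ _ _ _ (fun (m : int) k => a (e (m, k))))//.
  apply: eq_esum => m _; rewrite -esum_series; last 2 first.
  - by move=> n; exact: bessel_coef_ge0.
  - exact: is_cvg_bessel.
  apply: eq_esum => k _; congr EFin; rewrite /bessel_coef natrM.
  case: m => n; rewrite /e /exp_coeff /=.
    rewrite (_ : (2 * k + n = k + n + k)%N); last by lia.
    by rewrite exprD (mulrC k`!%:R)%R invfM mulrACA.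
  rewrite (_ : (2 * k + n.+1 = k + (k + n.+1))%N); last by lia.
  by rewrite exprD invfM mulrACA.
rewrite (_ : [set: nat * nat] = [set: nat] `*`` (fun=> [set: nat])); last first.
  by apply/seteqP; split.
rewrite -(@esum_esum _ _ _ _ _ (fun m k => a (m, k)))//.
under eq_esum => i _.
  rewrite /a /= esum_series; last 2 first.
  - by move=> n; rewrite mulr_ge0// exp_coeff_ge0.
  - exact/is_cvg_seriesZ/is_cvg_series_exp_coeff.
  rewrite (@lim_seriesZ _ (exp_coeff s)) -/(expR s); last exact: is_cvg_series_exp_coeff.
  rewrite -[_ *: _]/(_ * _)%R mulrC.
  over.
rewrite esum_series; last 2 first.
- by move=> n; rewrite mulr_ge0 ?expR_ge0 ?exp_coeff_ge0.
- exact/is_cvg_seriesZ/is_cvg_series_exp_coeff.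
rewrite (@lim_seriesZ _ (exp_coeff s)) -/(expR s); last exact: is_cvg_series_exp_coeff.
by rewrite -[_ *: _]/(_ * _)%R -expRD -mulr2n mulr_natl.
Qed.

Lemma sum_bes_le s n : (0 <= s)%R ->
  (\sum_(i < n) bes i s + \sum_(i < n) bes i.+1 s <= expR (2 * s))%R.
Proof.
move=> s0; rewrite -lee_fin -esum_bes// (esum_int (g := fun n => (bes n s)%:E)); last first.
  by move=> k; rewrite lee_fin bes_ge0.
rewrite EFinD leeD// -!nneseries_esumT; try by move=> k; rewrite lee_fin bes_ge0.
- rewrite -sumEFin -(big_mkord xpredT (fun i => (bes i s)%:E)).
  by apply: nneseries_lim_ge => k _ _; rewrite lee_fin bes_ge0.
- rewrite -sumEFin -(big_mkord xpredT (fun i => (bes i.+1 s)%:E)).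
  by apply: nneseries_lim_ge => k _ _; rewrite lee_fin bes_ge0.
Qed.

(** One factor [i.+1] is absorbed by [bes_rec]; summation by parts then leaves the two plain sums
    minus the boundary term [s * n%:R * (bes n s + bes n.+1 s)], which is nonnegative and
    dropped. *)
Lemma sum_sqr_bes_le s n : (0 <= s)%R ->
  (\sum_(i < n) i.+1%:R ^+ 2 * bes i.+1 s <= s * expR (2 * s))%R.
Proof.
move=> s0; apply: (@le_trans _ _ (s * (\sum_(i < n) bes i s + \sum_(i < n) bes i.+1 s))%R).
  rewrite -[leRHS]subr0.
  have h : (0 <= s * n%:R * (bes n s + bes n.+1 s))%R.
    by rewrite !mulr_ge0// addr_ge0// bes_ge0.
  apply: le_trans (lerB (lexx _) h).
  rewrite le_eqVlt; apply/orP; left; apply/eqP.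
  elim: n {h} => [|n IH]; first by rewrite !big_ord0; ring.
  rewrite !big_ord_recr/= IH.
  have -> : (n.+1%:R ^+ 2 * bes n.+1 s = n.+1%:R * (s * (bes n s - bes n.+2 s)))%R.
    by rewrite -bes_rec//; ring.
  by rewrite -[n.+1%:R]natr1; ring.
by rewrite ler_wpM2l// sum_bes_le.
Qed.

(** Divided by the total mass $e^{2s}$, this says that the unscaled walk has variance at most $2s$
    at time $s$. *)
Lemma esum_sqr_bes s : (0 <= s)%R ->
  \esum_(m in [set: int]) ((`|m|%N%:R) ^+ 2 * bes `|m| s)%:E <= (2 * s * expR (2 * s))%:E.
Proof.
move=> s0; have h0 k : 0 <= (k%:R ^+ 2 * bes k s)%:E.
  by rewrite lee_fin mulr_ge0 ?bes_ge0 ?exprn_ge0.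
rewrite (esum_int (g := fun n => (n%:R ^+ 2 * bes n s)%:E))//.
rewrite (_ : 2 * s * _ = s * expR (2 * s) + s * expR (2 * s))%R; last by ring.
rewrite EFinD -!nneseries_esumT//.
have h : \sum_(i <oo) (i.+1%:R ^+ 2 * bes i.+1 s)%:E <= (s * expR (2 * s))%:E.
  apply: lime_le; first by apply: is_cvg_nneseries => k _ _.
  by apply: nearW => n; rewrite sumEFin lee_fin big_mkord sum_sqr_bes_le.
apply: leeD => //.
apply: lime_le; first by apply: is_cvg_nneseries => k _ _.
apply: nearW => -[|n]; rewrite sumEFin lee_fin.
  by rewrite big_geq// mulr_ge0 ?expR_ge0.
by rewrite big_nat_recl// big_mkord expr0n mul0r add0r sum_sqr_bes_le.
Qed.

Local Close Scope ereal_scope.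

End bessel.

(** * Two-sided bounds on ratios of consecutive Bessel functions *)

Section bessel_ratio.
Context {R : realType}.
Implicit Types (s y : R) (m k : nat).

(** The positive root of $r^2+2yr=1$, that is, the fixed point of $r\mapsto 1/(2y+r)$: the
    recurrence of $I_{m+1}/I_m$ with its index frozen at $2y=(m+1)/s$. *)
Definition ratio y : R := Num.sqrt (1 + y ^+ 2) - y.

Lemma ratioE y : 0 <= y -> (Num.sqrt (1 + y ^+ 2) + y)^-1 = ratio y.
Proof.
move=> y0; have h : 0 < Num.sqrt (1 + y ^+ 2) + y.
  by rewrite ltr_wpDr// sqrtr_gt0 ltr_pwDl// sqr_ge0.
apply: (mulIf (lt0r_neq0 h)); rewrite mulVf ?lt0r_neq0// /ratio -subr_sqr sqr_sqrtr ?addrK//.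
by rewrite addr_ge0// sqr_ge0.
Qed.

Lemma ratio_gt0 y : 0 <= y -> 0 < ratio y.
Proof.
move=> y0; rewrite -ratioE// invr_gt0 ltr_wpDr// sqrtr_gt0 ltr_pwDl//; exact: sqr_ge0.
Qed.

Lemma ratio_le1 y : 0 <= y -> ratio y <= 1.
Proof.
move=> y0; rewrite lerBlDr -(@ger0_norm _ (1 + y)) ?addr_ge0// -sqrtr_sqr ler_wsqrtr//.
rewrite sqrrD expr1n mul1r lerD2r lerDl mulrn_wge0//.
Qed.

Lemma ratio_ge y : 0 <= y -> 1 - y <= ratio y.
Proof.
by move=> y0; rewrite lerD2r -{1}sqrtr1 ler_wsqrtr// lerDl sqr_ge0.
Qed.

Lemma ratio_le y : 0 <= y -> ratio y <= 1 - y + y ^+ 2 / 2.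
Proof.
move=> y0; rewrite /ratio addrAC lerD2r.
have h : 0 <= 1 + y ^+ 2 / 2 by rewrite addr_ge0 ?divr_ge0 ?sqr_ge0.
rewrite -(@ger0_norm _ (1 + _ / _))// -sqrtr_sqr ler_wsqrtr//.
have := sqr_ge0 (y ^+ 2 / 2); lra.
Qed.

Lemma ratio_leV y : 0 <= y -> ratio y <= (1 + y)^-1.
Proof.
move=> y0; rewrite -ratioE// lef_pV2 ?posrE; first last.
- by rewrite ltr_wpDr.
- by rewrite ltr_wpDr// sqrtr_gt0 ltr_pwDl// sqr_ge0.
by rewrite lerD2r -{1}sqrtr1 ler_wsqrtr// lerDl sqr_ge0.
Qed.

(** The source of the contraction: inversion has Lipschitz constant $c^{-2}$ on $[c,\infty)$, used
    below with $c=(m+1)/s$. *)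
Lemma ler_inv_sub (a b c e : R) : 0 < c -> c <= a -> c <= b -> b - a <= e -> 0 <= e ->
  a^-1 - b^-1 <= c^-1 ^+ 2 * e.
Proof.
move=> c0 ca cb bae e0.
have a0 : 0 < a by exact: lt_le_trans ca.
have b0 : 0 < b by exact: lt_le_trans cb.
rewrite (_ : _ - _ = (a * b)^-1 * (b - a)); last first.
  by field; rewrite !lt0r_neq0.
apply: (@le_trans _ _ ((a * b)^-1 * e)).
  by rewrite ler_wpM2l// invr_ge0 mulr_ge0// ltW.
rewrite ler_wpM2r// exprVn lef_pV2 ?posrE ?mulr_gt0 ?exprn_gt0//.
by rewrite expr2 ler_pM// ltW.
Qed.

Section fixed_s.
Variable s : R.
Hypothesis s0 : 0 < s.

Let r m := bes m.+1 s / bes m s.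
Let u m := ratio (m%:R / (2 * s)).
Let l m := ratio (m.+1%:R / (2 * s)).
(* [u] and [l] satisfy one-sided versions of the recurrence [rE], whose right-hand side
   contracts errors by the factor [(s / m.+1) ^ 2].  Running it backwards from infinity
   shows that the errors [r m - u m] and [l m - r m] are nonpositive. *)
Let D m (e : R) := r m - u m <= e /\ l m - r m <= e.

Let y0 m : 0 <= m%:R / (2 * s).
Proof. by rewrite divr_ge0// mulr_ge0// ltW. Qed.

Let r_gt0 m : 0 < r m. Proof. by rewrite divr_gt0// bes_gt0. Qed.

(** One step of the continued fraction of the ratio: [bes_rec] divided by $s\,I_{m+1}$. *)
Let rE m : r m = (m.+1%:R / s + r m.+1)^-1.
Proof.
rewrite /r -[LHS]invrK; congr (_^-1); rewrite invf_div.
have := bes_rec m (ltW s0).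
have h1 := lt0r_neq0 (bes_gt0 m.+1 s0); have h2 := lt0r_neq0 s0 => h.
apply: (mulIf h1); rewrite mulrDl !divfK// mulrAC h.
by field.
Qed.

(** Inversion reverses order, so the upper error at [m] comes from the lower error at [m.+1] and
    conversely. The value [l m] is obtained from [u m.+1] by the recurrence exactly; from [l m.+1]
    the recurrence only gives something below [u m], because the square root increases between the
    arguments [m%:R / (2 * s)] and [m.+2%:R / (2 * s)]. *)
Let step m e : 0 <= e -> D m.+1 e -> D m ((s / m.+1%:R) ^+ 2 * e).
Proof.
move=> e0 [h1 h2]; have c0 : 0 < m.+1%:R / s by rewrite divr_gt0.
rewrite -(invrK (s / _)) invf_div exprVn -exprVn.
split.
- have : (m.+1%:R / s + l m.+1)^-1 <= u m.
    rewrite /u -ratioE// lef_pV2 ?posrE; first last.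
    + by rewrite ltr_wpDr// sqrtr_gt0 ltr_pwDl// sqr_ge0.
    + by rewrite ltr_wpDr// ltW// ratio_gt0.
    rewrite /l /ratio (_ : m.+1%:R / s = m%:R / (2 * s) + m.+2%:R / (2 * s)); last first.
      by rewrite -[m.+2%:R]natr1 -[m.+1%:R]natr1; field; rewrite lt0r_neq0.
    set a := m%:R / _; set b := m.+2%:R / _.
    rewrite (_ : a + b + _ = Num.sqrt (1 + b ^+ 2) + a); last by ring.
    rewrite lerD2r /a /b.
    rewrite ler_wsqrtr// lerD2l ler_sqr ?nnegrE// ler_wpM2r ?invr_ge0 ?ler_nat//.
      by rewrite mulr_ge0// ltW.
    by rewrite ltnW.
  rewrite -lerN2 => h; rewrite rE; apply: le_trans (lerD (lexx _) h) _.
  apply: ler_inv_sub => //.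
  + by rewrite lerDl ltW.
  + by rewrite lerDl ltW// ratio_gt0.
  + by rewrite opprD addrACA subrr add0r.
- have -> : l m = (m.+1%:R / s + u m.+1)^-1.
    rewrite /l -ratioE//; congr (_^-1); rewrite /u /ratio.
    rewrite addrCA; congr (_ + _).
    by field; rewrite lt0r_neq0.
  rewrite rE; apply: ler_inv_sub => //.
  + by rewrite lerDl ltW// ratio_gt0.
  + by rewrite lerDl ltW.
  + by rewrite opprD addrACA subrr add0r.
Qed.

Let D_le m e e' : e <= e' -> D m e -> D m e'.
Proof. by move=> ee' [h1 h2]; split; apply: le_trans ee'. Qed.

(** Where $m+1\ge 2s$ a backward step multiplies errors by at most $1/4$. The recursion is started
    [k] indices further up, where [1 + s] is a valid error because [r] is at most [s] and [l] at
    most 1. *)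
Let D_far m k : 2 * s <= m.+1%:R -> D m (4^-1 ^+ k * (1 + s)).
Proof.
elim: k m => [|k IH] m hm.
  rewrite expr0 mul1r; split.
  - have h : r m <= s.
      rewrite rE invf_ple ?posrE//; last by rewrite addr_gt0// divr_gt0.
      apply: (@le_trans _ _ (m.+1%:R / s)); last by rewrite lerDl ltW.
      rewrite ler_pdivlMr// mulVf ?lt0r_neq0//.
      by rewrite ler1n.
    have := ratio_gt0 (y0 m); rewrite -/(u m); move: (r m) (u m) h s0 => *; lra.
  - have := ratio_le1 (y0 m.+1); rewrite -/(l m).
    by have := r_gt0 m; move: (r m) (l m) s0 => *; lra.
have hm' : 2 * s <= m.+2%:R by apply: le_trans hm _; rewrite ler_nat.
have e0 : 0 <= 4^-1 ^+ k * (1 + s).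
  by rewrite mulr_ge0 ?exprn_ge0// ?invr_ge0// addr_ge0// ltW.
apply: D_le (step e0 (IH _ hm')).
rewrite [4^-1 ^+ k.+1]exprS -[leRHS]mulrA ler_wpM2r//.
rewrite (_ : 4^-1 = 2^-1 ^+ 2); last by field.
rewrite ler_sqr ?nnegrE ?divr_ge0// ?(ltW s0)//.
by rewrite ler_pdivrMr// mulrC ler_pdivlMr// mulrC.
Qed.

Lemma bes_ratio m : ratio (m.+1%:R / (2 * s)) <= bes m.+1 s / bes m s <= ratio (m%:R / (2 * s)).
Proof.
suff : D m 0 by move=> [h1 h2]; apply/andP; split; rewrite -subr_le0.
have far n : 2 * s <= n.+1%:R -> D n 0.
  move=> hn; have c : (fun k => 4^-1 ^+ k * (1 + s)) @ \oo --> (0 : R).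
    rewrite -(mul0r (1 + s)); apply: cvgMl; apply: cvg_expr.
    by rewrite ger0_norm ?invr_ge0// invf_lt1// ltr1n.
  split; rewrite -(cvg_lim _ c)//; apply: limr_ge; try exact: cvgP c.
  - by apply: nearW => k; have [] := D_far k hn.
  - by apply: nearW => k; have [] := D_far k hn.
have [n hn] : exists n : nat, 2 * s <= n%:R.
  by exists (Num.bound (2 * s)); apply/ltW/archi_boundP; rewrite mulr_ge0// ltW.
(* An error bound of zero survives every backward step, whatever the factor, so it descends from the
   far range to all indices. *)
have : D (m + n) 0.
  by apply: far; apply: le_trans hn _; rewrite ler_nat ltnW// ltnS leq_addl.
elim: n {hn} => [|n IH]; first by rewrite addn0.
rewrite addnS => /step; rewrite mulr0 lexx => /(_ isT); exact: IH.
Qed.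

Let q m := bes m s / bes 0 s.

Let q0 : q 0 = 1. Proof. by rewrite /q divff// lt0r_neq0// bes_gt0. Qed.

Let qS m : q m.+1 = q m * r m.
Proof.
rewrite /q /r; field.
by rewrite !lt0r_neq0// bes_gt0.
Qed.

Let q_gt0 m : 0 < q m. Proof. by rewrite divr_gt0// bes_gt0. Qed.

(** The quotient is the product of the ratios. Each is at least $1-y\ge e^{-y-2y^2}$ with
    $y=(i+1)/(2s)$; the condition $m\le s$ ensures $y\le 1/2$. The linear terms sum to $m(m+1)/(4s)$
    and the quadratic ones to at most $m^3/(2s^2)$. *)
Lemma bes_quot_ge m : m%:R <= s ->
  expR (- (m%:R * m.+1%:R / (4 * s) + m%:R ^+ 3 / (2 * s ^+ 2))) <= bes m s / bes 0 s.
Proof.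
elim: m => [|m IH] ms; rewrite -/(q _); first by rewrite q0 !mul0r expr0n mul0r addr0 oppr0 expR0.
rewrite qS.
have ms' : m%:R <= s by apply: le_trans ms; rewrite ler_nat.
set y := m.+1%:R / (2 * s).
have yy : 0 <= y by exact: y0.
have y2 : y <= 2^-1.
  by rewrite /y invfM mulrA ler_pdivrMr// mulrC ler_wpM2l// invr_ge0.
have h : expR (- (y + 2 * y ^+ 2)) <= r m.
  have /andP[/(le_trans _) + _] := bes_ratio m; apply; rewrite -/y.
  apply: le_trans (ratio_ge yy).
  have h1 : 0 < 1 - y by lra.
  rewrite expRN invf_ple ?posrE ?expR_gt0//.
  apply: le_trans (expR_ge1Dx _).
  rewrite -[leLHS]mul1r ler_pdivrMr//.
  have : 0 <= y ^+ 2 * (1 - 2 * y) by rewrite mulr_ge0 ?sqr_ge0//; lra.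
  rewrite !expr2; lra.
apply: le_trans (ler_pM (expR_ge0 _) (expR_ge0 _) (IH ms') h).
rewrite -expRD ler_expR -opprD lerN2.
rewrite /y -subr_ge0 -[m.+2%:R]natr1 -[m.+1%:R]natr1.
set x : R := m%:R; have x0 : 0 <= x by rewrite ler0n.
rewrite (_ : _ - _ = (2 * x ^+ 2 + x) / (2 * s ^+ 2)); last by field; rewrite lt0r_neq0.
by apply: divr_ge0; have := sqr_ge0 x; have := sqr_ge0 s; nra.
Qed.

(** Same product, with each ratio at most $1-y+y^2/2\le e^{-y+y^2/2}$ for $y=i/(2s)$. *)
Lemma bes_quot_le m :
  bes m s / bes 0 s <= expR (- (m%:R * (m%:R - 1) / (4 * s)) + m%:R ^+ 3 / (8 * s ^+ 2)).
Proof.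
elim: m => [|m IH]; rewrite -/(q _); first by rewrite q0 !mul0r expr0n mul0r addr0 oppr0 expR0.
rewrite qS.
set y := m%:R / (2 * s).
have yy : 0 <= y by exact: y0.
have h : r m <= expR (- y + y ^+ 2 / 2).
  have /andP[_ /le_trans] := bes_ratio m; apply; rewrite -/y.
  apply: le_trans (ratio_le yy) _.
  by rewrite -addrA; exact: expR_ge1Dx.
apply: le_trans (ler_pM (ltW (q_gt0 _)) (ltW (r_gt0 _)) IH h) _.
rewrite -expRD ler_expR.
rewrite /y -subr_ge0 -[m.+1%:R]natr1.
set x : R := m%:R; have x0 : 0 <= x by rewrite ler0n.
rewrite (_ : _ - _ = (2 * x ^+ 2 + 3 * x + 1) / (8 * s ^+ 2)); last by field; rewrite lt0r_neq0.
by apply: divr_ge0; have := sqr_ge0 x; have := sqr_ge0 s; nra.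
Qed.

(** In [bes_quot_le] the cubic term takes over when $m$ is much larger than $s$. The cruder bound
    $1/(1+y)$ on each ratio, with the product of the $1+y$ bounded below by one plus their sum,
    decays in $m$ without restriction and supplies the dominating function. *)
Lemma bes_quot_leV m :
  bes m s / bes 0 s <= (1 + m%:R * (m%:R - 1) / (4 * s))^-1.
Proof.
elim: m => [|m IH]; rewrite -/(q _); first by rewrite q0 !mul0r addr0 invr1.
rewrite qS.
set y := m%:R / (2 * s).
have yy : 0 <= y by exact: y0.
have h : r m <= (1 + y)^-1.
  have /andP[_ /le_trans] := bes_ratio m; apply; exact: ratio_leV.
apply: le_trans (ler_pM (ltW (q_gt0 _)) (ltW (r_gt0 _)) IH h) _.
have z0 : 0 <= m%:R * (m%:R - 1) / (4 * s) :> R.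
  case: m {IH h} @y yy => [|m] *; first by rewrite !mul0r.
  by rewrite divr_ge0// mulr_ge0// ?(ltW s0)// -natr1 addrK.
rewrite -invfM lef_pV2 ?posrE; last 2 first.
- by rewrite mulr_gt0// ltr_wpDr.
- rewrite -natr1 addrK ltr_wpDr// divr_ge0// mulr_ge0// ltW//.
rewrite -natr1 addrK.
have -> : (m%:R + 1) * m%:R / (4 * s) = m%:R * (m%:R - 1) / (4 * s) + y.
  by rewrite /y; field; rewrite lt0r_neq0.
move: z0; set z := _ / (4 * s) => z0.
have : 0 <= z * y by rewrite mulr_ge0.
lra.
Qed.

End fixed_s.
End bessel_ratio.

(** * Integration over tuples and lattice cells *)

Section countable_valued.
Context d (T : measurableType d) (I : countType).
Variable c : T -> I.
Hypothesis mc : forall i, measurable (c @^-1` [set i]).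

(** The index type carries no sigma-algebra; measurability is read off the fibres of [c], a preimage
    being a union of rectangles over the codes [unpickle n]. This serves all functions that depend
    on a point only through its lattice cell. *)
Lemma measurable_fun_countable_valued d1 (T1 : measurableType d1) d2 (T2 : measurableType d2)
    (g : I -> T1 -> T2) : (forall i, measurable_fun setT (g i)) ->
  measurable_fun setT (fun p : T1 * T => g (c p.2) p.1).
Proof.
move=> mg _ A mA; rewrite setTI.
rewrite (_ : _ @^-1` A = \bigcup_n
    oapp (fun i => (g i @^-1` A) `*` (c @^-1` [set i])) set0 (unpickle n)); last first.
  apply/seteqP; split=> [[t x] /= h|[t x] [n _]].
    by exists (pickle (c x)) => //; rewrite pickleK.
  by case: unpickle => //= i [/= h1 h2]; rewrite h2.
apply: bigcup_measurable => n _; case: unpickle => //= i.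
apply: measurableX; last exact: mc.
by rewrite -[X in measurable X]setTI; exact: mg.
Qed.

Lemma measurable_fun_countable_valued1 d2 (T2 : measurableType d2) (g : I -> T2) :
  measurable_fun setT (g \o c).
Proof.
apply: (measurableT_comp (f := fun p : unit * T => g (c p.2)) (g := fun x => (tt, x))).
  exact: (measurable_fun_countable_valued (g := fun i _ => g i)).
exact: measurable_pair1.
Qed.

Local Open Scope ereal_scope.

(** Transfers sums over a countable type to series over the naturals, where sums and integrals can
    be exchanged. *)
Lemma esum_pickle (R : realType) (a : I -> \bar R) :
  \esum_(n in [set: nat]) oapp a 0 (@pickle_inv I n) = \esum_(i in [set: I]) a i.
Proof.
transitivity (\esum_(n in range (@pickle I)) oapp a 0 (@pickle_inv I n)).
  rewrite [RHS]esum_mkcond; apply: eq_esum => n _.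
  case: ifPn => // /negP h; case e : (@pickle_inv I n) => [i|]//=.
  exfalso; apply: h; rewrite inE; exists i => //.
  by have := @pickle_invK I n; rewrite e.
rewrite esum_image//.
by apply: eq_esum => i _; rewrite pickleK_inv.
Qed.

Lemma esumZl (R : realType) (k : R) (a : I -> \bar R) : (0 <= k)%R -> (forall i, 0 <= a i) ->
  \esum_(i in [set: I]) (k%:E * a i) = k%:E * \esum_(i in [set: I]) a i.
Proof.
move=> k0 a0; rewrite -!esum_pickle -!nneseries_esumT; last 2 first.
- by move=> n; case: pickle_inv => //= i.
- by move=> n; case: pickle_inv => //= i; rewrite mule_ge0.
rewrite -nneseriesZl; last by move=> n _; case: pickle_inv => //= i.
by apply: eq_eseriesr => n _; case: pickle_inv => //=; rewrite mule0.
Qed.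

Lemma ge0_integral_countable_valued (R : realType) (mu : {measure set T -> \bar R}) (v : R)
    (a : I -> R) : (forall i, mu (c @^-1` [set i]) = v%:E) ->
  (forall i, 0 <= a i)%R ->
  \int[mu]_x (a (c x))%:E = v%:E * \esum_(i in [set: I]) (a i)%:E.
Proof.
move=> hv a0.
pose F n x := oapp (fun i => (a i * \1_(c @^-1` [set i]) x)%:E) 0 (@pickle_inv I n).
have F0 n x : 0 <= F n x.
  by rewrite /F; case: pickle_inv => //= i; rewrite lee_fin mulr_ge0.
have FE x : (a (c x))%:E = \sum_(n <oo) F n x.
  rewrite nneseries_esumT//.
  rewrite (esum_pickle (fun i => (a i * \1_(c @^-1` [set i]) x)%:E)).
  rewrite -[LHS](@esum_set1 _ _ (c x) (EFin \o a)) ?lee_fin//=.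
  rewrite esum_mkcond; apply: eq_esum => i _.
  rewrite indicE; case: ifPn => h.
    by rewrite mem_set ?mulr1//=; move: h; rewrite inE => ->.
  rewrite memNset ?mulr0//= => cxi.
  by move/negP: h; apply; rewrite inE /= cxi.
under eq_integral do rewrite FE.
rewrite integral_nneseries//; last first.
  move=> n; rewrite /F; case: pickle_inv => [i|]; last exact: measurable_cst.
  by apply/measurable_EFinP; apply: measurable_funM.
rewrite nneseries_esumT; last by move=> n; apply: integral_ge0.
transitivity (\esum_(n in [set: nat]) oapp (fun i => (v * a i)%:E) 0 (@pickle_inv I n)).
  apply: eq_esum => n _; rewrite /F; case: pickle_inv => [i|] /=; last exact: integral0.
  under eq_integral do rewrite EFinM.
  rewrite ge0_integralZl//; last 2 first.
  - exact/measurable_EFinP/measurable_indicP.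
  - by rewrite lee_fin.
  rewrite integral_indic// setIT hv muleC EFinM//.
(* As the measure of a fibre [v] is nonnegative, provided there is a fibre; when [I] is empty the
   sum vanishes instead. *)
have v0 : (0 <= v)%R \/ \esum_(i in [set: I]) (a i)%:E = 0.
  have [[i]|h] := pselect (inhabited I).
    by left; rewrite -lee_fin -(hv i).
  by right; apply: esum1 => i _; exfalso; exact: h.
rewrite esum_pickle.
case: v0 => [v0|h].
  rewrite -esum_pickle -(esum_pickle (EFin \o a)) -!nneseries_esumT; last 2 first.
  - by move=> n; case: pickle_inv => //= i; rewrite lee_fin.
  - by move=> n; case: pickle_inv => //= i; rewrite lee_fin mulr_ge0.
  rewrite -nneseriesZl; last by move=> n _; case: pickle_inv => //= i; rewrite lee_fin.
  by apply: eq_eseriesr => n _; case: pickle_inv => /= [i|]; rewrite ?EFinM// mule0.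
rewrite h mule0; apply: esum1 => i _.
have : (a i)%:E = 0.
  apply/le_anti/andP; split; last by rewrite lee_fin.
  rewrite -h; apply: esum_ge; exists [set i]%classic; last by rewrite fsbig_set1.
  by split => //; exact: finite_set1.
by rewrite EFinM => ->; rewrite mule0.
Qed.

End countable_valued.

Section floor1.
Context {R : realType}.
Implicit Types (h x : R).

Definition fl h x : int := Num.floor (x / h).

Lemma fl_preimage h (m : int) : 0 < h ->
  (fl h : measurableTypeR R -> int) @^-1` [set m] = `[h * m%:~R, h * (m%:~R + 1)[%classic.
Proof.
move=> h0; apply/seteqP; split => x /=; rewrite /fl in_itv/=.
  move=> <-; have := ge_floor (x / h); have := lt_succ_floor (x / h).
  by rewrite intrD ltr_pdivrMr// ler_pdivlMr// (mulrC _ h) (mulrC _ h) => -> ->.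
move=> /andP[h1 h2]; apply: floor_def.
by rewrite ler_pdivlMr// ltr_pdivrMr// mulrC h1/= mulrC intrD.
Qed.

Lemma measurable_fl_preimage h (m : int) : 0 < h ->
  measurable ((fl h : measurableTypeR R -> int) @^-1` [set m]).
Proof. by move=> h0; rewrite fl_preimage. Qed.

Lemma lebesgue_fl_preimage h (m : int) : 0 < h ->
  lebesgue_measure ((fl h : measurableTypeR R -> int) @^-1` [set m]) = h%:E.
Proof.
move=> h0; rewrite fl_preimage// lebesgue_measure_itv/= lte_fin.
by rewrite ltr_pM2l// ltrDl ltr01 -EFinB mulrDr addrAC subrr add0r mulr1.
Qed.

Lemma fl_le h x : 0 < h -> h * (fl h x)%:~R <= x.
Proof. by move=> h0; rewrite mulrC -ler_pdivlMr//; exact: ge_floor. Qed.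

Lemma fl_gt h x : 0 < h -> x < h * (fl h x)%:~R + h.
Proof.
move=> h0; have : x / h < (fl h x)%:~R + 1 by have := lt_succ_floor (x / h); rewrite intrD.
by rewrite ltr_pdivrMr// mulrDl mul1r mulrC.
Qed.

Lemma fl_dist h x : 0 < h -> `|x - h * (fl h x)%:~R| <= h.
Proof.
move=> h0; have := fl_le x h0; have := fl_gt x h0; rewrite ler_norml => *.
by apply/andP; split; lra.
Qed.

Lemma norm_fl_dist h x : 0 < h -> `| `|x| - h * `|fl h x|%N%:R | <= h.
Proof.
move=> h0; rewrite -[h in h * _](ger0_norm (ltW h0)) natr_absz intr_norm -normrM.
by apply: le_trans (ler_dist_dist _ _) _; rewrite fl_dist.
Qed.

End floor1.

(** * Changes of variables on the line and on tuples *)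

Section lebesgue_change.
Context {R : realType}.
Local Notation mR := (measurableTypeR R).
Local Notation mu := (@lebesgue_measure R).
Local Open Scope ereal_scope.

Lemma ge0_integralT_opp (f : R -> \bar R) : measurable_fun [set: mR] f ->
  (forall x, 0 <= f x) -> \int[mu]_x f (- x)%R = \int[mu]_x f x.
Proof.
move=> mf f0.
rewrite -[LHS](@ge0_integral_pushforward _ _ mR mR _ (-%R) _ mu setT f)//.
by apply: eq_measure_integral => //= A mA _; exact: lebesgue_measureN.
Qed.

(** By uniqueness of Lebesgue measure: [c] times the pushforward is a measure with the right value
    on half-open intervals. *)
Lemma lebesgue_measure_scale (c : R) (A : set mR) : (0 < c)%R -> measurable A ->
  mu ((fun x : mR => c * x : mR)%R @^-1` A) = (c^-1)%:E * mu A.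
Proof.
move=> c0 mA.
have mc : measurable_fun [set: mR] (fun x : mR => c * x : mR)%R by exact: measurable_funM.
pose nu := [the measure _ _ of pushforward mu (fun x : mR => c * x : mR)%R].
have c0' : (0 <= c)%R by exact: ltW.
pose nc := [the measure _ _ of mscale (NngNum c0') (nu mc)].
suff : mu A = nc A.
  move=> ->; rewrite /nc /= /mscale /= muleA -EFinM mulVf ?mul1e//.
  exact: lt0r_neq0.
apply: lebesgue_measure_unique => // _ [[a b]] _ <-.
rewrite /= /mscale /= /pushforward.
rewrite (_ : _ @^-1` _ = `](a / c)%R, (b / c)%R]%classic); last first.
  by apply/seteqP; split=> x /=; rewrite !in_itv/= ltr_pdivrMr// ler_pdivlMr// mulrC.
rewrite !lebesgue_measure_itv/= !lte_fin ltr_pM2r ?invr_gt0//.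
case: ifP => _; last by rewrite mule0.
by rewrite -!EFinB -EFinM -mulrBl mulrCA mulfV ?mulr1// lt0r_neq0.
Qed.

Lemma ge0_integralT_scale (c : R) (f : R -> \bar R) : (0 < c)%R ->
  measurable_fun [set: mR] f -> (forall x, 0 <= f x) ->
  \int[mu]_x f (c * x)%R = (c^-1)%:E * \int[mu]_x f x.
Proof.
move=> c0 mf f0.
have mc : measurable_fun [set: mR] (fun x : mR => c * x : mR)%R by exact: measurable_funM.
have c0' : (0 <= c^-1)%R by rewrite invr_ge0 ltW.
rewrite -[LHS](@ge0_integral_pushforward _ _ mR mR _ (fun x => c * x)%R mc mu setT f)//.
rewrite -(@ge0_integral_mscale _ _ _ mu _ measurableT (NngNum c0'))//.
by apply: eq_measure_integral => //= A mA _; exact: lebesgue_measure_scale.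
Qed.

End lebesgue_change.

Section lebesgue_tuple_theory.
Context {R : realType}.
Local Notation mR := (measurableTypeR R).
Local Notation mu := (@lebesgue_measure R).
Local Open Scope ereal_scope.

Lemma ge0_integral_tupleS n (f : n.+1.-tuple mR -> \bar R) :
  measurable_fun setT f -> (forall z, 0 <= f z) ->
  \int[lebesgue_tuple n.+1]_z f z =
  \int[mu]_x \int[lebesgue_tuple n]_z f (cons_pair (x, z)).
Proof.
move=> mf f0; rewrite [LHS](@ge0_integral_pushforward _ _ _ _ _ (@cons_pair R n) _ _ setT f)//; last first.
  exact: measurable_cons_pair.
rewrite preimage_setT fubini_tonelli1//.
  by apply: measurableT_comp => //; exact: measurable_cons_pair.
by move=> p; exact: f0.
Qed.

Lemma ge0_integral_tuple_prod n (g : 'I_n -> R -> R) (w : 'I_n -> R) :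
  (forall i, measurable_fun [set: mR] (g i)) -> (forall i x, (0 <= g i x)%R) ->
  (forall i, \int[mu]_x (g i x)%:E = (w i)%:E) ->
  \int[lebesgue_tuple n]_z (\prod_(i < n) g i (tnth z i))%:E = (\prod_(i < n) w i)%:E.
Proof.
elim: n g w => [|n IH] g w mg g0 gw.
  rewrite big_ord0; under eq_integral do rewrite big_ord0.
  by rewrite integral_cst//= mul1e diracT.
have w0 i : (0 <= w i)%R by rewrite -lee_fin -gw; apply: integral_ge0 => x _; rewrite lee_fin.
rewrite ge0_integral_tupleS; last 2 first.
- apply/measurable_EFinP/measurable_prod => i _.
  by apply: measurableT_comp => //; exact: measurable_tnth.
- by move=> z; rewrite lee_fin prodr_ge0.
transitivity (\int[mu]_x ((g ord0 x)%:E * (\prod_(i < n) w (lift ord0 i))%:E)).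
  apply: eq_integral => x _.
  rewrite -(IH (fun i => g (lift ord0 i)) (fun i => w (lift ord0 i)))//.
  rewrite -ge0_integralZl//; last 3 first.
  - apply/measurable_EFinP/measurable_prod => i _.
    by apply: measurableT_comp => //; exact: measurable_tnth.
  - by move=> z _; rewrite lee_fin prodr_ge0.
  - by rewrite lee_fin.
  apply: eq_integral => z _; rewrite -EFinM; congr EFin.
  rewrite big_ord_recl /= tnth0; congr (_ * _)%R.
  by apply: eq_bigr => i _; rewrite tnthS.
rewrite ge0_integralZr//; last 3 first.
- exact/measurable_EFinP.
- by move=> x _; rewrite lee_fin.
- by rewrite lee_fin prodr_ge0.
by rewrite gw -EFinM [in RHS]big_ord_recl.
Qed.

Definition opp_tuple n (z : n.-tuple mR) : n.-tuple mR := [tuple of map -%R z].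

Lemma measurable_opp_tuple n : measurable_fun setT (@opp_tuple n).
Proof.
apply/measurable_fun_tnthP => i; rewrite (_ : _ \o _ = -%R \o (fun z => tnth z i)); last first.
  by apply/funext => z; rewrite /= tnth_map.
by apply: measurableT_comp => //; exact: measurable_tnth.
Qed.

(** The first coordinate is reflected by the one-dimensional statement, the others by induction. *)
Lemma ge0_integral_tuple_opp n (f : n.-tuple mR -> \bar R) :
  measurable_fun setT f -> (forall z, 0 <= f z) ->
  \int[lebesgue_tuple n]_z f (opp_tuple z) = \int[lebesgue_tuple n]_z f z.
Proof.
elim: n f => [|n IH] f mf f0.
  by apply: eq_integral => z _; congr f; rewrite tuple0 [RHS]tuple0.
have mfc : measurable_fun setT (f \o @cons_pair R n).
  by apply: measurableT_comp => //; exact: measurable_cons_pair.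
rewrite !ge0_integral_tupleS//; last first.
  by apply: measurableT_comp => //; exact: measurable_opp_tuple.
transitivity (\int[mu]_x \int[lebesgue_tuple n]_z f (cons_pair ((- x)%R, z))).
  apply: eq_integral => x _.
  rewrite -[RHS]IH//; last first.
    by apply: (measurableT_comp mfc); exact: measurable_pair1.
  by apply: eq_integral => z _; congr f; apply: val_inj.
rewrite (ge0_integralT_opp (f := fun x => \int[lebesgue_tuple n]_z f (cons_pair (x, z))))//.
    by apply: (measurable_fun_fubini_tonelli_F _ mfc) => p; exact: f0.
by move=> x; exact: integral_ge0.
Qed.

Lemma integral_tuple_opp n (f : n.-tuple mR -> \bar R) : measurable_fun setT f ->
  \int[lebesgue_tuple n]_z f (opp_tuple z) = \int[lebesgue_tuple n]_z f z.
Proof.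
move=> mf; rewrite [LHS]integralE [RHS]integralE; congr (_ - _).
- rewrite -[RHS]ge0_integral_tuple_opp; last 2 first.
    exact: measurable_funepos.
    by move=> z; rewrite funepos_ge0.
  by apply: eq_integral => z _; rewrite !funeposE.
- rewrite -[RHS]ge0_integral_tuple_opp; last 2 first.
    exact: measurable_funeneg.
    by move=> z; rewrite funeneg_ge0.
  by apply: eq_integral => z _; rewrite !funenegE.
Qed.

End lebesgue_tuple_theory.

Section cells.
Context {R : realType} {N : nat}.
Local Notation mR := (measurableTypeR R).

Definition cell (h : R) (z : N.-tuple mR) : 'rV[int]_N := \row_i fl h (tnth z i).

Lemma cell_preimage h (j : 'rV[int]_N) :
  cell h @^-1` [set j] =
  \bigcap_(i in [set: 'I_N]) ((fun z => tnth z i) @^-1` (fl h @^-1` [set j 0 i])).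
Proof.
apply/seteqP; split=> z /=.
  by move=> <- i _ /=; rewrite /cell mxE.
by move=> zj; apply/rowP => i; rewrite mxE; exact: zj.
Qed.

Lemma measurable_cell_preimage h (j : 'rV[int]_N) : 0 < h ->
  measurable (cell h @^-1` [set j]).
Proof.
move=> h0; rewrite cell_preimage; apply: fin_bigcap_measurable => // i _.
rewrite -[X in measurable X]setTI; apply: measurable_tnth => //.
exact: measurable_fl_preimage.
Qed.

Lemma lebesgue_tuple_cell_preimage h (j : 'rV[int]_N) : 0 < h ->
  lebesgue_tuple N (cell h @^-1` [set j]) = (h ^+ N)%:E.
Proof.
move=> h0; rewrite -[X in lebesgue_tuple N X]setIT -integral_indic//; last first.
  exact: measurable_cell_preimage.
pose g (i : 'I_N) : R -> R := \1_(fl h @^-1` [set j 0 i]).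
transitivity (\int[lebesgue_tuple N]_z (\prod_(i < N) g i (tnth z i))%:E)%E.
  apply: eq_integral => z _; congr EFin; rewrite indicE.
  have [/= zj|zj] := pselect ((cell h @^-1` [set j]) z).
    rewrite mem_set// big1// => i _; rewrite /g indicE mem_set//=.
    by rewrite -zj mxE.
  rewrite memNset//; have [i zi] : exists i, fl h (tnth z i) != j 0 i.
    apply: contrapT => nex; apply: zj => /=; apply/rowP => i; rewrite mxE.
    by apply/eqP; apply/negPn/negP => zi; apply: nex; exists i.
  rewrite (bigD1 i)//= /g indicE memNset ?mul0r//=.
  exact/eqP.
rewrite (@ge0_integral_tuple_prod _ _ _ (fun=> h))//.
- by rewrite prodr_const card_ord.
- by move=> i; apply: measurable_indic; exact: measurable_fl_preimage.
- move=> i; rewrite integral_indic//; last exact: measurable_fl_preimage.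
  by rewrite setIT; exact: lebesgue_fl_preimage.
Qed.

(** This turns a sum over the lattice into the integral of a step function, so that discrete and
    continuous operators live on the same measure space. *)
Lemma ge0_integral_cell h (a : 'rV[int]_N -> R) : 0 < h -> (forall j, 0 <= a j) ->
  (\int[lebesgue_tuple N]_z (a (cell h z))%:E =
   (h ^+ N)%:E * \esum_(j in [set: 'rV[int]_N]) (a j)%:E)%E.
Proof.
move=> h0 a0; apply: ge0_integral_countable_valued => //.
- by move=> j; exact: measurable_cell_preimage.
- by move=> j; exact: lebesgue_tuple_cell_preimage.
Qed.

End cells.


(** * Subordination *)

Section integrable_fine.
Context d (T : measurableType d) (R : realType).

(** Fubini's theorem has extended real inner integrals, whereas an iterated [Rintegral] takes [fine]
    of them; the two agree because an integrable function is finite almost everywhere. *)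
Lemma integrable_fine (mu : {measure set T -> \bar R}) (g : T -> \bar R) :
  mu.-integrable setT g ->
  mu.-integrable setT (fun x => (fine (g x))%:E) /\
  (\int[mu]_x (fine (g x))%:E = \int[mu]_x g x)%E.
Proof.
move=> ig; have mg : measurable_fun setT g by exact: measurable_int ig.
have mf : measurable_fun setT (fun x => (fine (g x))%:E).
  by apply/measurable_EFinP; apply: measurableT_comp mg; exact: fine_measurable.
split.
  apply: le_integrable ig => // x _.
  by case: (g x) => [r| |] //=; rewrite normr0 leey.
apply: ae_eq_integral => //.
have := integrable_ae measurableT ig; apply: filterS => x h _.
by rewrite fineK// h.
Qed.

End integrable_fine.

Section Rintegral_Fubini.
Context d1 d2 (T1 : measurableType d1) (T2 : measurableType d2) (R : realType).

Variables (m1 : {sigma_finite_measure set T1 -> \bar R}).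
Variables (m2 : {sigma_finite_measure set T2 -> \bar R}).
Variable F : T1 -> T2 -> R.
Hypothesis iF : (m1 \x m2)%E.-integrable setT (fun p => (F p.1 p.2)%:E).

Lemma integrable_Rintegral1 : m1.-integrable setT (fun x => (\int[m2]_y F x y)%:E).
Proof. by have [] := integrable_fine (integrable_fubini_F iF). Qed.

Let integrable_G : m2.-integrable setT (fubini_G m1 (fun p => (F p.1 p.2)%:E)).
Proof.
apply/integrableP; split; first exact: (measurable_fubini_G iF).
have mF := measurable_int _ iF.
have /(integrable21ltyP m1 m2 mF) := iF; apply: le_lt_trans.
apply: ge0_le_integral => //.
- by apply: measurableT_comp => //; exact: (measurable_fubini_G iF).
- apply: (@measurable_fun_fubini_tonelli_G _ _ _ _ _ m1 (fun p => `|(F p.1 p.2)%:E|%E)) => //.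
  by apply: measurableT_comp.
- move=> y _; apply: le_abse_integral => //.
  by apply: (measurableT_comp mF); exact: measurable_pair2.
Qed.

Lemma integrable_Rintegral2 : m2.-integrable setT (fun y => (\int[m1]_x F x y)%:E).
Proof. by have [] := integrable_fine integrable_G. Qed.

Lemma Rintegral_Fubini :
  \int[m1]_x \int[m2]_y F x y = \int[m2]_y \int[m1]_x F x y.
Proof.
have [_ h1] := integrable_fine (integrable_fubini_F iF).
have [_ h2] := integrable_fine integrable_G.
by rewrite /Rintegral h1 (Fubini iF) -h2.
Qed.

End Rintegral_Fubini.

Section Rintegral_scale.
Context d (T : measurableType d) (R : realType) (mu : {measure set T -> \bar R}).

(** When the integral is infinite both sides are 0, since [fine] sends infinities to 0. This case
    does occur: at the origin the time integral of the kernels against [theta] diverges. *)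
Lemma ge0_RintegralZl (D : set T) (f : T -> R) (c : R) : measurable D -> measurable_fun D f ->
  (forall x, D x -> 0 <= f x) -> \int[mu]_(x in D) (c * f x) = c * \int[mu]_(x in D) f x.
Proof.
move=> mD mf f0; have mf' : measurable_fun D (EFin \o f) by exact/measurable_EFinP.
have f0' x : D x -> (0 <= (f x)%:E)%E by move=> Dx; rewrite lee_fin f0.
have pos k : 0 <= k -> \int[mu]_(x in D) (k * f x) = k * \int[mu]_(x in D) f x.
  move=> k0; rewrite /Rintegral; under eq_integral do rewrite EFinM.
  rewrite ge0_integralZl//.
  have : (0 <= \int[mu]_(x in D) (f x)%:E)%E by exact: integral_ge0.
  case: (\int[mu]_(x in D) (f x)%:E)%E => [r| |]//= _.
  have [->|k1] := eqVneq k 0; first by rewrite mul0e mul0r.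
  by rewrite gt0_muley ?mulr0// lte_fin lt0r k1.
have [c0|c0] := leP 0 c; first exact: pos.
rewrite -[c]opprK mulNr -pos ?oppr_ge0 1?ltW//.
rewrite /Rintegral.
under eq_integral do rewrite mulNr EFinN.
rewrite integral_ge0N//; first by rewrite fineN.
by move=> x Dx; rewrite lee_fin mulr_ge0 ?f0// oppr_ge0 ltW.
Qed.

End Rintegral_scale.

(** * The weight of the subordination integral *)

Section theta.
Context {R : realType}.
Local Notation mR := (measurableTypeR R).
Local Notation mu := (@lebesgue_measure R).
Implicit Types (a c t x y : R).

Lemma integral_powR c x y : 0 < x -> x < y -> c + 1 != 0 ->
  (\int[mu]_(t in `[x, y]) (t `^ c)%:E = ((y `^ (c + 1) - x `^ (c + 1)) / (c + 1))%:E)%E.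
Proof.
move=> x0 xy c1; pose G t := (c + 1)^-1 * t `^ (c + 1).
have pos t : t \in `[x, y] -> 0 < t by rewrite in_itv/= => /andP[+ _]; exact: lt_le_trans.
have dp b t : 0 < t -> derivable (fun t : R => t `^ b) t 1.
  by move=> t0; apply: derivable_powR; rewrite in_itv/= t0.
have cG t : 0 < t -> {for t, continuous G}.
  move=> t0; apply: differentiable_continuous; apply/derivable1_diffP.
  by apply: derivableM => //; exact: dp.
rewrite (@continuous_FTC2 _ _ G)//.
- by rewrite -EFinB /G -mulrBr mulrC.
- by apply: derivable_within_continuous => t /pos; exact: dp.
- split.
  + move=> t /subset_itv_oo_cc/pos t0; apply: derivableM => //; exact: dp.
  + exact/cvg_at_right_filter/cG.
  + apply/cvg_at_left_filter/cG; exact: lt_trans xy.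
- move=> t /subset_itv_oo_cc/pos t0; rewrite derive1E deriveM//; last exact: dp.
  rewrite derive_cst scaler0 addr0 -derive1E powR_derive1 ?in_itv/= ?t0//.
  by rewrite addrK -[_ *: _]/(_ * _) mulrA mulVf// mul1r.
Qed.

Lemma integral_powR01 a : 0 < a < 1 ->
  (\int[mu]_(t in `]0%R, 1%R]) (t `^ (- a))%:E <= ((1 - a)^-1)%:E)%E.
Proof.
move=> /andP[a0 a1]; have h : - a + 1 != 0 by rewrite addrC subr_eq0 eq_sym lt_eqF.
(* Starting at [n.+2] keeps the endpoints distinct, as [integral_powR] requires. *)
pose F (n : nat) : set mR := `[n.+2%:R^-1, 1]%classic.
have -> : `]0, 1]%classic = \bigcup_n F n.
  apply/seteqP; split => [t|t [n _]]; rewrite /F /= !in_itv/=.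
    move=> /andP[t0 t1]; exists (Num.bound t^-1) => //=; rewrite in_itv/= t1 andbT.
    rewrite invf_ple ?posrE//; apply/ltW.
    by apply: lt_trans (archi_boundP _) _; rewrite ?invr_ge0 ?ltW// ltr_nat.
  by move=> /andP[h1 ->]; rewrite andbT; apply: lt_le_trans h1; rewrite invr_gt0.
have := @ge0_nondecreasing_set_cvg_integral _ _ _ F (fun t => (t `^ (- a))%:E) mu.
move=> /(_ _ _ _ _)/cvg_lim <- //; first last.
- by move=> i t _; rewrite lee_fin powR_ge0.
- move=> i; apply/measurable_EFinP; apply: measurable_funTS; exact: measurable_powR.
- by move=> n; exact: measurable_itv.
- move=> n m nm; apply/subsetPset => t; rewrite /F /= !in_itv/= => /andP[+ ->].
  rewrite andbT; apply: le_trans; rewrite lef_pV2 ?posrE// ler_nat.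
  by rewrite !ltnS.
apply: lime_le.
  apply: ereal_nondecreasing_is_cvgn => n m nm.
  apply: ge0_subset_integral; try exact: measurable_itv.
  - by apply/measurable_EFinP; apply: measurable_funTS; exact: measurable_powR.
  - by move=> t _; rewrite lee_fin powR_ge0.
  - move=> t; rewrite /F /= !in_itv/= => /andP[+ ->].
    by rewrite andbT; apply: le_trans; rewrite lef_pV2 ?posrE// ler_nat !ltnS.
apply: nearW => n; rewrite /F integral_powR// ?invf_lt1 ?ltr1n//.
rewrite lee_fin powR1 (addrC (- a)) ler_pdivrMr ?subr_gt0// mulVf; last first.
  by rewrite addrC.
by rewrite gerBl powR_ge0.
Qed.

Lemma integral_powR1y a : 0 < a ->
  (\int[mu]_(t in `[1%R, +oo[) (t `^ (- (1 + a)))%:E <= (a^-1)%:E)%E.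
Proof.
move=> a0; have h : - (1 + a) + 1 != 0 by rewrite opprD addrAC addNr add0r oppr_eq0 gt_eqF.
pose F (n : nat) : set mR := `[1, n.+2%:R]%classic.
have -> : `[1, +oo[%classic = \bigcup_n F n.
  apply/seteqP; split => [t|t [n _]]; rewrite /F /= !in_itv/= ?andbT.
    move=> t1; exists (Num.bound t) => //=; rewrite in_itv/= t1/=.
    apply/ltW; apply: lt_trans (archi_boundP _) _; first exact: le_trans t1.
    by rewrite ltr_nat.
  by move=> /andP[].
have := @ge0_nondecreasing_set_cvg_integral _ _ _ F (fun t => (t `^ (- (1 + a)))%:E) mu.
move=> /(_ _ _ _ _)/cvg_lim <- //; first last.
- by move=> i t _; rewrite lee_fin powR_ge0.
- move=> i; apply/measurable_EFinP; apply: measurable_funTS; exact: measurable_powR.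
- by move=> n; exact: measurable_itv.
- move=> n m nm; apply/subsetPset => t; rewrite /F /= !in_itv/= => /andP[->].
  by move=> /le_trans; apply; rewrite ler_nat !ltnS.
apply: lime_le.
  apply: ereal_nondecreasing_is_cvgn => n m nm.
  apply: ge0_subset_integral; try exact: measurable_itv.
  - by apply/measurable_EFinP; apply: measurable_funTS; exact: measurable_powR.
  - by move=> t _; rewrite lee_fin powR_ge0.
  - move=> t; rewrite /F /= !in_itv/= => /andP[->].
    by move=> /le_trans; apply; rewrite ler_nat !ltnS.
apply: nearW => n; rewrite /F integral_powR// ?ltr1n//.
rewrite lee_fin powR1 opprD addrAC addNr add0r invrN mulrN -mulNr opprB.
by rewrite ler_pdivrMr// mulVf ?gt_eqF// gerBl powR_ge0.
Qed.

(** The density $t^{-1-a}$, with $a=\sigma/2$ later, extended by zero so that time integrals run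
    over the whole line. *)
Definition theta a t : R := if 0 < t then (t `^ (1 + a))^-1 else 0.

Lemma theta_ge0 a t : 0 <= theta a t.
Proof. by rewrite /theta; case: ifP => // _; rewrite invr_ge0 powR_ge0. Qed.

Lemma measurable_theta a : measurable_fun setT (theta a : mR -> mR).
Proof.
apply: measurable_fun_if => //; first exact: measurable_fun_ltr.
apply: measurable_funTS.
rewrite (_ : (fun x : R => _) = (fun x : R => x `^ (- (1 + a)))).
  exact: measurable_powR.
by apply/funext => x; rewrite powRN.
Qed.

(** Near 0 the minimum leaves $t^{-a}$, integrable since $a<1$; at infinity it leaves $t^{-1-a}$,
    integrable since $a>0$. The factor [Num.max M K] reduces everything to $\min(1,t)$. *)
Lemma integrable_min_theta a (M K : R) : 0 < a < 1 -> 0 <= M -> 0 <= K ->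
  mu.-integrable setT (fun t => (Num.min M (K * t) * theta a t)%:E).
Proof.
move=> a01 M0 K0; have /andP[a0 a1] := a01.
have mW (M' K' : R) : measurable_fun setT (fun t : mR => Num.min M' (K' * t) * theta a t).
  apply: measurable_funM; last exact: measurable_theta.
  by apply: measurable_minr => //; exact: measurable_funM.
suff h : mu.-integrable setT (fun t => (Num.min 1 (1 * t) * theta a t)%:E).
  have := integrableZl measurableT (Num.max M K) h; apply: le_integrable => //.
    by apply/measurable_EFinP; exact: mW.
  move=> t _; rewrite -EFinM !abse_EFin lee_fin mul1r !normrM !(ger0_norm (theta_ge0 _ _)).
  have [t0|t0] := ltP 0 t; last by rewrite /theta ltNge t0 !mulr0.
  rewrite mulrA ler_wpM2r ?theta_ge0//.
  have t0' := ltW t0.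
  rewrite !ger0_norm ?le_min ?le_max ?M0 ?mulr_ge0 ?t0'//; last by rewrite ler01.
  have [t1|t1] := leP 1 t.
    by rewrite mulr1 ge_min le_max lexx.
  by rewrite ge_min ler_wpM2r ?orbT// le_max lexx orbT.
apply/integrableP; split; first by apply/measurable_EFinP; exact: mW.
have W0 t : 0 <= Num.min 1 (1 * t) * theta a t.
  have [t0|t0] := ltP 0 t; last by rewrite /theta ltNge t0 !mulr0.
  by rewrite mulr_ge0 ?theta_ge0// le_min ler01 mul1r ltW.
under eq_integral do rewrite abse_EFin ger0_norm//.
rewrite (_ : setT = `]-oo, 0] `|` (`]0, 1] `|` `]1, +oo[) :> set R); last first.
  apply/seteqP; split => // t _; rewrite /= !in_itv/= andbT.
  by case: (leP t 0) => h1; [left|right; case: (leP t 1) => h2; [left|right]].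
have mWE D : measurable_fun D (fun t : R => (Num.min 1 (1 * t) * theta a t)%:E).
  by apply/measurable_EFinP; apply: measurable_funTS; exact: mW.
rewrite ge0_integral_setU//=; last 4 first.
- exact: measurableU.
- exact: mWE.
- by move=> t _; rewrite lee_fin.
- apply/disj_setPS => t /= []; rewrite !in_itv/= => h [/andP[]|/andP[]] h'.
    by move: h; rewrite leNgt h'.
  by move: h; rewrite leNgt (lt_trans ltr01 h').
rewrite ge0_integral_setU//=; last 3 first.
- exact: mWE.
- by move=> t _; rewrite lee_fin.
- apply/disj_setPS => t /= []; rewrite !in_itv/= andbT => /andP[_] h h'.
  by move: h; rewrite leNgt h'.
rewrite integral0_eq ?add0e; last first.
  by move=> t /=; rewrite in_itv/= => t0; rewrite /theta ltNge t0 mulr0.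
apply: (@le_lt_trans _ _ ((1 - a)^-1%:E + (a^-1)%:E)%E); last by rewrite ltry.
apply: leeD.
  apply: le_trans (integral_powR01 a01).
  apply: ge0_le_integral => //.
  - by move=> t _; rewrite lee_fin.
  - exact: mWE.
  - by apply/measurable_EFinP; apply: measurable_funTS; exact: measurable_powR.
  move=> t /=; rewrite in_itv/= => /andP[t0 t1]; rewrite lee_fin /theta t0 mul1r min_r//.
  rewrite -powRN -[X in X * _](powRr1 (ltW t0)) -powRD.
    by rewrite opprD addrA subrr add0r.
  by rewrite (gt_eqF t0) implybT.
apply: le_trans (integral_powR1y a0).
apply: (@le_trans _ _ (\int[mu]_(t in `[1%R, +oo[) (Num.min 1 (1 * t) * theta a t)%:E)%E).
  apply: ge0_subset_integral => //; first exact: mWE.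
  by move=> t _; rewrite lee_fin.
  by move=> t /=; rewrite !in_itv/= !andbT; exact: ltW.
apply: ge0_le_integral => //.
- by move=> t _; rewrite lee_fin.
- exact: mWE.
- by apply/measurable_EFinP; apply: measurable_funTS; exact: measurable_powR.
move=> t /=; rewrite in_itv/= andbT => t1; have t0 := lt_le_trans ltr01 t1.
by rewrite lee_fin /theta t0 mul1r min_l// mul1r powRN.
Qed.

End theta.

(** * Product kernels integrated against weights of quadratic growth at the origin *)

Section tensor_kernel.
Context {R : realType} {N : nat}.
Local Notation mR := (measurableTypeR R).
Local Notation mu := (@lebesgue_measure R).
Local Notation muN := (@lebesgue_tuple R N).
Implicit Types (t x : R) (z : N.-tuple mR).

(** [Y] is the coordinate in which second moments are measured: the identity for the Gaussian, the
    lattice point of the cell for the walk. Keeping it abstract treats both operators at once. *)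
Variables (Y : R -> R) (p : R -> R -> R).
Hypothesis mY : measurable_fun setT (Y : mR -> mR).
Hypothesis mp : measurable_fun setT (fun q : mR * mR => p q.1 q.2 : mR).
Hypothesis p_ge0 : forall t x, 0 <= p t x.
Hypothesis p_int : forall t, 0 < t -> (\int[mu]_x (p t x)%:E = 1)%E.
Hypothesis p_mom : forall t, 0 < t -> (\int[mu]_x (Y x ^+ 2 * p t x)%:E <= (2 * t)%:E)%E.

Definition tensor t z : R := \prod_(i < N) p t (tnth z i).

Lemma tensor_ge0 t z : 0 <= tensor t z.
Proof. by apply: prodr_ge0. Qed.

Lemma measurable_kernel_section t : measurable_fun setT (p t : mR -> mR).
Proof.
by apply: (measurableT_comp (g := fun x : mR => (t, x)) mp); exact: measurable_pair1.
Qed.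

Lemma measurable_tensor : measurable_fun setT (fun q : mR * N.-tuple mR => tensor q.1 q.2 : mR).
Proof.
apply: measurable_prod => i _.
apply: (measurableT_comp (g := fun q : mR * N.-tuple mR => (q.1, tnth q.2 i)) mp).
apply/measurable_fun_pairP; split; first exact: measurable_fst.
exact: (measurableT_comp (measurable_tnth i) measurable_snd).
Qed.

Lemma measurable_tensor_section t : measurable_fun setT (tensor t : N.-tuple mR -> mR).
Proof.
apply: (measurableT_comp (g := fun z : N.-tuple mR => (t, z)) measurable_tensor).
exact: measurable_pair1.
Qed.

Lemma integral_tensor t : 0 < t -> (\int[muN]_z (tensor t z)%:E = 1)%E.
Proof.
move=> t0; rewrite (@ge0_integral_tuple_prod _ _ (fun=> p t) (fun=> 1))//.
- by rewrite big1.
- by move=> _; exact: measurable_kernel_section.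
- by move=> _; rewrite p_int.
Qed.

Lemma integral_tensor_sqr t (i : 'I_N) : 0 < t ->
  (\int[muN]_z (Y (tnth z i) ^+ 2 * tensor t z)%:E <= (2 * t)%:E)%E.
Proof.
move=> t0; pose g (k : 'I_N) (x : R) := if k == i then Y x ^+ 2 * p t x else p t x.
have mYp : measurable_fun setT (fun x : mR => Y x ^+ 2 * p t x).
  apply: measurable_funM; last exact: measurable_kernel_section.
  exact: measurable_funX.
have I0 : (0 <= \int[mu]_x (Y x ^+ 2 * p t x)%:E)%E.
  by apply: integral_ge0 => x _; rewrite lee_fin mulr_ge0 ?sqr_ge0.
have If : (\int[mu]_x (Y x ^+ 2 * p t x)%:E)%E \is a fin_num.
  by rewrite ge0_fin_numE// (le_lt_trans (p_mom t0)) ?ltry.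
pose w (k : 'I_N) : R := if k == i then fine (\int[mu]_x (Y x ^+ 2 * p t x)%:E)%E else 1.
have : (\int[muN]_z (\prod_(k < N) g k (tnth z k))%:E = (\prod_(k < N) w k)%:E)%E.
  apply: ge0_integral_tuple_prod.
  - by move=> k; rewrite /g; case: eqP => // _; exact: measurable_kernel_section.
  - by move=> k x; rewrite /g; case: eqP => // _; rewrite mulr_ge0 ?sqr_ge0.
  - move=> k; rewrite /g /w; case: eqP => _; last by rewrite p_int.
    by rewrite fineK.
rewrite [in RHS](bigD1 i)//= big1 ?mulr1 /w ?eqxx ?fineK//; last first.
  by move=> k /negPf ->.
move=> h; apply: le_trans (p_mom t0); rewrite -h.
apply: ge0_le_integral => //.
- by move=> z _; rewrite lee_fin mulr_ge0 ?sqr_ge0 ?tensor_ge0.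
- apply/measurable_EFinP; apply: measurable_funM; last exact: measurable_tensor_section.
  apply: measurable_funX; apply: (measurableT_comp mY); exact: measurable_tnth.
- apply/measurable_EFinP/measurable_prod => k _.
  apply: (measurableT_comp (f := g k)); last exact: measurable_tnth.
  by rewrite /g; case: eqP => // _; exact: measurable_kernel_section.
move=> z _; rewrite lee_fin /tensor (bigD1 i)//= [leRHS](bigD1 i)//= mulrA /g eqxx.
rewrite le_eqVlt; apply/orP; left; apply/eqP; congr (_ * _).
by apply: eq_bigr => k /negPf ->.
Qed.

Section weight.
Variables (D : N.-tuple mR -> R) (M C : R).
Hypothesis mD : measurable_fun setT (D : N.-tuple mR -> mR).
Hypothesis M0 : 0 <= M.
Hypothesis C0 : 0 <= C.
Hypothesis D_M : forall z, `|D z| <= M.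
Hypothesis D_C : forall z, `|D z| <= C * \sum_(i < N) Y (tnth z i) ^+ 2.

Let mDt t : measurable_fun setT (fun z : N.-tuple mR => D z * tensor t z : mR).
Proof. by apply: measurable_funM => //; exact: measurable_tensor_section. Qed.

Let mDt' t : measurable_fun setT (fun z : N.-tuple mR => `|D z| * tensor t z : mR).
Proof.
apply: measurable_funM; last exact: measurable_tensor_section.
exact: measurableT_comp.
Qed.

(** The first bound comes from total mass one, the second from the moment $2t$ of each of the [N]
    coordinates. *)
Lemma integral_weight_le t : 0 < t ->
  (\int[muN]_z (`|D z| * tensor t z)%:E <= (Num.min M (2 * N%:R * C * t))%:E)%E.
Proof.
move=> t0; rewrite EFin_min le_min; apply/andP; split.
  apply: (@le_trans _ _ (\int[muN]_z (M%:E * (tensor t z)%:E))%E).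
    apply: ge0_le_integral => //.
    - by move=> z _; rewrite lee_fin mulr_ge0 ?tensor_ge0.
    - by apply/measurable_EFinP; exact: mDt'.
    - apply/measurable_EFinP; apply: measurable_funM => //; exact: measurable_tensor_section.
    - by move=> z _; rewrite -EFinM lee_fin ler_wpM2r ?tensor_ge0.
  rewrite ge0_integralZl ?lee_fin//.
  - by rewrite integral_tensor// mule1.
  - by apply/measurable_EFinP; exact: measurable_tensor_section.
  - by move=> z _; rewrite lee_fin tensor_ge0.
have mi (i : 'I_N) : measurable_fun setT (fun z : N.-tuple mR => Y (tnth z i) ^+ 2 * tensor t z : mR).
  apply: measurable_funM; last exact: measurable_tensor_section.
  apply: measurable_funX; apply: (measurableT_comp mY); exact: measurable_tnth.
apply: (@le_trans _ _ (\int[muN]_z (C%:E * (\sum_(i < N) (Y (tnth z i) ^+ 2 * tensor t z)%:E)))%E).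
  apply: ge0_le_integral => //.
  - by move=> z _; rewrite lee_fin mulr_ge0 ?tensor_ge0.
  - by apply/measurable_EFinP; exact: mDt'.
  - by apply: measurable_funeM; apply: emeasurable_sum => i; apply/measurable_EFinP; exact: mi.
  - move=> z _; rewrite sumEFin -EFinM lee_fin -mulr_suml mulrA ler_wpM2r ?tensor_ge0//.
rewrite ge0_integralZl ?lee_fin//; last 2 first.
- by apply: emeasurable_sum => i; apply/measurable_EFinP; exact: mi.
- by move=> z _; apply: sume_ge0 => i _; rewrite lee_fin mulr_ge0 ?sqr_ge0 ?tensor_ge0.
rewrite ge0_integral_sum//; last 2 first.
- by move=> i; apply/measurable_EFinP; exact: mi.
- by move=> i z _; rewrite lee_fin mulr_ge0 ?sqr_ge0 ?tensor_ge0.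
apply: (@le_trans _ _ (C%:E * \sum_(i < N) (2 * t)%:E)%E).
  apply: lee_wpmul2l; first by rewrite lee_fin.
  by apply: lee_sum => i _; exact: integral_tensor_sqr.
rewrite sumEFin -EFinM lee_fin sumr_const card_ord.
by rewrite le_eqVlt; apply/orP; left; apply/eqP; rewrite -mulr_natr; ring.
Qed.

Lemma integrable_weight t : 0 < t -> muN.-integrable setT (fun z => (D z * tensor t z)%:E).
Proof.
move=> t0; apply/integrableP; split.
  by apply/measurable_EFinP; exact: mDt.
under eq_integral do rewrite abse_EFin normrM (ger0_norm (tensor_ge0 _ _)).
by apply: le_lt_trans (integral_weight_le t0) _; rewrite ltry.
Qed.

Lemma norm_Rintegral_weight_le t : 0 < t ->
  `|\int[muN]_z (D z * tensor t z)| <= Num.min M (2 * N%:R * C * t).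
Proof.
move=> t0; apply: le_trans (le_normr_Rintegral measurableT (integrable_weight t0)) _.
rewrite -lee_fin; apply: le_trans (integral_weight_le t0).
under eq_Rintegral do rewrite normrM (ger0_norm (tensor_ge0 _ _)).
rewrite /Rintegral fineK// ge0_fin_numE.
  by rewrite (le_lt_trans (integral_weight_le t0)) ?ltry.
by apply: integral_ge0 => z _; rewrite lee_fin mulr_ge0 ?tensor_ge0.
Qed.

Variable a : R.
Hypothesis a01 : 0 < a < 1.

(** By Tonelli, integrating in [z] first: the inner integral is at most
    [Num.min M (2 * N%:R * C * t)], which is integrable against [theta]. This is the absolute
    convergence behind every exchange of integrals below. *)
Lemma integrable_weight_theta : (mu \x muN)%E.-integrable setT
  (fun q => (D q.2 * (tensor q.1 q.2 * theta a q.1))%:E).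
Proof.
apply/(integrable12ltyP mu muN).
  apply/measurable_EFinP; apply: measurable_funM.
    by apply: (measurableT_comp mD); exact: measurable_snd.
  apply: measurable_funM; first exact: measurable_tensor.
  by apply: (measurableT_comp (measurable_theta a)); exact: measurable_fst.
have C0' : 0 <= 2 * N%:R * C by rewrite !mulr_ge0.
have iW := integrable_min_theta a01 M0 C0'.
have /integrableP[mW] := iW; apply: le_lt_trans.
apply: ge0_le_integral => //.
- by move=> t _; apply: integral_ge0.
- apply: (@measurable_fun_fubini_tonelli_F _ _ _ _ _ muN
     (fun q => `|(D q.2 * (tensor q.1 q.2 * theta a q.1))%:E|%E)) => //.
  apply: measurableT_comp => //.
  apply/measurable_EFinP; apply: measurable_funM.
    by apply: (measurableT_comp mD); exact: measurable_snd.
  apply: measurable_funM; first exact: measurable_tensor.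
  by apply: (measurableT_comp (measurable_theta a)); exact: measurable_fst.
- exact: measurableT_comp.
move=> t _ /=.
have [t0|t0] := ltP 0 t; last first.
  rewrite integral0_eq ?lee_fin//.
  by move=> z _; rewrite /theta ltNge t0 !mulr0 normr0.
rewrite normrM (ger0_norm (theta_ge0 _ _)).
under eq_integral do rewrite mulrA normrM (ger0_norm (theta_ge0 _ _)) EFinM.
rewrite ge0_integralZr//; last 2 first.
- apply/measurable_EFinP; exact: (measurableT_comp (@normr_measurable _ setT) (mDt t)).
- by rewrite lee_fin theta_ge0.
rewrite EFinM; apply: lee_wpmul2r; first by rewrite lee_fin theta_ge0.
under eq_integral do rewrite normrM (ger0_norm (tensor_ge0 _ _)).
apply: le_trans (integral_weight_le t0) _.
by rewrite lee_fin ler_norm.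
Qed.

Let swapF (t : mR) (z : N.-tuple mR) : R := D z * (tensor t z * theta a t).

Lemma measurable_tensor_theta z : measurable_fun setT (fun t : mR => tensor t z * theta a t : mR).
Proof.
apply: measurable_funM; last exact: measurable_theta.
apply: (measurableT_comp (g := fun t : mR => (t, z)) measurable_tensor); exact: measurable_pair2.
Qed.

Lemma tensor_theta_ge0 t z : 0 <= tensor t z * theta a t.
Proof. by rewrite mulr_ge0 ?tensor_ge0 ?theta_ge0. Qed.

Let swapE z : \int[mu]_t swapF t z = D z * \int[mu]_t (tensor t z * theta a t).
Proof.
apply: ge0_RintegralZl => //; first exact: measurable_tensor_theta.
by move=> t _; exact: tensor_theta_ge0.
Qed.

Lemma integrable_weight_kernel :
  muN.-integrable setT (fun z => (D z * \int[mu]_t (tensor t z * theta a t))%:E).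
Proof.
under eq_fun do rewrite -swapE.
exact: (integrable_Rintegral2 (T1 := mR) (m1 := mu) (m2 := muN) (F := swapF) integrable_weight_theta).
Qed.

Lemma integrable_theta_weight :
  mu.-integrable setT (fun t => ((\int[muN]_z (D z * tensor t z)) * theta a t)%:E).
Proof.
have h := integrable_Rintegral1 (T1 := mR) (m1 := mu) (m2 := muN) (F := swapF) integrable_weight_theta.
apply: eq_integrable h => // t _; congr EFin.
rewrite /swapF; under eq_Rintegral do rewrite mulrA.
have [t0|t0] := ltP 0 t; first by rewrite RintegralZr//; exact: integrable_weight.
rewrite /theta ltNge t0 mulr0; under eq_Rintegral do rewrite mulr0.
by rewrite /Rintegral integral0.
Qed.

(** The subordination formula: the jump kernel on the left is the time integral of the transition
    kernels on the right. *)
Lemma Rintegral_weight_kernel :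
  \int[muN]_z (D z * \int[mu]_t (tensor t z * theta a t)) =
  \int[mu]_t ((\int[muN]_z (D z * tensor t z)) * theta a t).
Proof.
under eq_Rintegral do rewrite -swapE.
rewrite -(Rintegral_Fubini (T1 := mR) (m1 := mu) (m2 := muN) (F := swapF))//; last exact: integrable_weight_theta.
apply: eq_Rintegral => t _; rewrite /swapF; under eq_Rintegral do rewrite mulrA.
have [t0|t0] := ltP 0 t; first by rewrite RintegralZr//; exact: integrable_weight.
rewrite /theta ltNge t0 mulr0; under eq_Rintegral do rewrite mulr0.
by rewrite /Rintegral integral0.
Qed.

End weight.
End tensor_kernel.

(** * The local limit theorem *)

Section cauchy_weight.
Context {R : realType}.
Local Notation mR := (measurableTypeR R).
Local Notation mu := (@lebesgue_measure R).

Lemma integral_oneDsqrV : (\int[mu]_x ((1 + x ^+ 2)^-1)%:E = pi%:E)%E.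
Proof.
rewrite (@ge0_symfun_integralT _ (fun x : R => (1 + x ^+ 2)^-1)).
- rewrite (_ : [set x | 0 <= x] = `[0, +oo[%classic); last first.
    by apply/seteqP; split => x /=; rewrite in_itv/= andbT.
  have := @integral0y_oneDsqr R; rewrite /oneDsqr => ->.
  by rewrite -EFinM mulrCA mulfV ?mulr1.
- by move=> x; rewrite invr_ge0 addr_ge0// sqr_ge0.
- exact: continuous_oneDsqrV.
- by move=> x; rewrite /= sqrrN.
Qed.

Lemma measurable_oneDsqrV : measurable_fun setT (fun x : mR => (1 + x ^+ 2)^-1 : mR).
Proof. apply: continuous_measurable_fun; exact: continuous_oneDsqrV. Qed.

Lemma integrable_oneDsqrV : mu.-integrable setT (fun x => ((1 + x ^+ 2)^-1)%:E).
Proof.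
apply/integrableP; split; first by apply/measurable_EFinP; exact: measurable_oneDsqrV.
under eq_integral do rewrite abse_EFin ger0_norm ?invr_ge0 ?addr_ge0 ?sqr_ge0//.
by rewrite integral_oneDsqrV ltry.
Qed.

End cauchy_weight.

(** * The walk kernel: mass and second moment *)

Section lattice_kernel.
Context {R : realType}.
Local Notation mR := (measurableTypeR R).
Local Notation mu := (@lebesgue_measure R).
Implicit Types (h t s x : R).

Lemma measurable_bes m : measurable_fun [set s : mR | 0 <= s] (bes m : mR -> mR).
Proof.
apply: (@measurable_fun_cvg _ _ _ _ (fun n s => series (bessel_coef m s) n)).
  by move=> n; apply: measurable_sum => k; apply: measurable_funM.
by move=> s s0; exact: is_cvg_bessel.
Qed.

(* The law at time [t] of the random walk on [h]Z generated by the discrete Laplacian, with each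
   atom spread uniformly over a cell of length [h]; [bes m s] is [besselI m (2 * s)]. *)
Definition lattice_kernel h t x : R :=
  if 0 < t then expR (- (2 * (t / h ^+ 2))) * bes `|fl h x|%N (t / h ^+ 2) / h else 0.

Lemma lattice_kernel_ge0 h t x : 0 < h -> 0 <= lattice_kernel h t x.
Proof.
move=> h0; rewrite /lattice_kernel; case: ifP => // t0.
by rewrite mulr_ge0 ?invr_ge0 ?(ltW h0)// mulr_ge0 ?expR_ge0 ?bes_ge0// divr_ge0 ?ltW// exprn_gt0.
Qed.

Lemma measurable_lattice_kernel h : 0 < h ->
  measurable_fun setT (fun q : mR * mR => lattice_kernel h q.1 q.2 : mR).
Proof.
move=> h0.
apply: (@measurable_fun_countable_valued _ mR _ (fl h) _ _ _ _ _ (fun (m : int) (t : mR) =>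
  (if 0 < t then expR (- (2 * (t / h ^+ 2))) * bes `|m|%N (t / h ^+ 2) / h else 0) : mR)).
  by move=> m; exact: measurable_fl_preimage.
move=> m; apply: measurable_fun_if => //; first exact: measurable_fun_ltr.
apply: measurable_funM => //; apply: measurable_funM.
  apply: measurable_funTS; apply: measurableT_comp => //.
  by apply: measurableT_comp => //; apply: measurable_funM => //; apply: measurable_funM.
apply: (measurable_comp (F := [set s : mR | 0 <= s]) _ _ (measurable_bes `|m|%N)).
- by rewrite -set_itvcy; exact: measurable_itv.
- by move=> _ [t /= [_ t0] <-] /=; rewrite divr_ge0 ?exprn_ge0 ?ltW.
- by apply: measurable_funM.
Qed.

Let integral_lattice h t (a : int -> R) : 0 < h -> (forall m, 0 <= a m) ->
  (\int[mu]_x (a (fl h x))%:E = h%:E * \esum_(m in [set: int]) (a m)%:E)%E.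
Proof.
move=> h0 a0; rewrite (@ge0_integral_countable_valued _ mR _ (fl h) _ _ mu h a)//.
- by move=> m; exact: measurable_fl_preimage.
- by move=> m; exact: lebesgue_fl_preimage.
Qed.

Lemma integral_lattice_kernel h t : 0 < h -> 0 < t ->
  (\int[mu]_x (lattice_kernel h t x)%:E = 1)%E.
Proof.
move=> h0 t0; rewrite /lattice_kernel t0; set s := t / _.
have s0 : 0 <= s by rewrite divr_ge0 ?exprn_ge0 ?ltW.
have k0 : 0 <= expR (- (2 * s)) / h by rewrite divr_ge0 ?expR_ge0 ?ltW.
pose a (m : int) : R := expR (- (2 * s)) / h * bes `|m|%N s.
rewrite (_ : (fun x => _) = (fun x => (a (fl h x))%:E)); last first.
  by apply/funext => x; rewrite /a mulrAC.
rewrite integral_lattice//; last by move=> m; rewrite mulr_ge0 ?bes_ge0.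
under eq_esum do rewrite /a EFinM.
rewrite esumZl//; last by move=> m; rewrite lee_fin bes_ge0.
rewrite esum_bes// -!EFinM expRN mulrA mulrCA mulfV ?gt_eqF// mulr1.
by rewrite mulVf// gt_eqF ?expR_gt0.
Qed.

(** The moment is taken at the lattice point of the cell and not at [x]: spreading the atoms adds
    $h^2/3$ to the variance, which would destroy a bound linear in $t$ near $t=0$. *)
Lemma integral_sqr_lattice_kernel h t : 0 < h -> 0 < t ->
  (\int[mu]_x ((h * (fl h x)%:~R) ^+ 2 * lattice_kernel h t x)%:E <= (2 * t)%:E)%E.
Proof.
move=> h0 t0; rewrite /lattice_kernel t0; set s := t / _.
have s0 : 0 <= s by rewrite divr_ge0 ?exprn_ge0 ?ltW.
have k0 : 0 <= h * expR (- (2 * s)) by rewrite mulr_ge0 ?expR_ge0 ?ltW.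
pose a (m : int) : R := h * expR (- (2 * s)) * (`|m|%N%:R ^+ 2 * bes `|m|%N s).
rewrite (_ : (fun x => _) = (fun x => (a (fl h x))%:E)); last first.
  apply/funext => x; rewrite /a natr_absz intr_norm real_normK ?num_real//.
  by congr EFin; field; rewrite gt_eqF.
rewrite integral_lattice//; last first.
  by move=> m; rewrite mulr_ge0 // mulr_ge0 ?bes_ge0// exprn_ge0.
under eq_esum do rewrite /a EFinM.
rewrite esumZl//; last first.
  by move=> m; rewrite lee_fin mulr_ge0 ?bes_ge0// exprn_ge0.
rewrite muleA -EFinM.
apply: (@le_trans _ _ ((h * (h * expR (- (2 * s))))%:E * (2 * s * expR (2 * s))%:E)%E).
  by apply: lee_wpmul2l (esum_sqr_bes s0); rewrite lee_fin mulr_ge0// ltW.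
rewrite -EFinM lee_fin expRN /s le_eqVlt; apply/orP; left; apply/eqP.
have := expR_gt0 (2 * (t / h ^+ 2)); move: (expR _) => X X0.
by field; rewrite !gt_eqF.
Qed.

End lattice_kernel.

Section gauss_kernel.
Context {R : realType}.
Local Notation mR := (measurableTypeR R).
Local Notation mu := (@lebesgue_measure R).
Implicit Types (t x : R).

Definition gauss_kernel t x : R :=
  if 0 < t then expR (- (x ^+ 2 / (4 * t))) / Num.sqrt (4 * t * pi) else 0.

Lemma gauss_kernel_ge0 t x : 0 <= gauss_kernel t x.
Proof. by rewrite /gauss_kernel; case: ifP => // _; rewrite divr_ge0 ?expR_ge0 ?sqrtr_ge0. Qed.

Lemma measurable_gauss_kernel :
  measurable_fun setT (fun q : mR * mR => gauss_kernel q.1 q.2 : mR).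
Proof.
apply: measurable_fun_if => //.
  by apply: measurable_fun_ltr => //; exact: measurable_fst.
have m1 : measurable_fun setT (fun q : mR * mR => q.1) by exact: measurable_fst.
have m2 : measurable_fun setT (fun q : mR * mR => q.2) by exact: measurable_snd.
apply: (@eq_measurable_fun _ _ _ _ _ (fun q : mR * mR =>
    expR (- (q.2 ^+ 2 * (4 * q.1) `^ (- 1))) * (4 * q.1 * pi) `^ (- 2^-1))).
  move=> q; rewrite inE => -[_ /= q0].
  have q4 : 0 <= 4 * q.1 by rewrite mulr_ge0// ltW.
  by rewrite powR_inv1// powRN powR12_sqrt// mulr_ge0// pi_ge0.
apply: measurable_funTS; apply: measurable_funM.
  apply: measurableT_comp => //; apply: measurableT_comp => //.
  apply: measurable_funM; first exact: measurable_funX.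
  apply: (measurableT_comp (measurable_powR _)); exact: measurable_funM.
apply: (measurableT_comp (measurable_powR _)).
by apply: measurable_funM => //; exact: measurable_funM.
Qed.

Lemma integral_exp_sqr t : 0 < t ->
  (\int[mu]_x (expR (- (x ^+ 2 / (4 * t))))%:E = (Num.sqrt (4 * t * pi))%:E)%E.
Proof.
move=> t0; have t4 : 0 < 4 * t by rewrite mulr_gt0.
have c0 : 0 < (Num.sqrt (4 * t))^-1 by rewrite invr_gt0 sqrtr_gt0.
transitivity (\int[mu]_x (EFin \o gauss_fun) ((Num.sqrt (4 * t))^-1 * x)%R)%E.
  apply: eq_integral => x _; congr EFin; congr expR.
  by rewrite exprMn exprVn sqr_sqrtr ?ltW// mulrC.
rewrite (ge0_integralT_scale (f := EFin \o gauss_fun))//.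
- by rewrite integralT_gauss invrK -EFinM (sqrtrM _ (ltW t4)).
- by apply/measurable_EFinP; exact: measurable_gauss_fun.
- by move=> x; rewrite lee_fin gauss_fun_ge0.
Qed.

Lemma integral_gauss_kernel t : 0 < t -> (\int[mu]_x (gauss_kernel t x)%:E = 1)%E.
Proof.
move=> t0; have c0 : 0 < Num.sqrt (4 * t * pi) by rewrite sqrtr_gt0 !mulr_gt0// pi_gt0.
rewrite /gauss_kernel t0; under eq_integral do rewrite EFinM.
rewrite ge0_integralZr//.
- by rewrite integral_exp_sqr// -EFinM mulfV// gt_eqF.
- apply/measurable_EFinP; apply: measurableT_comp => //; apply: measurableT_comp => //.
  by apply: measurable_funM => //; exact: measurable_funX.
Qed.

End gauss_kernel.

(** * Convergence of the walk kernel to the Gaussian at a fixed time *)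

Section local_limit.
Context {R : realType}.
Local Notation mR := (measurableTypeR R).
Local Notation mu := (@lebesgue_measure R).
Variables (h : R^nat) (t : R).
Hypothesis h_gt0 : forall n, 0 < h n.
Hypothesis h_le1 : forall n, h n <= 1.
Hypothesis h_cvg : h @ \oo --> 0.
Hypothesis t0 : 0 < t.

Let s n := t / h n ^+ 2.
Let s0 n : 0 < s n. Proof. by rewrite divr_gt0// exprn_gt0. Qed.
Let hn0 n : h n != 0. Proof. by rewrite gt_eqF. Qed.
Let tn0 : t != 0. Proof. by rewrite gt_eqF. Qed.
Let m x n := `|fl (h n) x|%N.
Let u x n := h n * (m x n)%:R.
Let u0 x n : 0 <= u x n. Proof. by rewrite mulr_ge0// ltW. Qed.

Let u_cvg x : u x @ \oo --> `|x|.
Proof.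
apply: (@squeeze_cvgr _ _ _ _ (fun n => `|x| - h n) (fun n => `|x| + h n)).
- apply: nearW => n; have := norm_fl_dist x (h_gt0 n); rewrite ler_norml => /andP[].
  rewrite -/(m x n) -/(u x n) => h1 h2; apply/andP; split; lra.
- by rewrite -[X in _ --> X]subr0; apply: cvgB => //; exact: cvg_cst.
- by rewrite -[X in _ --> X]addr0; apply: cvgD => //; exact: cvg_cst.
Qed.

(** The kernel is split into a shape [Q], equal to 1 on the cells of index 0, and a factor [W]
    independent of [x]. *)
Let Q x n := bes (m x n) (s n) / bes 0 (s n).
Let W n := expR (- (2 * s n)) * bes 0 (s n) / h n.

Let kernelE x n : lattice_kernel (h n) t x = W n * Q x n.
Proof.
rewrite /lattice_kernel t0 -/(s n) -/(m x n) /W /Q.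
by field; rewrite hn0 gt_eqF// bes_gt0.
Qed.

Let W_gt0 n : 0 < W n.
Proof. by rewrite divr_gt0// mulr_gt0 ?expR_gt0 ?bes_gt0. Qed.

Let Q_ge0 x n : 0 <= Q x n.
Proof. by rewrite divr_ge0// bes_ge0 ?ltW. Qed.

(** In the variables $u=hm$ and $s=t/h^2$ the bounds on $I_m/I_0$ have exponents $u(u\pm h)/(4t)$
    with corrections of size $u^3h/t^2$; both sides of the squeeze follow from $u\to|x|$. *)
Let Q_cvg x : Q x @ \oo --> expR (- (x ^+ 2 / (4 * t))).
Proof.
pose l n := expR (- (u x n * (u x n + h n) / (4 * t) + u x n ^+ 3 * h n / (2 * t ^+ 2))).
pose r n := expR (- (u x n * (u x n - h n) / (4 * t)) + u x n ^+ 3 * h n / (8 * t ^+ 2)).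
have cE (v : R^nat) (y : R) : v @ \oo --> y -> expR (v n) @[n --> \oo] --> expR y.
  by move=> vy; apply: continuous_cvg => //; exact: continuous_expR.
have ux := @u_cvg x.
have e3 k : u x n ^+ 3 * h n / k @[n --> \oo] --> 0.
  rewrite -(mul0r k^-1); apply: cvgMl; rewrite -(mulr0 (`|x| ^+ 3)).
  apply: cvgM => //; rewrite !exprS expr0 mulr1.
  under eq_fun do rewrite !exprS expr0 mulr1.
  by do 2 (apply: cvgM => //).
have x2 : `|x| * `|x| = x ^+ 2 by rewrite -expr2 real_normK ?num_real.
apply: (@squeeze_cvgr _ _ _ _ l r).
(* This is the condition $m\le s$ of the lower bound [bes_quot_ge]. *)
- have : \forall n \near \oo, u x n * h n <= t.
    have : u x n * h n @[n --> \oo] --> 0 by rewrite -(mulr0 `|x|); exact: cvgM.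
    by move=> /cvgr_lt/(_ _ t0); apply: filterS => n; exact: ltW.
  apply: filterS => n hn.
  have ms : (m x n)%:R <= s n.
    rewrite ler_pdivlMr ?exprn_gt0//; apply: le_trans hn.
    by rewrite /u le_eqVlt; apply/orP; left; apply/eqP; ring.
  apply/andP; split.
    apply: le_trans (bes_quot_ge (s0 n) ms).
    rewrite ler_expR lerN2 -natr1 le_eqVlt; apply/orP; left; apply/eqP.
    by rewrite /u /s; field; rewrite hn0 tn0.
  apply: le_trans (bes_quot_le (s0 n) _) _.
  rewrite ler_expR le_eqVlt; apply/orP; left; apply/eqP.
  by rewrite /u /s; field; rewrite hn0 tn0.
- apply: cE; apply: cvgN; rewrite -[X in _ --> X]addr0; apply: cvgD => //.
  apply: cvgMl; rewrite -x2; apply: cvgM => //.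
  by rewrite -[X in _ --> X]addr0; apply: cvgD.
- apply: cE; rewrite -[X in _ --> X]addr0; apply: cvgD => //.
  apply: cvgN; apply: cvgMl; rewrite -x2; apply: cvgM => //.
  by rewrite -[X in _ --> X]subr0; apply: cvgB.
Qed.

(** For $|x|\le4$ the summand 17 bounds $1+x^2$. For $|x|>4$ and $h\le1$ one has $u\ge\frac34|x|$
    and $u-h\ge\frac12|x|$, so $u(u-h)/(4t)\ge 3x^2/(32t)$, and $11t\ge 32t/3$ compensates the
    factor. *)
Let Cst : R := 17 + 11 * t.

Let Q_le x n : Q x n <= Cst * (1 + x ^+ 2)^-1.
Proof.
have t4 : 0 < 4 * t by rewrite mulr_gt0.
have xx : 0 < 1 + x ^+ 2 by rewrite ltr_pwDl// sqr_ge0.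
have h1 := h_gt0 n; have h2 := h_le1 n.
have uxn : `|x| - h n <= u x n.
  have := norm_fl_dist x (h_gt0 n); rewrite ler_norml => /andP[].
  rewrite -/(m x n) -/(u x n) => h3 h4; lra.
have E : (m x n)%:R * ((m x n)%:R - 1) / (4 * s n) = u x n * (u x n - h n) / (4 * t).
  by rewrite /u /s; field; rewrite hn0 tn0.
have nx := normr_ge0 x.
have x2 : x ^+ 2 = `|x| * `|x| by rewrite -expr2 real_normK ?num_real.
have mm : 0 <= (m x n)%:R * ((m x n)%:R - 1) / (4 * s n).
  apply: divr_ge0; last by rewrite mulr_ge0// ltW.
  by case: (m x n) => [|k]; rewrite ?mul0r// mulr_ge0// -natr1 addrK.
apply: le_trans (bes_quot_leV (s0 n) _) _; rewrite -/(m x n).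
rewrite -[leLHS]mul1r ler_pdivrMr; last by rewrite ltr_pwDl.
rewrite mulrAC ler_pdivlMr// mul1r.
have [x4|x4] := leP `|x| 4.
  apply: (@le_trans _ _ (Cst * 1)); last first.
    apply: ler_wpM2l; last by rewrite lerDl.
    by rewrite addr_ge0// mulr_ge0// ltW.
  rewrite mulr1 /Cst x2; nra.
rewrite E.
have : 3 / 8 * x ^+ 2 <= u x n * (u x n - h n).
  rewrite x2; move: (u x n) (`|x|) uxn x4 h1 h2 => v y ? ? ? ?.
  apply: (@le_trans _ _ ((3 / 4 * y) * (1 / 2 * y))); first by lra.
  by apply: ler_pM; lra.
move=> h5; apply: (@le_trans _ _ (Cst * (1 + (3 / 8 * x ^+ 2) / (4 * t)))); last first.
  apply: ler_wpM2l; first by rewrite addr_ge0// mulr_ge0// ltW.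
  by rewrite lerD2l ler_pM2r// invr_gt0.
rewrite mulrDr mulr1; apply: lerD; first by rewrite /Cst; lra.
rewrite mulrA ler_pdivlMr// /Cst.
have := sqr_ge0 x; move: (x ^+ 2) => z z0; nra.
Qed.

Let mQ n : measurable_fun setT (fun x : mR => Q x n : mR).
Proof.
apply: (@measurable_fun_countable_valued1 _ mR _ (fl (h n)) _ _ mR
  (fun k : int => bes `|k|%N (s n) / bes 0 (s n) : mR)).
by move=> k; exact: measurable_fl_preimage.
Qed.

(** Since the kernel has mass one, [(W n)^-1] is the integral of [Q], which converges by domination
    to the Gaussian integral $\sqrt{4\pi t}$. *)
Let W_cvg : W @ \oo --> (Num.sqrt (4 * t * pi))^-1.
Proof.
have c0 : 0 < Num.sqrt (4 * t * pi) by rewrite sqrtr_gt0 !mulr_gt0// pi_gt0.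
have IQ n : (\int[mu]_x (Q x n)%:E = ((W n)^-1)%:E)%E.
  have := integral_lattice_kernel (h_gt0 n) t0.
  under eq_integral do rewrite kernelE EFinM.
  rewrite ge0_integralZl//; last 3 first.
  - by apply/measurable_EFinP; exact: mQ.
  - by move=> x _; rewrite lee_fin.
  - by rewrite lee_fin ltW.
  have : (0 <= \int[mu]_x (Q x n)%:E)%E by apply: integral_ge0 => x _; rewrite lee_fin.
  case: (\int[mu]_x (Q x n)%:E)%E => [r| |]//=.
    move=> r0 /eqP; rewrite -EFinM eqe => /eqP e; congr EFin.
    by rewrite -[LHS](mulKf (lt0r_neq0 (W_gt0 n))) e mulr1.
  by rewrite gt0_muley ?lte_fin.
suff : (W n)^-1 @[n --> \oo] --> Num.sqrt (4 * t * pi).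
  move=> h1; rewrite (_ : W = (fun n => ((W n)^-1)^-1)); last first.
    by apply/funext => n; rewrite invrK.
  by apply: cvgV => //; rewrite gt_eqF.
suff /fine_cvg : ((W n)^-1)%:E @[n --> \oo] --> (Num.sqrt (4 * t * pi))%:E by [].
rewrite -integral_exp_sqr//; under eq_fun do rewrite -IQ.
apply: (@dominated_cvg _ _ _ mu setT measurableT _ _
    (fun x => Cst%:E * ((1 + x ^+ 2)^-1)%:E)%E).
- by move=> n; apply/measurable_EFinP; exact: mQ.
- by move=> x _; apply: cvg_EFin; [exact: nearW|exact: Q_cvg].
- by [].
- by apply: integrableZl => //; exact: integrable_oneDsqrV.
- by move=> n x _; rewrite abse_EFin -EFinM lee_fin ger0_norm.
Qed.

Lemma lattice_kernel_cvg x : lattice_kernel (h n) t x @[n --> \oo] --> gauss_kernel t x.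
Proof.
under eq_fun do rewrite kernelE.
by rewrite /gauss_kernel t0 mulrC; exact: (cvgM W_cvg (@Q_cvg x)).
Qed.

Lemma lattice_kernel_le : exists C : R,
  forall n x, lattice_kernel (h n) t x <= C * (1 + x ^+ 2)^-1.
Proof.
have cW : cvgn W by apply/cvg_ex; exists (Num.sqrt (4 * t * pi))^-1; exact: W_cvg.
have [M [_ hM]] := cvg_seq_bounded cW.
exists ((M + 1) * Cst) => n x; rewrite kernelE -[leRHS]mulrA.
apply: ler_pM => //; first exact: ltW.
by apply: le_trans (ler_norm _) _; apply: hM => //; rewrite ltrDl.
Qed.

End local_limit.

Section gauss_moment.
Context {R : realType}.
Local Notation mR := (measurableTypeR R).
Local Notation mu := (@lebesgue_measure R).

Lemma cvg_lattice_point (h : R^nat) (x : R) : (forall n, 0 < h n) -> h @ \oo --> 0 ->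
  h n * (fl (h n) x)%:~R @[n --> \oo] --> x.
Proof.
move=> h0 hc; apply: (@squeeze_cvgr _ _ _ _ (fun n => x - h n) (fun n => x + h n)).
- apply: nearW => n; have := fl_dist x (h0 n); rewrite ler_norml => /andP[] h1 h2.
  by apply/andP; split; lra.
- by rewrite -[X in _ --> X]subr0; apply: cvgB => //; exact: cvg_cst.
- by rewrite -[X in _ --> X]addr0; apply: cvgD => //; exact: cvg_cst.
Qed.

Lemma measurable_lattice_point (h : R) : 0 < h ->
  measurable_fun setT (fun x : mR => h * (fl h x)%:~R : mR).
Proof.
move=> h0; apply: (@measurable_fun_countable_valued1 _ mR _ (fl h) _ _ mR
  (fun k : int => h * k%:~R : mR)).
by move=> k; exact: measurable_fl_preimage.
Qed.

(** Inherited from the walk: Fatou's lemma along the meshes $1/(n+1)$ passes the uniform bound $2t$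
    to the limit kernel. *)
Lemma integral_sqr_gauss_kernel (t : R) : 0 < t ->
  (\int[mu]_x (x ^+ 2 * gauss_kernel t x)%:E <= (2 * t)%:E)%E.
Proof.
move=> t0; pose h n : R := n.+1%:R^-1.
have h0 n : 0 < h n by rewrite invr_gt0.
have h1 n : h n <= 1 by rewrite invf_le1// ler1n.
have hc : h @ \oo --> 0 by exact: cvg_harmonic.
pose f n (x : mR) := ((h n * (fl (h n) x)%:~R) ^+ 2 * lattice_kernel (h n) t x)%:E.
have fcvg x : f n x @[n --> \oo] --> (x ^+ 2 * gauss_kernel t x)%:E.
  apply: cvg_EFin; first exact: nearW.
  apply: cvgM; last exact: lattice_kernel_cvg.
  rewrite expr2; under eq_fun do rewrite expr2.
  by apply: cvgM; exact: cvg_lattice_point.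
have mf n : measurable_fun setT (f n).
  apply/measurable_EFinP; apply: measurable_funM.
    by apply: measurable_funX; exact: measurable_lattice_point.
  apply: (measurableT_comp (g := fun x : mR => (t, x)) (measurable_lattice_kernel (h0 n))).
  exact: measurable_pair1.
have f0 n x : (0 <= f n x)%E.
  by rewrite lee_fin mulr_ge0 ?sqr_ge0// lattice_kernel_ge0.
rewrite (_ : (fun x => _) = (fun x => limn_einf (f ^~ x))); last first.
  by apply/funext => x; have [-> _] := cvg_limn_einf_sup (fcvg x).
apply: le_trans (@fatou _ mR _ mu setT measurableT f mf _) _ => //.
rewrite limn_einf_lim; apply: lime_le; first exact: is_cvg_einfs.
apply: nearW => n; apply: le_trans (integral_sqr_lattice_kernel (h0 n) t0).
by apply: ereal_inf_lbound; exists n => /=.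
Qed.

End gauss_moment.

(** * The fractional operators as subordinated kernels *)

Section substitutions.
Context {R : realType}.
Local Notation mR := (measurableTypeR R).
Local Notation mu := (@lebesgue_measure R).

Lemma powR_gt0E (x y : R) : 0 < x -> x `^ y = expR (y * ln x).
Proof. by move=> x0; rewrite /powR gt_eqF. Qed.

Lemma fine_mulZl (k : R) (x : \bar R) : 0 < k -> fine (k%:E * x)%E = k * fine x.
Proof.
move=> k0; case: x => [r| |] //=.
- by rewrite gt0_muley ?lte_fin//= mulr0.
- by rewrite gt0_muleNy ?lte_fin//= mulr0.
Qed.

Lemma ge0_Rintegral_scale (c : R) (f : R -> R) : 0 < c ->
  measurable_fun setT (f : mR -> mR) -> (forall x, 0 <= f x) ->
  \int[mu]_x f (c * x) = c^-1 * \int[mu]_x f x.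
Proof.
move=> c0 mf f0; rewrite /Rintegral -fine_mulZl ?invr_gt0//; congr fine.
rewrite (ge0_integralT_scale (f := EFin \o f))//.
exact/measurable_EFinP.
Qed.

(** The substitution $t=1/s$, made on the intervals $[1/(n+2),n+2]$, which inversion maps to
    themselves, and then extended by monotone convergence. *)
Lemma ge0_integral_inv (G : R -> R) : {in `]0, +oo[, continuous G} ->
  (forall x, 0 < x -> 0 <= G x) ->
  (\int[mu]_(t in `]0%R, +oo[) (G t)%:E = \int[mu]_(s in `]0%R, +oo[) (G s^-1 * s ^- 2)%:E)%E.
Proof.
move=> cG G0; pose F (n : nat) : set mR := `[n.+2%:R^-1, n.+2%:R]%classic.
have Fpos n t : F n t -> 0 < t.
  by rewrite /F /= in_itv/= => /andP[+ _]; apply: lt_le_trans; rewrite invr_gt0.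
have FE : `]0%R, +oo[%classic = \bigcup_n F n.
  apply/seteqP; split => [t|t [n _ /Fpos]]; rewrite /= in_itv/= andbT//.
  move=> t0; exists (maxn (Num.bound t) (Num.bound t^-1)) => //=.
  rewrite /F /= in_itv/= invf_ple ?posrE//; apply/andP; split.
    apply/ltW; apply: lt_trans (archi_boundP _) _; rewrite ?invr_ge0 ?ltW// ltr_nat.
    by rewrite ltnS leqW// leq_maxr.
  apply/ltW; apply: lt_trans (archi_boundP _) _; rewrite ?invr_ge0 ?ltW// ltr_nat.
  by rewrite ltnS leqW// leq_maxl.
have ndF : {homo F : n m / (n <= m)%N >-> (n <= m)%O}.
  move=> n m nm; apply/subsetPset => t; rewrite /F /= !in_itv/= => /andP[h1 h2].
  apply/andP; split; last by apply: le_trans h2 _; rewrite ler_nat !ltnS.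
  by apply: le_trans h1; rewrite lef_pV2 ?posrE// ler_nat !ltnS.
have cinv : {in `]0, +oo[, continuous (fun s : R => s^-1)}.
  by move=> s; rewrite in_itv/= andbT => s0; apply: inv_continuous; rewrite gt_eqF.
have cG' : {in `]0, +oo[, continuous (fun s : R => G s^-1 * s ^- 2)}.
  move=> s s0; have := s0; rewrite in_itv/= andbT => s0'.
  apply: cvgM.
    apply: continuous_comp; first exact: cinv.
    by apply: cG; rewrite in_itv/= andbT invr_gt0.
  rewrite expr2 invfM; under eq_fun do rewrite expr2 invfM.
  by apply: cvgM; exact: cinv.
have cont_meas (g : R -> R) n : {in `]0, +oo[, continuous g} -> measurable_fun (F n) (fun t : mR => (g t)%:E).
  move=> cg; apply/measurable_EFinP; 
  have mg : measurable_fun (`]0%R, +oo[%classic : set mR) (g : mR -> mR).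
    by apply: open_continuous_measurable_fun => // t; rewrite inE => ?; exact: cg.
  apply: measurable_funS mg; first exact: measurable_itv.
  by rewrite FE; exact: bigcup_sup.
have lim (g : R -> R) : {in `]0, +oo[, continuous g} -> (forall x, 0 < x -> 0 <= g x) ->
    (\int[mu]_(t in F n) (g t)%:E)%E @[n --> \oo] --> (\int[mu]_(t in `]0%R, +oo[) (g t)%:E)%E.
  move=> cg g0; rewrite FE; apply: ge0_nondecreasing_set_cvg_integral => //.
  - by move=> n; exact: measurable_itv.
  - by move=> n; exact: cont_meas.
  - by move=> n t /Fpos t0; rewrite lee_fin g0.
have h1 := lim _ cG G0.
have h2 := lim _ cG' (fun s s0 => mulr_ge0 (G0 _ (etrans (invr_gt0 s) s0)) (etrans (invr_ge0 _) (exprn_ge0 2 (ltW s0)))).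
rewrite -(cvg_lim _ h1)// -(cvg_lim _ h2)//; congr (limn _); apply/funext => n.
have n0 : 0 < n.+2%:R :> R by [].
have dE : {in `]0, +oo[, derive1 (fun s : R => s `^ (- 1)) =1 (fun s => - s ^- 2)}.
  move=> s s0; rewrite powR_derive1// mulN1r -opprD powRN.
  by rewrite -[1 + 1]/(2%:R) powR_mulrn//; move: s0; rewrite in_itv/= andbT => /ltW.
have dc : {in `]0, +oo[, continuous (derive1 (fun s : R => s `^ (- 1)))}.
  move=> s s0; have := s0; rewrite in_itv/= andbT => s0'.
  have c2 : (fun s : R => - s ^- 2) y @[y --> s] --> - s ^- 2.
    apply: cvgN; rewrite expr2 invfM; under eq_fun do rewrite expr2 invfM.
    by apply: cvgM; exact: cinv.
  rewrite /continuous_at dE//; apply: cvg_trans _ c2; apply: near_eq_cvg.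
  by have := near_in_itvoy s0; apply: filterS => y y0; rewrite dE.
have a0 : 0 < n.+2%:R^-1 :> R by rewrite invr_gt0.
have ab : n.+2%:R^-1 < n.+2%:R :> R.
  by rewrite (@lt_trans _ _ 1)// ?invf_lt1// ltr1n.
have pE (s : R) : 0 < s -> s `^ (- 1) = s^-1 by move=> s0; rewrite powR_inv1// ltW.
have posi (s : R) : s \in `[n.+2%:R^-1, n.+2%:R] -> s \in `]0, +oo[.
  by rewrite !in_itv/= andbT => /andP[+ _]; exact: lt_le_trans.
have inD (s : R) : 0 < s -> s \in `]0, +oo[ by rewrite in_itv/= andbT.
pose p (s : R) := s `^ (- 1).
transitivity (\int[mu]_(s in F n) (((G \o p) * - derive1 p) s)%:E)%E; last first.
  apply: eq_integral => s; rewrite inE => /posi s0; congr EFin.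
  rewrite !fctE dE// opprK /p pE//.
  by move: s0; rewrite in_itv/= andbT.
rewrite -(integration_by_substitution_decreasing (F := p) (G := G) (ltW ab)).
- by rewrite /F /p (pE _ n0) (pE _ a0) invrK.
- move=> x y xI yI xy; rewrite /p !pE; last 2 first.
  + by move: (posi _ xI) (posi _ yI); rewrite !in_itv/= !andbT.
  + by move: (posi _ xI) (posi _ yI); rewrite !in_itv/= !andbT.
  by rewrite ltf_pV2// posrE; move: (posi _ xI) (posi _ yI); rewrite !in_itv/= !andbT.
- by move=> s /subset_itv_oo_cc/posi; exact: dc.
- by apply/cvg_ex; eexists; apply/cvg_at_right_filter/dc/inD.
- by apply/cvg_ex; eexists; apply/cvg_at_left_filter/dc/inD.
- have dpow (s : R) : s \in `]0, +oo[ -> derivable (fun s : R => s `^ (- 1)) s 1 by exact: derivable_powR.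
  have cpow (s : R) : s \in `]0, +oo[ -> {for s, continuous (fun s : R => s `^ (- 1))}.
    by move=> s0; apply: differentiable_continuous; apply/derivable1_diffP; exact: dpow.
  split.
  + by move=> s /subset_itv_oo_cc/posi; exact: dpow.
  + exact/cvg_at_right_filter/cpow/inD.
  + exact/cvg_at_left_filter/cpow/inD.
- rewrite /p (pE _ n0) (pE _ a0) invrK.
  by apply: continuous_in_subspaceT => s; rewrite inE => /posi; exact: cG.
Qed.

End substitutions.

Section kernel_identities.
Context {R : realType} {N : nat}.
Local Notation mR := (measurableTypeR R).
Local Notation mu := (@lebesgue_measure R).
Variables (sigma : R).
Hypothesis sigma_gt0 : 0 < sigma.

(** Replacing [t] by $t/h^2$ in the integral of [kappa] produces a factor $h^\sigma$ from
    $t^{-1-\sigma/2}dt$, which cancels the prefactor. The factor $h^{-N}$ makes the weight of a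
    lattice point a density on its cell. *)
Lemma kappa_tensor (h : R) (z : N.-tuple mR) : 0 < h ->
  h ^- N * kappa sigma h (cell h z) =
  `|Gamma (- (sigma / 2))|^-1 *
    \int[mu]_t (tensor (lattice_kernel h) t z * theta (sigma / 2) t).
Proof.
move=> h0; rewrite /kappa Rintegral_mkcond.
pose f (t : R) := if 0 < t then expR (- (2 * N%:R * t)) *
  (\prod_(i < N) bes `|fl h (tnth z i)|%N t) / t `^ (1 + sigma / 2) else 0.
have f0 t : 0 <= f t.
  rewrite /f; case: ifP => // t0; rewrite divr_ge0 ?powR_ge0// mulr_ge0 ?expR_ge0//.
  by apply: prodr_ge0 => i _; rewrite bes_ge0 ?ltW.
have mf : measurable_fun setT (f : mR -> mR).
  apply: measurable_fun_if => //; first exact: measurable_fun_ltr.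
  under eq_fun do rewrite -powRN.
  apply: measurable_funM; last by apply: measurable_funTS; exact: measurable_powR.
  apply: measurable_funM.
    apply: measurable_funTS; apply: measurableT_comp => //; apply: measurableT_comp => //.
  apply: measurable_prod => i _.
  apply: measurable_funS (measurable_bes _); first by rewrite -set_itvcy; exact: measurable_itv.
  by move=> t [_ /= t0]; exact: ltW.
have -> : \int[mu]_t ((fun t : R => expR (- (2 * N%:R * t)) *
    (\prod_(i < N) besselI `|cell h z ord0 i|%N (2 * t)) / t `^ (1 + sigma / 2)) \_ `]0, +oo[) t =
    \int[mu]_t f t.
  apply: eq_Rintegral => t _; rewrite patchE mem_setE in_itv/= andbT /f; case: ifP => // t0.
  by under eq_bigr do rewrite besselIE mxE.
have h2 : 0 < h ^- 2 by rewrite invr_gt0 exprn_gt0.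
have := ge0_Rintegral_scale h2 mf f0; rewrite invrK => fscale.
have -> : \int[mu]_t f t = h ^- 2 * \int[mu]_t f (h ^- 2 * t).
  by rewrite fscale mulrA mulVf ?mul1r// gt_eqF// exprn_gt0.
have hn0 : h != 0 by rewrite gt_eqF.
have -> : \int[mu]_t f (h ^- 2 * t) =
    \int[mu]_t ((h ^+ N * h ^+ 2 * h `^ sigma) * (tensor (lattice_kernel h) t z * theta (sigma / 2) t)).
  apply: eq_Rintegral => t _; rewrite /f pmulr_rgt0// /theta; case: ifP => t0; last by rewrite !mulr0.
  rewrite /tensor /lattice_kernel t0 !big_split/= !prodr_const card_ord -expRM_natl.
  under [in RHS]eq_bigr do rewrite mulrC.
  set B := \prod_(i < N) _.
  rewrite (_ : N%:R * - (2 * (t / h ^+ 2)) = - (2 * N%:R * (h ^- 2 * t))); last by field.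
  set e := expR _.
  have -> : (h ^- 2 * t) `^ (1 + sigma / 2) = h ^- 2 * (h `^ sigma)^-1 * t `^ (1 + sigma / 2).
    have hE : h ^+ 2 = expR (2 * ln h) by rewrite expRM_natl lnK.
    rewrite !powR_gt0E ?pmulr_rgt0// lnM ?posrE// lnV ?posrE ?exprn_gt0// hE expRK.
    by rewrite -!expRN -!expRD; congr expR; field.
  have hs0 : h `^ sigma != 0 by rewrite gt_eqF// powR_gt0.
  have ts0 : t `^ (1 + sigma / 2) != 0 by rewrite gt_eqF// powR_gt0.
  rewrite exprVn; have : h ^+ N != 0 by rewrite expf_neq0.
  move: (h ^+ N) (h `^ sigma) (t `^ _) hs0 ts0 => X Y Z Y0 Z0 X0.
  by field; rewrite X0 Y0 Z0 hn0.
rewrite ge0_RintegralZl//; last 2 first.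
- exact: (@measurable_tensor_theta _ _ _ (measurable_lattice_kernel h0)).
- by move=> t _; apply: tensor_theta_ge0 => s x; exact: lattice_kernel_ge0.
have hs0 : h `^ sigma != 0 by rewrite gt_eqF// powR_gt0.
move: (Rintegral _ _ _) => I; have : h ^+ N != 0 by rewrite expf_neq0.
move: (h ^+ N) (h `^ sigma) hs0 => X Y Y0 X0.
move: (`|_|^-1) => A.
by field; rewrite X0 Y0 hn0.
Qed.

(** The substitution $t\mapsto1/t$ turns the left side into $(4\pi)^{-N/2}\int t^{b-1}e^{-ct}dt$
    with $b=(N+\sigma)/2$ and $c=\rho^2/4$, that is $(4\pi)^{-N/2}\Gamma(b)c^{-b}$. The powers of 4
    combine to $2^\sigma$, which gives [frac_cst] up to $|\Gamma(-\sigma/2)|$. *)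
Lemma gauss_tensor (z : N.-tuple mR) : 0 < enorm (row_of_tuple z) ->
  \int[mu]_t (tensor gauss_kernel t z * theta (sigma / 2) t) =
  2 `^ sigma * Gamma ((N%:R + sigma) / 2) / pi `^ (N%:R / 2) /
    enorm (row_of_tuple z) `^ (N%:R + sigma).
Proof.
set rho := enorm _ => rho0.
have sz : \sum_(i < N) tnth z i ^+ 2 = rho ^+ 2.
  rewrite /rho /enorm sqr_sqrtr; last by apply: sumr_ge0 => i _; exact: sqr_ge0.
  by apply: eq_bigr => i _; rewrite mxE.
pose b := (N%:R + sigma) / 2; pose c := rho ^+ 2 / 4.
have c0 : 0 < c by rewrite divr_gt0// exprn_gt0.
have b0 : 0 < b by rewrite divr_gt0// ltr_wpDl.
pose k := (4 * pi) `^ (- (N%:R / 2)) : R.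
pose G (t : R) := k * t `^ (- (b + 1)) * expR (- (c * t^-1)).
pose f (t : R) := (t `^ (b - 1) * expR (- t)) * \1_(`]0, +oo[%classic : set R) t.
have -> : \int[mu]_t (tensor gauss_kernel t z * theta (sigma / 2) t) =
    \int[mu]_(t in `]0, +oo[) G t.
  rewrite [RHS]Rintegral_mkcond; apply: eq_Rintegral => t _.
  rewrite patchE mem_setE in_itv/= andbT /theta; case: ifP => t0; last by rewrite mulr0.
  rewrite /tensor /gauss_kernel t0 /G big_split/= prodr_const card_ord.
  have -> : \prod_(i < N) expR (- (tnth z i ^+ 2 / (4 * t))) = expR (- (c * t^-1)).
    rewrite -expR_sum; congr expR; rewrite sumrN -mulr_suml sz /c.
    by field; rewrite gt_eqF.
  rewrite mulrAC -mulrA mulrC; congr (_ * _).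
  have p4 : 0 < 4 * pi :> R by rewrite mulr_gt0// pi_gt0.
  have -> : Num.sqrt (4 * t * pi) = expR (2^-1 * (ln (4 * pi) + ln t)).
    rewrite -lnM ?posrE// mulrAC -powR_gt0E; last by rewrite mulr_gt0.
    by rewrite powR12_sqrt// ltW// mulr_gt0.
  rewrite /k !powR_gt0E// -!expRN -expRM_natl -!expRD; congr expR.
  by rewrite /b; field.
have cpow (e s : R) : s \in `]0, +oo[ -> {for s, continuous (fun s : R => s `^ e)}.
  move=> s0; apply: differentiable_continuous; apply/derivable1_diffP; exact: derivable_powR.
have k0 : 0 <= k by exact: powR_ge0.
have -> : \int[mu]_(t in `]0, +oo[) G t = \int[mu]_t (k * (c `^ (1 - b)) * f (c * t)).
  rewrite [RHS](_ : _ = \int[mu]_(t in `]0, +oo[) (G t^-1 * t ^- 2)).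
    rewrite /Rintegral ge0_integral_inv//; last first.
      by move=> x x0; rewrite !mulr_ge0 ?powR_ge0 ?expR_ge0.
    move=> s s0; have := s0; rewrite in_itv/= andbT => s0'.
    apply: cvgM.
      by apply: cvgM; [exact: cvg_cst|exact: cpow].
    apply: continuous_comp; last exact: continuous_expR.
    by apply: cvgN; apply: cvgM; [exact: cvg_cst|apply: inv_continuous; rewrite gt_eqF].
  rewrite [RHS]Rintegral_mkcond; apply: eq_Rintegral => t _.
  rewrite patchE /f !indicE !mem_setE !in_itv/= !andbT pmulr_rgt0//.
  case: ifP => t0; last by rewrite !mulr0.
  rewrite mulr1 /G invrK; set E := expR _.
  have ti0 : 0 < t^-1 by rewrite invr_gt0.
  have h : c `^ (1 - b) * (c * t) `^ (b - 1) = t^-1 `^ (- (b + 1)) * t ^- 2.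
    have -> : t ^- 2 = expR (- (2 * ln t)) by rewrite expRN expRM_natl lnK.
    rewrite !powR_gt0E ?mulr_gt0// lnM ?posrE// lnV ?posrE// -!expRD.
    by congr expR; ring.
  rewrite (_ : k * _ * _ = k * E * (c `^ (1 - b) * (c * t) `^ (b - 1))); last by ring.
  by rewrite h; ring.
have mf : measurable_fun setT (f : mR -> mR).
  apply: measurable_funM; last by apply: measurable_indic; exact: measurable_itv.
  apply: measurable_funM; first exact: measurable_powR.
  by apply: measurableT_comp.
have f0 t : 0 <= f t by rewrite !mulr_ge0 ?powR_ge0 ?expR_ge0.
rewrite ge0_RintegralZl//; last first.
  apply: (measurableT_comp (g := fun t : mR => c * t : mR) mf).
  exact: measurable_funM.
rewrite ge0_Rintegral_scale//.
have -> : \int[mu]_t f t = gamma_integral b.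
  rewrite /gamma_integral [RHS]Rintegral_mkcond; apply: eq_Rintegral => t _.
  rewrite patchE /f indicE; case: ifP => _; first by rewrite mulr1.
  by rewrite mulr0.
rewrite /Gamma -/b b0 big_ord0 addr0 divr1 /k.
rewrite (mulrAC (2 `^ sigma)) -[RHS]mulrAC [RHS]mulrC [LHS]mulrA [LHS]mulrC; congr (_ * _).
have p4 : 0 < 4 * pi :> R by rewrite mulr_gt0// pi_gt0.
have -> : c^-1 = expR (- ln c) by rewrite expRN lnK.
rewrite !powR_gt0E ?pi_gt0// -!expRN -!expRD; congr expR.
have ln4 : ln 4 = 2 * ln 2 :> R.
  by rewrite (_ : 4 = 2 ^+ 2) ?lnXn// ?mulr_natl//; ring.
have -> : ln c = 2 * ln rho - 2 * ln 2.
  by rewrite /c lnM ?posrE ?exprn_gt0 ?invr_gt0// lnV ?posrE// lnXn// ln4; ring.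
by rewrite lnM ?posrE ?pi_gt0// ln4 /b; field.
Qed.

End kernel_identities.

Section dominated_Rintegral.
Context d (T : measurableType d) (R : realType) (mu : {measure set T -> \bar R}).

Lemma dominated_cvg_Rintegral (f_ : nat -> T -> R) (f g : T -> R) :
  (forall n, measurable_fun setT (f_ n)) ->
  (forall x, f_ n x @[n --> \oo] --> f x) ->
  mu.-integrable setT (fun x => (g x)%:E) ->
  (forall n x, `|f_ n x| <= g x) ->
  \int[mu]_x f_ n x @[n --> \oo] --> \int[mu]_x f x.
Proof.
move=> mf fc ig fg.
have mf' : measurable_fun setT f.
  by apply: (measurable_fun_cvg mf) => x _; exact: fc.
have fc' x : (f_ n x)%:E @[n --> \oo] --> (f x)%:E.
  by apply: cvg_EFin; [exact: nearW|exact: fc].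
have [ifi _ fcv] := @dominated_convergence _ _ _ mu setT measurableT
  (fun n x => (f_ n x)%:E) (fun x => (f x)%:E) _
  (fun n => (measurable_EFinP _ _).2 (mf n)) ((measurable_EFinP _ _).2 mf')
  (aeW _ (fun x _ => fc' x)) ig
  (aeW _ (fun x n _ => fg n x)).
apply: fine_cvg; rewrite fineK//; exact: integrable_fin_num.
Qed.

End dominated_Rintegral.

Section rV_convergence.
Context {R : realType} {N : nat}.
Local Notation mR := (measurableTypeR R).

Lemma cvg_rV (u : nat -> 'rV[R]_N) (x : 'rV[R]_N) :
  (forall i, u n 0 i @[n --> \oo] --> x 0 i) -> u @ \oo --> x.
Proof.
move=> h; apply/cvg_ballP => e e0.
have : \forall n \near \oo, forall i, ball (x 0 i) e (u n 0 i).
  apply: filter_forall => i.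
  by have /cvg_ballP/(_ _ e0) := h i.
by apply: filterS => n hn; split => // i j; rewrite ord1; exact: hn.
Qed.

Definition lattice_point (h : R) (z : N.-tuple mR) : 'rV[R]_N := h *: map_mx intr (cell h z).

Lemma lattice_pointE h z i : lattice_point h z 0 i = h * (fl h (tnth z i))%:~R.
Proof. by rewrite !mxE. Qed.

Lemma cvg_lattice_point_rV (h : R^nat) (z : N.-tuple mR) : (forall n, 0 < h n) ->
  h @ \oo --> 0 -> lattice_point (h n) z @[n --> \oo] --> row_of_tuple z.
Proof.
move=> h0 hc; apply: cvg_rV => i; rewrite mxE.
under eq_fun do rewrite lattice_pointE.
exact: cvg_lattice_point.
Qed.

Lemma measurable_cell_fun d (T : measurableType d) (h : R) (g : 'rV[int]_N -> T) : 0 < h ->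
  measurable_fun setT (fun z : N.-tuple mR => g (cell h z)).
Proof.
move=> h0; apply: (@measurable_fun_countable_valued1 _ _ _ (cell h) _ _ T g).
by move=> j; exact: measurable_cell_preimage.
Qed.

(** A continuous function is the pointwise limit of its values at lattice points of finer and finer
    meshes, and each approximation depends only on the cell. *)
Lemma measurable_row_of_tuple (g : 'rV[R]_N -> R) : continuous g ->
  measurable_fun setT (fun z : N.-tuple mR => g (row_of_tuple z) : mR).
Proof.
move=> cg; pose h n : R := n.+1%:R^-1.
have h0 n : 0 < h n by rewrite invr_gt0.
apply: (@measurable_fun_cvg _ _ _ _ (fun n z => g (lattice_point (h n) z))).
  move=> n; exact: (measurable_cell_fun (T := mR) (fun j => g (h n *: map_mx intr j)) (h0 n)).
move=> z _; apply: continuous_cvg; first exact: cg.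
apply: cvg_lattice_point_rV => //; exact: cvg_harmonic.
Qed.

Lemma row_of_opp_tuple (z : N.-tuple mR) : row_of_tuple (opp_tuple z) = - row_of_tuple z.
Proof. by apply/rowP => i; rewrite !mxE tnth_map. Qed.

Lemma enorm_sqr (y : 'rV[R]_N) : enorm y ^+ 2 = \sum_(i < N) y 0 i ^+ 2.
Proof. by rewrite sqr_sqrtr// sumr_ge0// => i _; exact: sqr_ge0. Qed.

Lemma measurable_enorm : measurable_fun setT (fun z : N.-tuple mR => enorm (row_of_tuple z) : mR).
Proof.
rewrite (_ : (fun z => _) = (fun z : N.-tuple mR => (\sum_(i < N) tnth z i ^+ 2) `^ 2^-1)).
  apply: (measurableT_comp (measurable_powR _)).
  by apply: measurable_sum => i; apply: measurable_funX; exact: measurable_tnth.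
apply/funext => z; rewrite powR12_sqrt; last by apply: sumr_ge0 => i _; exact: sqr_ge0.
by congr Num.sqrt; apply: eq_bigr => i _; rewrite mxE.
Qed.

End rV_convergence.

(** * Both operators as time integrals of symmetrised increments *)

Section fracs.
Context {R : realType} {N : nat}.
Local Notation mR := (measurableTypeR R).
Local Notation mu := (@lebesgue_measure R).
Local Notation muN := (@lebesgue_tuple R N).
Implicit Types (psi : 'rV[R]_N -> R) (x y : 'rV[R]_N).

(* Symmetrising makes the increment of second order in [y], which removes the principal value:
   everything below converges absolutely. *)
Definition sdiff psi x y : R := (psi (x + y) + psi (x - y)) / 2 - psi x.

(** Positive and negative parts are treated separately; integrability makes both finite, so that
    their difference is the integral. *)
Lemma family_sum_cell (h : R) (b : 'rV[int]_N -> R) : 0 < h ->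
  muN.-integrable setT (fun z => (b (cell h z))%:E) ->
  family_sum setT b = h ^- N * \int[muN]_z b (cell h z).
Proof.
move=> h0 ib; have hN : 0 < h ^+ N by rewrite exprn_gt0.
have key (c : 'rV[int]_N -> R) : (forall j, 0 <= c j) ->
    fine (\esum_(j in setT) (c j)%:E) = h ^- N * fine (\int[muN]_z (c (cell h z))%:E).
  move=> c0; rewrite ge0_integral_cell//.
  by rewrite fine_mulZl// mulrA mulVf ?mul1r// gt_eqF.
rewrite /family_sum /Rintegral [in RHS]integralE fineB; last 2 first.
- exact: integrable_pos_fin_num ib.
- exact: integrable_neg_fin_num ib.
rewrite mulrBr; congr (_ - _).
  under eq_esum do rewrite funeposE -EFin_max.
  under eq_integral do rewrite funeposE -EFin_max.
  by apply: (key (fun j => Num.max (b j) 0)) => j; rewrite le_max lexx orbT.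
under eq_esum do rewrite funenegE -EFinN -EFin_max.
under eq_integral do rewrite funenegE -EFinN -EFin_max.
by apply: (key (fun j => Num.max (- b j) 0)) => j; rewrite le_max lexx orbT.
Qed.

Lemma family_sum_neq0 (b : 'rV[int]_N -> R) : b 0 = 0 ->
  family_sum [set j | j != 0] b = family_sum setT b.
Proof.
move=> b0; rewrite /family_sum; congr (fine _ - fine _).
- rewrite esum_mkcond; apply: eq_esum => j _; case: ifPn => //.
  by rewrite notin_setE/= => /negP/negPn/eqP ->; rewrite funeposE/= b0 maxxx.
- rewrite esum_mkcond; apply: eq_esum => j _; case: ifPn => //.
  by rewrite notin_setE/= => /negP/negPn/eqP ->; rewrite funenegE/= b0 oppr0 maxxx.
Qed.

Lemma family_sumN (b : 'rV[int]_N -> R) :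
  family_sum setT (fun j => b (- j)) = family_sum setT b.
Proof.
have bij : set_bij setT setT (-%R : 'rV[int]_N -> 'rV[int]_N).
  split; [by []|by move=> i j _ _ /oppr_inj|move=> j _].
  by exists (- j) => //; rewrite opprK.
have key (c e : 'rV[int]_N -> \bar R) : (forall j, c j = e (- j)) ->
    \esum_(j in setT) c j = \esum_(j in setT) e j.
  by move=> ce; rewrite [RHS](reindex_esum _ _ _ _ bij); exact: eq_esum.
rewrite /family_sum; congr (fine _ - fine _).
- by apply: key => j; rewrite !funeposE.
- by apply: key => j; rewrite !funenegE.
Qed.

Section operators.
Variables (sigma : R).
Hypothesis sigma_bnd : 0 < sigma < 2.

Let a01 : 0 < sigma / 2 < 1.
Proof. by case/andP: sigma_bnd => h1 h2; apply/andP; split; lra. Qed.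
Let sigma_gt0 : 0 < sigma. Proof. by case/andP: sigma_bnd. Qed.

Section discrete.
Variables (h : R) (psi : 'rV[R]_N -> R) (x : 'rV[R]_N) (M : R).
Hypothesis h0 : 0 < h.
Hypothesis psiM : forall y, `|psi y| <= M.

Let Y (t : R) : R := h * (fl h t)%:~R.
Let mY : measurable_fun setT (Y : mR -> mR).
Proof. exact: measurable_lattice_point. Qed.

Let K (z : N.-tuple mR) := \int[mu]_t (tensor (lattice_kernel h) t z * theta (sigma / 2) t).

(** A nonzero integer vector has squared length at least one, so on the lattice boundedness and
    vanishing at 0 already give a quadratic bound. Its constant blows up as [h] tends to 0, but it
    only serves integrability at fixed [h]. *)
Let weight_le (g : 'rV[int]_N -> R) (B : R) : g 0 = 0 -> (forall j, `|g j| <= B) ->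
  forall z, `|g (cell h z)| <= B / h ^+ 2 * \sum_(i < N) Y (tnth z i) ^+ 2.
Proof.
move=> g0 gB z; have B0 : 0 <= B by apply: le_trans (gB 0); exact: normr_ge0.
rewrite mulrAC -mulrA.
have -> : (\sum_(i < N) Y (tnth z i) ^+ 2) / h ^+ 2 = \sum_(i < N) (cell h z 0 i)%:~R ^+ 2.
  rewrite mulr_suml; apply: eq_bigr => i _; rewrite mxE /Y.
  by field; rewrite gt_eqF.
have [->|] := eqVneq (cell h z) 0.
  by rewrite g0 normr0 mulr_ge0// sumr_ge0// => i _; exact: sqr_ge0.
move=> cn0; have [i ci] : exists i, cell h z 0 i != 0.
  apply: contrapT => nex; move/eqP: cn0; apply; apply/rowP => i; rewrite [RHS]mxE.
  by apply/eqP/negPn/negP => ci; apply: nex; exists i.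
apply: le_trans (gB _) _; rewrite -[leLHS]mulr1; apply: ler_wpM2l => //.
rewrite (bigD1 i)//= -[leLHS]addr0; apply: lerD; last first.
  by apply: sumr_ge0 => k _; exact: sqr_ge0.
by rewrite -real_normK ?num_real// -intr_norm -natr_absz exprn_ege1// ler1n absz_gt0.
Qed.

Let integrable_lattice_weight (g : 'rV[int]_N -> R) (B : R) : g 0 = 0 ->
  (forall j, `|g j| <= B) ->
  muN.-integrable setT (fun z => (g (cell h z) * K z)%:E).
Proof.
move=> g0 gB; have B0 : 0 <= B by apply: le_trans (gB 0); exact: normr_ge0.
apply: (@integrable_weight_kernel _ _ Y (lattice_kernel h) mY (measurable_lattice_kernel h0)
  _ _ _ (fun z => g (cell h z)) B (B / h ^+ 2)) => //.
- by move=> t z; exact: lattice_kernel_ge0.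
- by move=> t; exact: integral_lattice_kernel.
- by move=> t; exact: integral_sqr_lattice_kernel.
- exact: (measurable_cell_fun (T := mR) g h0).
- by rewrite divr_ge0// exprn_ge0// ltW.
- exact: weight_le.
Qed.

Lemma disc_frac_lapE : disc_frac_lap sigma h psi x =
  `|Gamma (- (sigma / 2))|^-1 * \int[mu]_t
    ((\int[muN]_z (sdiff psi x (lattice_point h z) * tensor (lattice_kernel h) t z)) *
     theta (sigma / 2) t).
Proof.
set A := `|_|^-1; pose pt (j : 'rV[int]_N) : 'rV[R]_N := h *: map_mx intr j.
have ptN j : pt (- j) = - pt j by rewrite /pt -scalerN -map_mxN.
pose g j := psi (x + pt j) - psi x; pose b j := g j * kappa sigma h j.
have g0 : g 0 = 0 by rewrite /g /pt map_mx0 scaler0 addr0 subrr.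
have hN : h ^+ N != 0 by rewrite expf_neq0// gt_eqF.
have kE z : kappa sigma h (cell h z) = h ^+ N * A * K z.
  by rewrite -mulrA -kappa_tensor// mulrA mulfV// mul1r.
have kN j : kappa sigma h (- j) = kappa sigma h j.
  rewrite /kappa; congr (_ * _); apply: eq_Rintegral => t _.
  by under eq_bigr do rewrite mxE abszN.
have gB j : `|g j| <= 2 * M.
  by rewrite /g; apply: le_trans (ler_normB _ _) _; rewrite mulr_natl mulr2n lerD.
have ib (g' : 'rV[int]_N -> R) : g' 0 = 0 -> (forall j, `|g' j| <= 2 * M) ->
    muN.-integrable setT (fun z => (g' (cell h z) * kappa sigma h (cell h z))%:E).
  move=> g'0 g'B; have := integrableZl measurableT (h ^+ N * A) (integrable_lattice_weight g'0 g'B).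
  by apply: eq_integrable => // z _; rewrite /= kE -EFinM; congr EFin; ring.
have ib1 := ib g g0 gB.
have gN0 : g (- 0) = 0 by rewrite oppr0.
have ib2 := ib (fun j => g (- j)) gN0 (fun j => gB (- j)).
rewrite /disc_frac_lap -/b (family_sum_neq0 (b := b)); last by rewrite /b g0 mul0r.
have e1 : family_sum setT b = h ^- N * \int[muN]_z b (cell h z) by exact: family_sum_cell.
have e2 : family_sum setT b = h ^- N * \int[muN]_z (g (- cell h z) * kappa sigma h (cell h z)).
  rewrite -family_sumN /b; under eq_fun do rewrite kN.
  exact: (family_sum_cell (b := fun j => g (- j) * kappa sigma h j)).
(* [kappa] is even in [j], so averaging the sum with its reflection replaces the increment by
   [sdiff]. *)
have e3 : family_sum setT b = h ^- N * \int[muN]_z (sdiff psi x (lattice_point h z) * kappa sigma h (cell h z)).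
  have -> : family_sum setT b = 2^-1 * (family_sum setT b + family_sum setT b) by field.
  rewrite {1}e1 e2 -mulrDr -(RintegralD measurableT ib1 ib2) mulrCA; congr (_ * _).
  have ib12 := integrableD measurableT ib1 ib2.
  rewrite -(@RintegralZl _ _ _ muN setT
    (fun z => g (cell h z) * kappa sigma h (cell h z) + g (- cell h z) * kappa sigma h (cell h z)) _ measurableT ib12).
  by apply: eq_Rintegral => z _; rewrite /b /g ptN /sdiff /lattice_point -/(pt _); field.
have s0 : sdiff psi x (pt 0) = 0.
  by rewrite /sdiff /pt map_mx0 scaler0 addr0 subr0; field.
have sB j : `|sdiff psi x (pt j)| <= 2 * M.
  rewrite (_ : sdiff _ _ _ = (g j + g (- j)) / 2); last by rewrite /sdiff /g ptN; field.
  rewrite normrM (@ger0_norm _ 2^-1)// ler_pdivrMr// (le_trans (ler_normD _ _))//.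
  by rewrite mulr_natr mulr2n lerD.
rewrite e3.
have -> : \int[muN]_z (sdiff psi x (lattice_point h z) * kappa sigma h (cell h z)) =
  h ^+ N * A * \int[muN]_z (sdiff psi x (lattice_point h z) * K z).
  have iS := @integrable_lattice_weight (fun j => sdiff psi x (pt j)) (2 * M) s0 sB.
  rewrite -(@RintegralZl _ _ _ muN setT (fun z => sdiff psi x (lattice_point h z) * K z) _
    measurableT iS).
  by apply: eq_Rintegral => z _; rewrite kE; ring.
rewrite 2!mulrA mulVf// mul1r; congr (_ * _).
have B0 : 0 <= M by apply: le_trans (psiM 0).
apply: (@Rintegral_weight_kernel _ _ Y (lattice_kernel h) mY (measurable_lattice_kernel h0)
  _ _ _ (fun z => sdiff psi x (lattice_point h z)) (2 * M) (2 * M / h ^+ 2)) => //.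
- by move=> t z; exact: lattice_kernel_ge0.
- by move=> t; exact: integral_lattice_kernel.
- by move=> t; exact: integral_sqr_lattice_kernel.
- exact: (measurable_cell_fun (T := mR) (fun j => sdiff psi x (pt j)) h0).
- by rewrite mulr_ge0.
- by rewrite divr_ge0 ?mulr_ge0 ?exprn_ge0// ltW.
- by move=> z; exact: (sB (cell h z)).
- exact: (weight_le (g := fun j => sdiff psi x (pt j))).
Qed.

End discrete.

Section continuum.
Variables (psi : 'rV[R]_N -> R) (x : 'rV[R]_N) (M C : R).
Hypothesis psi_cont : continuous psi.
Hypothesis psiM : forall y, `|psi y| <= M.
Hypothesis C0 : 0 <= C.
Hypothesis sdiffC : forall y, `|sdiff psi x y| <= C * \sum_(i < N) y 0 i ^+ 2.

Let K (z : N.-tuple mR) := \int[mu]_t (tensor gauss_kernel t z * theta (sigma / 2) t).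
Let M0 : 0 <= M. Proof. by apply: le_trans (psiM 0). Qed.

Let integrable_gauss_weight (D : N.-tuple mR -> R) (B L : R) :
  measurable_fun setT (D : N.-tuple mR -> mR) -> 0 <= B -> 0 <= L ->
  (forall z, `|D z| <= B) -> (forall z, `|D z| <= L * \sum_(i < N) tnth z i ^+ 2) ->
  muN.-integrable setT (fun z => (D z * K z)%:E).
Proof.
move=> mD B0 L0 DB DL.
apply: (@integrable_weight_kernel _ _ id gauss_kernel _ measurable_gauss_kernel
  _ _ _ D B L) => //.
- by move=> t z; exact: gauss_kernel_ge0.
- by move=> t; exact: integral_gauss_kernel.
- by move=> t; exact: integral_sqr_gauss_kernel.
Qed.

Let KN z : K (opp_tuple z) = K z.
Proof.
apply: eq_Rintegral => t _; congr (_ * _); apply: eq_bigr => i _.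
by rewrite tnth_map /gauss_kernel sqrrN.
Qed.

Let g (z : N.-tuple mR) := psi (x + row_of_tuple z) - psi x.

Let mg : measurable_fun setT (g : N.-tuple mR -> mR).
Proof.
apply: (measurable_row_of_tuple (g := fun y => psi (x + y) - psi x)) => y.
apply: (@continuousB _ _ _ (fun y0 => psi (x + y0)) (fun=> psi x)); last exact: cst_continuous.
apply: (@continuous_comp _ _ _ (fun y0 => x + y0)); last exact: psi_cont.
by apply: (@continuousD _ _ _ (fun=> x) id); [exact: cst_continuous|exact: cvg_id].
Qed.

Let D (z : N.-tuple mR) := sdiff psi x (row_of_tuple z).

Let DE z : D z = (g z + g (opp_tuple z)) / 2.
Proof. by rewrite /D /sdiff /g row_of_opp_tuple; field. Qed.

Let mD : measurable_fun setT (D : N.-tuple mR -> mR).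
Proof.
rewrite (_ : D = (fun z => (g z + g (opp_tuple z)) / 2)); last exact/funext/DE.
apply: measurable_funM => //; apply: measurable_funD => //.
by apply: measurableT_comp => //; exact: measurable_opp_tuple.
Qed.

Let gB z : `|g z| <= 2 * M.
Proof. by rewrite /g (le_trans (ler_normB _ _))// mulr_natl mulr2n lerD. Qed.

Let DB z : `|D z| <= 2 * M.
Proof.
rewrite DE normrM (@ger0_norm _ 2^-1)// ler_pdivrMr// (le_trans (ler_normD _ _))//.
by rewrite mulr_natr mulr2n lerD.
Qed.

Let DC z : `|D z| <= C * \sum_(i < N) tnth z i ^+ 2.
Proof.
by apply: le_trans (sdiffC _) _; under eq_bigr do rewrite mxE.
Qed.

Let far (r : R) : set (N.-tuple mR) := [set z | r < enorm (row_of_tuple z)].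

Let mfar r : measurable (far r).
Proof.
rewrite (_ : far r = (fun z => enorm (row_of_tuple z)) @^-1` `]r, +oo[%classic); last first.
  by apply/seteqP; split => z /=; rewrite in_itv/= andbT.
by rewrite -[X in measurable X]setTI; apply: measurable_enorm.
Qed.

Let farN r z : \1_(far r) (opp_tuple z) = \1_(far r) z :> R.
Proof.
rewrite !indicE; congr ((_ : bool)%:R); apply/idP/idP; rewrite !inE /far /=.
  rewrite row_of_opp_tuple /enorm; under eq_bigr do rewrite mxE sqrrN; by [].
by rewrite row_of_opp_tuple /enorm => h; under eq_bigr do rewrite mxE sqrrN.
Qed.

(** Away from the ball of radius [r] the plain increment obeys a quadratic bound with constant
    $2M/r^2$, so it is integrable against the kernel and may be averaged with its reflection, the
    kernel and the truncation being even. *)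
Let truncated (r : R) : 0 < r ->
  \int[muN]_(z in far r) (g z * (@frac_cst R N sigma / enorm (row_of_tuple z) `^ (N%:R + sigma))) =
  `|Gamma (- (sigma / 2))|^-1 * \int[muN]_z (D z * \1_(far r) z * K z).
Proof.
move=> r0; set A := `|_|^-1.
pose g1 (z : N.-tuple mR) := g z * \1_(far r) z.
have m1 : measurable_fun setT (\1_(far r) : N.-tuple mR -> mR) by exact: measurable_indic.
have mg1 : measurable_fun setT (g1 : N.-tuple mR -> mR) by exact: measurable_funM.
have M2 : 0 <= 2 * M by rewrite mulr_ge0.
have L0 : 0 <= 2 * M / r ^+ 2 by rewrite divr_ge0// exprn_ge0// ltW.
have g1B z : `|g1 z| <= 2 * M.
  rewrite /g1 normrM indicE; apply: le_trans (gB z).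
  by rewrite ler_piMr// ger0_norm// lern1 leq_b1.
have g1L z : `|g1 z| <= 2 * M / r ^+ 2 * \sum_(i < N) tnth z i ^+ 2.
  rewrite /g1 indicE; case: (boolP (z \in far r)) => hz; last first.
    rewrite mulr0 normr0 mulr_ge0//.
    by apply: sumr_ge0 => i _; exact: sqr_ge0.
  rewrite mulr1; apply: le_trans (gB z) _.
  rewrite mulrAC ler_pdivlMr ?exprn_gt0//; apply: ler_wpM2l => //.
  move: hz; rewrite inE /far /= => hz.
  apply: (@le_trans _ _ (enorm (row_of_tuple z) ^+ 2)).
    by rewrite ler_pXn2r ?nnegrE ?(ltW r0) ?sqrtr_ge0// ltW.
  rewrite enorm_sqr le_eqVlt; apply/orP; left; apply/eqP.
  by apply: eq_bigr => i _; rewrite mxE.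
have ig1 : muN.-integrable setT (fun z => (g1 z * K z)%:E).
  exact: (integrable_gauss_weight mg1 M2 L0).
rewrite Rintegral_mkcond.
transitivity (\int[muN]_z (A * (g1 z * K z))).
  apply: eq_Rintegral => z _; rewrite patchE /g1 indicE; case: ifPn => hz; last first.
    by rewrite mulr0 mul0r mulr0.
  have hz' : 0 < enorm (row_of_tuple z).
    by apply: lt_trans r0 _; move: hz; rewrite inE.
  rewrite /K gauss_tensor// /frac_cst -/A.
  rewrite mulr1 invfM -/A; ring.
rewrite RintegralZl//; congr (_ * _).
have e2 : \int[muN]_z (g1 z * K z) = \int[muN]_z (g1 (opp_tuple z) * K z).
  rewrite -[LHS](congr1 fine (integral_tuple_opp (measurable_int _ ig1))).
  by apply: eq_Rintegral => z _; rewrite KN.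
have ig2 : muN.-integrable setT (fun z => (g1 (opp_tuple z) * K z)%:E).
  apply: (integrable_gauss_weight _ M2 L0) => //.
    by apply: (measurableT_comp mg1); exact: measurable_opp_tuple.
  move=> z; apply: le_trans (g1L _) _.
  by under eq_bigr do rewrite tnth_map sqrrN.
have -> : \int[muN]_z (g1 z * K z) = 2^-1 * (\int[muN]_z (g1 z * K z) + \int[muN]_z (g1 z * K z)) by field.
have ig12 := integrableD measurableT ig1 ig2.
rewrite {2}e2 -(RintegralD measurableT ig1 ig2).
rewrite -(@RintegralZl _ _ _ muN setT
  (fun z => g1 z * K z + g1 (opp_tuple z) * K z) _ measurableT ig12).
by apply: eq_Rintegral => z _; rewrite DE /g1 farN; field.
Qed.

(** After symmetrisation the truncated integrals are dominated by the absolutely integrable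
    [D z * K z], so the principal value is an ordinary limit as the indicator tends to 1. *)
Lemma frac_lapE : frac_lap sigma psi x =
  `|Gamma (- (sigma / 2))|^-1 * \int[mu]_t
    ((\int[muN]_z (sdiff psi x (row_of_tuple z) * tensor gauss_kernel t z)) *
     theta (sigma / 2) t).
Proof.
have iDK : muN.-integrable setT (fun z => (D z * K z)%:E).
  by apply: (integrable_gauss_weight (B := 2 * M) (L := C)) => //; rewrite mulr_ge0.
have <- : \int[muN]_z (D z * K z) = \int[mu]_t
    ((\int[muN]_z (D z * tensor gauss_kernel t z)) * theta (sigma / 2) t).
  apply: (@Rintegral_weight_kernel _ _ id gauss_kernel _ measurable_gauss_kernel
    _ _ _ D (2 * M) C) => //.
  - by move=> t z; exact: gauss_kernel_ge0.
  - by move=> t; exact: integral_gauss_kernel.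
  - by move=> t; exact: integral_sqr_gauss_kernel.
  - by rewrite mulr_ge0.
rewrite /frac_lap; apply/cvg_lim => //; set A := `|_|^-1.
apply: (@cvg_trans _ ((A * \int[muN]_z (D z * \1_(far r) z * K z)) @[r --> 0^'+])).
  apply: near_eq_cvg; near=> r; rewrite -truncated//.
apply: cvgMr; apply/cvg_at_rightP => u [u0 uc].
apply: (@dominated_cvg_Rintegral _ _ _ _ _ _ (fun z => `|D z * K z|)).
- move=> n; rewrite (_ : (fun z => _) = (fun z => (D z * K z) * \1_(far (u n)) z)); last first.
    by apply/funext => z; rewrite mulrAC.
  apply: measurable_funM; first by have /measurable_int/measurable_EFinP := iDK.
  exact: measurable_indic.
- move=> z; apply: cvgMl; rewrite -[X in _ --> X]mulr1.
  (* If [D z] is nonzero then [z] is nonzero by the quadratic bound, and the indicator is eventually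
     1; if it is zero the integrand vanishes for every radius. *)
  have [z0|z0] := eqVneq (D z) 0; first by rewrite z0; under eq_fun do rewrite mul0r; rewrite mul0r; exact: cvg_cst.
  have ez : 0 < enorm (row_of_tuple z).
    rewrite lt_neqAle sqrtr_ge0 andbT eq_sym; apply: contra z0 => /eqP ez.
    rewrite -normr_le0; apply: le_trans (sdiffC _) _; rewrite -enorm_sqr.
    by rewrite -/(enorm _) ez expr0n mulr0.
  apply: cvg_near_cst; have /cvgr_lt/(_ _ ez) := uc; apply: filterS => n un.
  by rewrite indicE mem_set// mulr1.
- by apply: integrable_abse iDK.
- move=> n z; rewrite !normrM; apply: ler_wpM2r => //.
  by rewrite ler_piMr// indicE ger0_norm// lern1 leq_b1.
Unshelve. all: by end_near.
Qed.

End continuum.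
End operators.
End fracs.

(** * Second order bounds *)

Section partial_derivatives.
Context {R : realType} {N : nat}.
Implicit Types (g : 'rV[R]_N -> R) (x y w v : 'rV[R]_N) (rho M : R).

Lemma is_derive_line g w v (u : R) : derivable g (w + u *: v) v ->
  is_derive u (1 : R) (fun u : R => g (w + u *: v)) ('D_v g (w + u *: v)).
Proof.
move=> dg.
have E : (fun h : R => h^-1 *: (((fun u : R => g (w + u *: v)) \o shift u) (h *: 1) - g (w + u *: v))) =
         (fun h : R => h^-1 *: ((g \o shift (w + u *: v)) (h *: v) - g (w + u *: v))).
  apply/funext => h; congr (_ *: (g _ - _)).
  by rewrite /= -[h *: 1]/(h * 1) mulr1 scalerDl addrCA.
split; first by rewrite /derivable E.
by rewrite /derive E.
Qed.

(** Mean value theorem along a segment; [d] is a reference slope, and the range $|u|\le|b|$ covers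
    both signs of [b]. *)
Lemma line_increment_le g w v (b d M : R) :
  (forall u, `|u| <= `|b| -> derivable g (w + u *: v) v /\ `|'D_v g (w + u *: v) - d| <= M) ->
  `|g (w + b *: v) - g w - d * b| <= M * `|b|.
Proof.
move=> hg; pose f (u : R) := g (w + u *: v).
have f0 : f 0 = g w by rewrite /f scale0r addr0.
have key (p q : R) : p <= q -> (forall u, u \in `[p, q] -> `|u| <= `|b|) ->
    `|f q - f p - d * (q - p)| <= M * (q - p).
  move=> pq hpq.
  have dfu u : u \in `[p, q] -> is_derive u (1 : R) f ('D_v g (w + u *: v)).
    by move=> /hpq/hg[+ _]; exact: is_derive_line.
  have cf : {within `[p, q], continuous f}.
    by apply: derivable_within_continuous => u /dfu [].
  have [c cpq ->] := MVT_segment pq (fun u hu => dfu u (subset_itv_oo_cc hu)) cf.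
  rewrite -mulrBl normrM (@ger0_norm _ (q - p)) ?subr_ge0//.
  by apply: ler_wpM2r; [rewrite subr_ge0|have /hpq/hg[] := cpq].
rewrite -f0 -/(f b); have [b0|b0] := leP 0 b.
  rewrite -[X in d * X]subr0 -[X in M * X]subr0 (ger0_norm b0); apply: key => // u.
  by rewrite in_itv/= => /andP[u0 ub]; rewrite !ger0_norm.
rewrite -normrN (_ : - (f b - f 0 - d * b) = f 0 - f b - d * (0 - b)); last by ring.
rewrite (_ : `|b| = 0 - b); last by rewrite sub0r ltr0_norm.
apply: key => [|u]; first exact: ltW.
rewrite in_itv/= => /andP[bu u0].
by rewrite (ler0_norm u0) (ltr0_norm b0) lerN2.
Qed.

Definition box x rho : set 'rV[R]_N := [set w | forall i, `|w 0 i - x 0 i| <= rho].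

(** The point moves from [x] to [x + y] one coordinate at a time through [part k], the truncation of
    [y] to its first [k] coordinates, so only partial derivatives occur. All intermediate points
    stay in the box. *)
Lemma increment_le g x y rho M (d : 'I_N -> R) :
  (forall w k, box x rho w -> derivable g w (delta_mx 0 k) /\
     `|'D_(delta_mx 0 k) g w - d k| <= M) ->
  (forall i, `|y 0 i| <= rho) ->
  `|g (x + y) - g x - \sum_(i < N) d i * y 0 i| <= M * \sum_(i < N) `|y 0 i|.
Proof.
move=> hg yrho; pose part (k : nat) : 'rV[R]_N := \row_i (if (i < k)%N then y 0 i else 0).
suff key k : (k <= N)%N -> `|g (x + part k) - g x - \sum_(i < N | (i < k)%N) d i * y 0 i| <=
    M * \sum_(i < N | (i < k)%N) `|y 0 i|.
  have := key N (leqnn _); rewrite (_ : part N = y); last first.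
    by apply/rowP => i; rewrite mxE ltn_ord.
  rewrite (eq_bigl xpredT); last by move=> i; rewrite ltn_ord.
  by rewrite [X in M * X](eq_bigl xpredT)// => i; rewrite ltn_ord.
elim: k => [|k IH] kN.
  rewrite !big_pred0// (_ : part 0%N = 0) ?addr0 ?subrr ?normr0 ?mulr0//.
  by apply/rowP => i; rewrite !mxE.
pose k' : 'I_N := Ordinal kN.
have partS : part k.+1 = part k + y 0 k' *: delta_mx 0 k'.
  apply/rowP => i; rewrite !mxE eqxx/= ltnS leq_eqVlt.
  have [ik|ik] := eqVneq i k'; first by rewrite ik /= eqxx ltnn add0r mulr1.
  rewrite mulr0 addr0; case: eqP => //= ik'; exfalso.
  by move/eqP: ik; apply; apply: val_inj.
have step : `|g (x + part k + y 0 k' *: delta_mx 0 k') - g (x + part k) - d k' * y 0 k'| <= M * `|y 0 k'|.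
  apply: line_increment_le => u uy; apply: hg => i.
  rewrite (_ : _ - x 0 i = (if (i < k)%N then y 0 i else 0) + u * (i == k')%:R); last first.
    by rewrite !mxE eqxx/=; ring.
  have [->|ik] := eqVneq i k'; first by rewrite /= ltnn add0r mulr1 (le_trans uy).
  rewrite mulr0 addr0; case: ifP => // _.
  by rewrite normr0 (le_trans _ (yrho i)).
have split_sum (F : 'I_N -> R) : \sum_(i < N | (i < k.+1)%N) F i = \sum_(i < N | (i < k)%N) F i + F k'.
  rewrite (bigD1 k') ?ltnSn//= addrC; congr (_ + _); apply: eq_bigl => i.
  rewrite ltnS leq_eqVlt -val_eqE /=.
  by case: (ltngtP i k).
rewrite !split_sum partS addrA mulrDr.
apply: le_trans (lerD (IH (ltnW kN)) step).
apply: le_trans _ (ler_normD _ _); rewrite le_eqVlt; apply/orP; left; apply/eqP; congr `|_|.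
by ring.
Qed.

(** Cauchy-Schwarz, from $2ab\le a^2+b^2$ on each pair. *)
Lemma sqr_sum_le (F : 'I_N -> R) : (\sum_(i < N) `|F i|) ^+ 2 <= N%:R * \sum_(i < N) F i ^+ 2.
Proof.
rewrite expr2 big_distrl/=.
under eq_bigr do rewrite big_distrr/=.
apply: (@le_trans _ _ (\sum_(i < N) \sum_(j < N) (F i ^+ 2 + F j ^+ 2) / 2)).
  apply: ler_sum => i _; apply: ler_sum => j _.
  have := sqr_ge0 (`|F i| - `|F j|); rewrite sqrrB !real_normK ?num_real//.
  by move: (F i ^+ 2) (F j ^+ 2) (`|F i| * `|F j|) => A B C; rewrite mulr2n; lra.
set Q := \sum_(i < N) F i ^+ 2.
have -> : \sum_(i < N) \sum_(j < N) (F i ^+ 2 + F j ^+ 2) / 2 =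
    \sum_(i < N) (F i ^+ 2 * N%:R + Q) / 2.
  apply: eq_bigr => i _.
  by rewrite -mulr_suml big_split/= sumr_const card_ord mulr_natr.
rewrite -mulr_suml big_split/= -mulr_suml sumr_const card_ord -/Q mulr_natr -mulr_natl.
by rewrite ler_pdivrMr// mulr_natr mulr2n.
Qed.

(** Let $S=\sum|y_i|$, so $S^2\le N|y|^2$. If $S>\rho$, the trivial bound $2B$ is at most
    $2BN|y|^2/\rho^2$. If $S\le\rho$, the gradient varies by at most $MNS$ per component on the box
    of radius $S$, so each one-sided increment differs from its linear part by at most $MNS^2\le
    MN^2|y|^2$. *)
Lemma sdiff_le g x rho M B : 0 < rho -> 0 <= M ->
  (forall y, `|g y| <= B) ->
  (forall w i, box x rho w -> derivable g w (delta_mx 0 i)) ->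
  (forall w i j, box x rho w -> derivable ('D_(delta_mx 0 i) g) w (delta_mx 0 j) /\
      `|'D_(delta_mx 0 j) ('D_(delta_mx 0 i) g) w| <= M) ->
  forall y, `|sdiff g x y| <=
     (M * N%:R * N%:R + 2 * B * N%:R / rho ^+ 2) * \sum_(i < N) y 0 i ^+ 2.
Proof.
move=> rho0 M0 gB dg ddg y.
have B0 : 0 <= B by apply: le_trans (gB 0).
set S := \sum_(i < N) `|y 0 i|; set Q := \sum_(i < N) _.
have SQ : S ^+ 2 <= N%:R * Q by exact: sqr_sum_le.
have S0 : 0 <= S by apply: sumr_ge0.
have Q0 : 0 <= Q by apply: sumr_ge0 => i _; exact: sqr_ge0.
have yS i : `|y 0 i| <= S.
  by rewrite /S (bigD1 i)//= lerDl sumr_ge0.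
rewrite mulrDl; have [Srho|Srho] := leP S rho; last first.
  apply: (@le_trans _ _ (2 * B)).
    rewrite /sdiff (le_trans (ler_normB _ _))// mulr_natl mulr2n lerD//.
    rewrite normrM (@ger0_norm _ 2^-1)// ler_pdivrMr// (le_trans (ler_normD _ _))//.
    by rewrite mulr_natr mulr2n lerD.
  rewrite -[leLHS]add0r; apply: lerD; first by rewrite !mulr_ge0.
  have rQ : rho ^+ 2 <= N%:R * Q.
    by apply: le_trans SQ; rewrite ler_pXn2r ?nnegrE// ltW.
  have B2 : 0 <= 2 * B by rewrite mulr_ge0.
  rewrite mulrAC ler_pdivlMr ?exprn_gt0//.
  by apply: le_trans (ler_wpM2l B2 rQ) _; rewrite mulrA.
rewrite -[leLHS]addr0; apply: lerD; last first.
  by rewrite mulr_ge0// divr_ge0 ?exprn_ge0 ?mulr_ge0// ltW.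
pose d i := 'D_(delta_mx 0 i) g x.
have bS w : box x S w -> box x rho w by move=> h i; apply: le_trans (h i) _.
have dd w i : box x S w -> `|'D_(delta_mx 0 i) g w - d i| <= M * (N%:R * S).
  move=> wS.
  have := @increment_le ('D_(delta_mx 0 i) g) x (w - x) S M (fun=> 0).
  rewrite (_ : x + (w - x) = w); last by rewrite addrC subrK.
  rewrite big1 ?subr0; last by move=> k _; rewrite mul0r.
  move=> h; apply: le_trans (h _ _) _.
  - by move=> v k /bS vr; rewrite subr0; exact: ddg.
  - by move=> k; rewrite !mxE; exact: wS.
  apply: ler_wpM2l => //; rewrite mulr_natl.
  apply: (@le_trans _ _ (\sum_(j < N) S)); last by rewrite sumr_const card_ord.
  by apply: ler_sum => j _; rewrite !mxE; exact: wS.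
have inc (z : 'rV[R]_N) : (forall i, `|z 0 i| <= S) -> \sum_(i < N) `|z 0 i| = S ->
    `|g (x + z) - g x - \sum_(i < N) d i * z 0 i| <= M * (N%:R * S) * S.
  move=> zS zE; rewrite -{2}zE; apply: (increment_le (rho := S)) => // w k wS.
  by split; [exact/dg/bS|exact: dd].
have h1 := inc y yS erefl.
have h2 : `|g (x - y) - g x - \sum_(i < N) d i * (- y) 0 i| <= M * (N%:R * S) * S.
  apply: inc => [i|]; first by rewrite mxE normrN.
  by apply: eq_bigr => i _; rewrite mxE normrN.
have e : \sum_(i < N) d i * (- y) 0 i = - \sum_(i < N) d i * y 0 i.
  by rewrite -sumrN; apply: eq_bigr => i _; rewrite mxE mulrN.
rewrite e in h2.
apply: (@le_trans _ _ (M * (N%:R * S) * S)); last first.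
  by rewrite -!mulrA; apply: ler_wpM2l => //; apply: ler_wpM2l => //; rewrite -expr2.
(* The linear parts at [y] and [- y] are opposite and cancel. *)
have -> : sdiff g x y = ((g (x + y) - g x - \sum_(i < N) d i * y 0 i) +
    (g (x - y) - g x - - \sum_(i < N) d i * y 0 i)) / 2 by rewrite /sdiff; field.
rewrite normrM (@ger0_norm _ 2^-1)// ler_pdivrMr// (le_trans (ler_normD _ _))//.
by rewrite mulr_natr mulr2n lerD.
Qed.

End partial_derivatives.

Section within_continuity.
Context {R : realType} {N : nat}.

Lemma cvg_within_continuous (I : Type) (F : set_system I) (FF : Filter F)
    (X : topologicalType) (A : set X) (f : X -> R) (u : I -> X) (p : X) :
  {within A, continuous f} -> A p -> u @ F --> p -> (\forall q \near F, A (u q)) ->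
  f (u q) @[q --> F] --> f p.
Proof.
move=> /subspace_continuousP cf Ap up Au.
apply: (cvg_comp u f _ (cf _ Ap)) => P HP.
have h : \forall q \near F, A (u q) -> P (u q) := up _ HP.
by move: Au h; apply: filterS2 => q Aq; exact.
Qed.

Lemma within_continuous_ball (A : set ('rV[R]_N * R)) (f : 'rV[R]_N * R -> R) (p : 'rV[R]_N * R) (e : R) :
  {within A, continuous f} -> A p -> 0 < e ->
  exists2 d, 0 < d & forall q, A q -> (forall i, `|q.1 0 i - p.1 0 i| < d) -> `|q.2 - p.2| < d ->
    `|f q - f p| < e.
Proof.
move=> /subspace_continuousP cf Ap e0.
have /cvgr_dist_lt/(_ _ e0) := cf _ Ap.
rewrite near_withinE => /nbhs_ballP[d /= d0 dA]; exists d => // q Aq h1 h2.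
rewrite distrC; apply: dA => //; split => /=.
  by split => // i j; rewrite ord1 /ball /= distrC.
by rewrite /ball /= distrC.
Qed.

End within_continuity.

(** * Consistency *)

Section sequential_consistency.
Context {R : realType} {N : nat}.
Local Notation mR := (measurableTypeR R).
Local Notation mu := (@lebesgue_measure R).
Local Notation muN := (@lebesgue_tuple R N).
Variables (sigma : R) (h : R^nat) (psi_ : nat -> 'rV[R]_N -> R) (psi : 'rV[R]_N -> R).
Variables (x_ : nat -> 'rV[R]_N) (x : 'rV[R]_N) (M C : R).
Hypothesis sigma_bnd : 0 < sigma < 2.
Hypothesis h_gt0 : forall n, 0 < h n.
Hypothesis h_le1 : forall n, h n <= 1.
Hypothesis h_cvg : h @ \oo --> 0.
Hypothesis psi_cont : continuous psi.
Hypothesis psi_M : forall n y, `|psi_ n y| <= M.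
Hypothesis psiM : forall y, `|psi y| <= M.
Hypothesis C0 : 0 <= C.
Hypothesis sdiff_C : forall n y, `|sdiff (psi_ n) (x_ n) y| <= C * \sum_(i < N) y 0 i ^+ 2.
Hypothesis sdiffC : forall y, `|sdiff psi x y| <= C * \sum_(i < N) y 0 i ^+ 2.
Hypothesis sdiff_cvg : forall (y_ : nat -> 'rV[R]_N) y, y_ @ \oo --> y ->
  sdiff (psi_ n) (x_ n) (y_ n) @[n --> \oo] --> sdiff psi x y.

Let a01 : 0 < sigma / 2 < 1.
Proof. by case/andP: sigma_bnd => h1 h2; apply/andP; split; lra. Qed.
Let M0 : 0 <= M. Proof. by apply: le_trans (psiM 0). Qed.
Let M2 : 0 <= 2 * M. Proof. by rewrite mulr_ge0. Qed.

Let D n (z : N.-tuple mR) := sdiff (psi_ n) (x_ n) (lattice_point (h n) z).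
Let Doo (z : N.-tuple mR) := sdiff psi x (row_of_tuple z).

Let mD n : measurable_fun setT (D n : N.-tuple mR -> mR).
Proof.
exact: (measurable_cell_fun (T := mR)
  (fun j => sdiff (psi_ n) (x_ n) (h n *: map_mx intr j)) (h_gt0 n)).
Qed.

Let sdiffM (g : 'rV[R]_N -> R) w y : (forall y, `|g y| <= M) -> `|sdiff g w y| <= 2 * M.
Proof.
move=> gM; rewrite /sdiff (le_trans (ler_normB _ _))// mulr_natl mulr2n lerD//.
rewrite normrM (@ger0_norm _ 2^-1)// ler_pdivrMr// (le_trans (ler_normD _ _))//.
by rewrite mulr_natr mulr2n lerD.
Qed.

Let D_C n z : `|D n z| <= C * \sum_(i < N) (h n * (fl (h n) (tnth z i))%:~R) ^+ 2.
Proof.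
by apply: le_trans (sdiff_C _ _) _; under eq_bigr do rewrite lattice_pointE.
Qed.

Let I n t := \int[muN]_z (D n z * tensor (lattice_kernel (h n)) t z).

(** The domination is a product of Cauchy weights $K/(1+z_i^2)$, of integral $(K\pi)^N$; the
    constant [K] depends on [t] only, not on [n]. *)
Let I_cvg t : 0 < t -> I n t @[n --> \oo] --> \int[muN]_z (Doo z * tensor gauss_kernel t z).
Proof.
move=> t0; have [K hK] := lattice_kernel_le h_gt0 h_le1 h_cvg t0.
have K0 : 0 <= K.
  have := le_trans (lattice_kernel_ge0 t 0 (h_gt0 0%N)) (hK 0%N 0).
  by rewrite expr0n/= addr0 invr1 mulr1.
pose G (z : N.-tuple mR) := \prod_(i < N) (K * (1 + tnth z i ^+ 2)^-1).
have mK : measurable_fun setT (fun u : mR => K * (1 + u ^+ 2)^-1 : mR).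
  by apply: measurable_funM => //; exact: measurable_oneDsqrV.
have K1 u : 0 <= K * (1 + u ^+ 2)^-1.
  by rewrite mulr_ge0// invr_ge0 addr_ge0// sqr_ge0.
have G0 z : 0 <= G z by apply: prodr_ge0.
have intG : (\int[muN]_z (G z)%:E = (\prod_(i < N) (K * pi))%:E)%E.
  apply: (ge0_integral_tuple_prod (g := fun _ u => K * (1 + u ^+ 2)^-1)) => // _.
  under eq_integral do rewrite EFinM.
  rewrite ge0_integralZl//.
  - by rewrite integral_oneDsqrV.
  - by apply/measurable_EFinP; exact: measurable_oneDsqrV.
  - by move=> u _; rewrite lee_fin invr_ge0 addr_ge0// sqr_ge0.
have iG : muN.-integrable setT (fun z => (G z)%:E).
  apply/integrableP; split.
    apply/measurable_EFinP; apply: measurable_prod => i _.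
    by apply: (measurableT_comp mK); exact: measurable_tnth.
  under eq_integral do rewrite abse_EFin (ger0_norm (G0 _)).
  by rewrite intG ltry.
apply: (@dominated_cvg_Rintegral _ _ _ muN (fun n z => D n z * tensor (lattice_kernel (h n)) t z)
  _ (fun z => 2 * M * G z)).
- move=> n; apply: measurable_funM; first exact: mD.
  exact: (measurable_tensor_section (measurable_lattice_kernel (h_gt0 n))).
- move=> z; apply: cvgM.
    by apply: sdiff_cvg; exact: cvg_lattice_point_rV.
  apply: cvg_big => [|i _]; first exact: mul_continuous.
  exact: lattice_kernel_cvg.
- by have := integrableZl measurableT (2 * M) iG.
- move=> n z; rewrite normrM; apply: ler_pM => //; first exact: sdiffM.
  rewrite ger0_norm; last by apply: tensor_ge0 => t' u; exact: lattice_kernel_ge0.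
  apply: ler_prod => i _; rewrite lattice_kernel_ge0//=; exact: hK.
Qed.

(** The quadratic bound has the same [C] for all [n], so $\min(2M,2NCt)$ times [theta] dominates the
    time integrands, including near $t=0$ where [I_cvg] gives no uniformity. *)
Lemma cvg_disc_frac_lap :
  disc_frac_lap sigma (h n) (psi_ n) (x_ n) @[n --> \oo] --> frac_lap sigma psi x.
Proof.
rewrite (frac_lapE sigma_bnd psi_cont psiM C0 sdiffC).
under eq_fun do rewrite (disc_frac_lapE sigma_bnd _ (h_gt0 _) (psi_M _)).
apply: cvgMr.
apply: (@dominated_cvg_Rintegral _ _ _ mu (fun n t => I n t * theta (sigma / 2) t)
  _ (fun t => Num.min (2 * M) (2 * N%:R * C * t) * theta (sigma / 2) t)).
- move=> n; apply/measurable_EFinP.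
  have := @integrable_theta_weight _ _ (fun t => h n * (fl (h n) t)%:~R) (lattice_kernel (h n))
    (measurable_lattice_point (h_gt0 n)) (measurable_lattice_kernel (h_gt0 n)) _ _ _
    (D n) (2 * M) C _ _ _ _ _ _ a01.
  move=> iI; apply: (measurable_int mu); apply: iI.
  + by move=> t z; exact: lattice_kernel_ge0.
  + by move=> t; exact: integral_lattice_kernel.
  + by move=> t; exact: integral_sqr_lattice_kernel.
  + exact: mD.
  + exact: M2.
  + exact: C0.
  + by move=> z; exact: sdiffM.
  + exact: D_C.
- move=> t; have [t0|t0] := ltP 0 t; last first.
    by rewrite /theta ltNge t0 mulr0; under eq_fun do rewrite mulr0; exact: cvg_cst.
  by apply: cvgMl; exact: I_cvg.
- by apply: integrable_min_theta => //; rewrite !mulr_ge0.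
- move=> n t; rewrite normrM (ger0_norm (theta_ge0 _ _)).
  have [t0|t0] := ltP 0 t; last by rewrite /theta ltNge t0 !mulr0.
  apply: ler_wpM2r; first exact: theta_ge0.
  apply: (@norm_Rintegral_weight_le _ _ (fun t => h n * (fl (h n) t)%:~R) (lattice_kernel (h n))
    (measurable_lattice_point (h_gt0 n)) (measurable_lattice_kernel (h_gt0 n)) _ _ _
    (D n) (2 * M) C).
  + by move=> t' z; exact: lattice_kernel_ge0.
  + by move=> t'; exact: integral_lattice_kernel.
  + by move=> t'; exact: integral_sqr_lattice_kernel.
  + exact: mD.
  + exact: M2.
  + exact: C0.
  + by move=> z; exact: sdiffM.
  + exact: D_C.
  + exact: t0.
Qed.

End sequential_consistency.

Section cylinder_consistency.
Context {R : realType} {N : nat}.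
Variables (sigma T B : R) (phi : 'rV[R]_N * R -> R) (x0 : 'rV[R]_N) (t0 : R).
Hypothesis phi_C2 : C2_cylinder T phi.
Hypothesis phi_B : forall p, cylinder T p -> `|phi p| <= B.
Hypothesis t0_in : 0 <= t0 <= T.

Lemma ler_sum2 (G : 'I_N -> 'I_N -> R) i j : (forall i j, 0 <= G i j) ->
  G i j <= \sum_(i < N) \sum_(j < N) G i j.
Proof.
move=> G0; apply: (@le_trans _ _ (\sum_(j < N) G i j)).
  by rewrite (bigD1 j)//= lerDl sumr_ge0.
by rewrite [leRHS](bigD1 i)//= lerDl sumr_ge0// => k _; exact: sumr_ge0.
Qed.

Lemma dxE i (g : 'rV[R]_N * R -> R) y s :
  dx i g (y, s) = 'D_(delta_mx 0 i) (fun y => g (y, s)) y.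
Proof. by rewrite /dx. Qed.

Lemma dxxE i j (g : 'rV[R]_N * R -> R) y s :
  dx j (dx i g) (y, s) = 'D_(delta_mx 0 j) ('D_(delta_mx 0 i) (fun y => g (y, s))) y.
Proof. by rewrite dxE. Qed.

Lemma sdiff_cylinder_le : exists r C : R, [/\ 0 < r, 0 <= C &
  forall (x : 'rV[R]_N) s, (forall i, `|x 0 i - x0 0 i| < r) -> 0 <= s <= T -> `|s - t0| < r ->
  forall y, `|sdiff (fun y => phi (y, s)) x y| <= C * \sum_(i < N) y 0 i ^+ 2].
Proof.
have [[_ d1 _ _ _] d2 _] := phi_C2.
have B0 : 0 <= B by apply: le_trans (phi_B (p := (x0, t0)) t0_in).
pose p0 := (x0, t0).
pose P i j r := forall q : 'rV[R]_N * R, cylinder T q -> (forall k, `|q.1 0 k - x0 0 k| < r) ->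
  `|q.2 - t0| < r -> `|dx j (dx i phi) q - dx j (dx i phi) p0| < 1.
have Pnear : \forall r \near 0^'+, forall i j, P i j r.
  apply: filter_forall => i; apply: filter_forall => j.
  have [_ _ _ c _] := d2 i.
  have [d d0 hd] := @within_continuous_ball _ _ _ _ p0 _ (c j) t0_in ltr01.
  have : \forall r \near (0 : R)^'+, r < d by exact: nbhs_right_lt.
  apply: filterS => r rd q qT h1 h2; apply: hd => // [k|]; last exact: lt_trans rd.
  exact: lt_trans (h1 k) rd.
have [r [r0 hr]] : exists r : R, 0 < r /\ forall i j, P i j r.
  exact: (filter_ex (filterI (nbhs_right_gt (0 : R)) Pnear)).
pose M := \sum_(i < N) \sum_(j < N) `|dx j (dx i phi) p0| + 1.
have M0 : 0 <= M by rewrite addr_ge0// sumr_ge0// => i _; exact: sumr_ge0.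
have r2 : 0 < r / 2 by rewrite divr_gt0.
exists (r / 2), (M * N%:R * N%:R + 2 * B * N%:R / (r / 2) ^+ 2); split => //.
  apply: addr_ge0; first by rewrite !mulr_ge0.
  by rewrite divr_ge0 ?exprn_ge0 ?mulr_ge0// ltW.
move=> x s xr sT sr y.
have near0 w : box x (r / 2) w -> forall k, `|w 0 k - x0 0 k| < r.
  move=> wx k; rewrite [X in _ < X](splitr r).
  rewrite (_ : w 0 k - x0 0 k = (w 0 k - x 0 k) + (x 0 k - x0 0 k)); last by ring.
  by apply: le_lt_trans (ler_normD _ _) _; exact: ler_ltD.
apply: (@sdiff_le _ _ _ x (r / 2) M B) => // [z|w i _|w i j wx].
- exact: phi_B.
- exact: (d1 i (w, s)).
have [_ dd _ _ _] := d2 i; split; first exact: (dd j (w, s)).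
have sr' : `|s - t0| < r by apply: lt_trans sr _; rewrite ltr_pdivrMr// mulr_natr mulr2n ltrDl.
have := hr i j (w, s) sT (near0 w wx) sr'.
set b := dx j (dx i phi) p0.
rewrite [X in `|X - b|](_ : _ = 'D_(delta_mx 0 j) ('D_(delta_mx 0 i) (fun y => phi (y, s))) w); last exact: dxxE.
set a := 'D_(delta_mx 0 j) _ w => ab.
rewrite (_ : a = b + (a - b)); last by ring.
apply: le_trans (ler_normD _ _) _; apply: lerD; last exact: ltW.
exact: (@ler_sum2 (fun i j => `|dx j (dx i phi) p0|)).
Qed.

Lemma cvg_dist_harmonic (u : R^nat) (l r : R) :
  (forall n, `|u n - l| < r * n.+1%:R^-1) -> u @ \oo --> l.
Proof.
move=> ul; have rc : r * n.+1%:R^-1 @[n --> \oo] --> 0.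
  by rewrite -[X in _ --> X](mulr0 r); apply: cvgMr; exact: cvg_harmonic.
apply: (@squeeze_cvgr _ _ _ _ (fun n => l - r * n.+1%:R^-1) (fun n => l + r * n.+1%:R^-1)).
- by apply: nearW => n; have := ul n; rewrite ltr_distl => /andP[h1 h2]; rewrite !ltW.
- by rewrite -[X in _ --> X]subr0; apply: cvgB => //; exact: cvg_cst.
- by rewrite -[X in _ --> X]addr0; apply: cvgD => //; exact: cvg_cst.
Qed.

Hypothesis sigma_bnd : 0 < sigma < 2.

(** If it failed, counterexamples chosen at the scales [d n] would form a sequence with mesh, time
    and point converging, against [cvg_disc_frac_lap]. *)
Lemma disc_frac_lap_consistent (e : R) : 0 < e -> exists2 d : R, 0 < d &
  forall h s (x : 'rV[R]_N), 0 < h < d -> 0 <= s <= T -> `|s - t0| < d ->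
  (forall i, `|x 0 i - x0 0 i| < d) ->
  `|disc_frac_lap sigma h (fun y => phi (y, s)) x -
    frac_lap sigma (fun y => phi (y, t0)) x0| < e.
Proof.
move=> e0; have [r [C [r0 C0 hC]]] := sdiff_cylinder_le.
have [[phic _ _ _ _] _ _] := phi_C2.
(* The cap by 1 ensures the mesh bound of the sequential statement, the cap by [r] the uniform
   quadratic bound. *)
pose r' := Num.min r 1; have r'0 : 0 < r' by rewrite lt_min r0 ltr01.
pose d n : R := r' * n.+1%:R^-1.
have d0 n : 0 < d n by rewrite mulr_gt0// invr_gt0.
have dr' n : d n <= r' by rewrite ler_piMr ?(ltW r'0)// invf_le1// ler1n.
have dr n : d n <= r by apply: le_trans (dr' n) _; rewrite ge_min lexx.
have d1 n : d n <= 1 by apply: le_trans (dr' n) _; rewrite ge_min lexx orbT.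
apply: contrapT => nex.
have ex n : exists q : R * R * 'rV[R]_N, [/\ 0 < q.1.1 < d n, 0 <= q.1.2 <= T,
    `|q.1.2 - t0| < d n, forall i, `|q.2 0 i - x0 0 i| < d n &
    e <= `|disc_frac_lap sigma q.1.1 (fun y => phi (y, q.1.2)) q.2 -
    frac_lap sigma (fun y => phi (y, t0)) x0|].
  apply: contrapT => nq; apply: nex; exists (d n) => // h s x hd sT sd xd.
  by rewrite ltNge; apply/negP => he; apply: nq; exists (h, s, x).
have [q hq] := choice ex.
have cs : (q n).1.2 @[n --> \oo] --> t0.
  by apply: (@cvg_dist_harmonic _ _ r') => n; have [] := hq n.
have cx : (q n).2 @[n --> \oo] --> x0.
  by apply: cvg_rV => i; apply: (@cvg_dist_harmonic _ _ r') => n; have [_ _ _ + _] := hq n.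
have ch : (q n).1.1 @[n --> \oo] --> 0.
  apply: (@cvg_dist_harmonic _ _ r') => n; have [/andP[h1 h2] _ _ _ _] := hq n.
  by rewrite subr0 gtr0_norm.
have phicvg (y_ : nat -> 'rV[R]_N) (y : 'rV[R]_N) : y_ @ \oo --> y ->
    phi (y_ n, (q n).1.2) @[n --> \oo] --> phi (y, t0).
  move=> yc.
  have := @cvg_within_continuous R nat \oo _ _ _ _ (fun n => (y_ n, (q n).1.2)) (y, t0) phic.
  apply => //.
    exact: (cvg_pair yc cs).
  by apply: nearW => n; have [] := hq n.
have : disc_frac_lap sigma (q n).1.1 (fun y => phi (y, (q n).1.2)) (q n).2 @[n --> \oo] -->
    frac_lap sigma (fun y => phi (y, t0)) x0.
  apply: (@cvg_disc_frac_lap _ _ sigma (fun n => (q n).1.1) (fun n y => phi (y, (q n).1.2))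
    (fun y => phi (y, t0)) (fun n => (q n).2) x0 B C) => //.
  - by move=> n; have [/andP[]] := hq n.
  - by move=> n; have [/andP[_ /ltW h] _ _ _ _] := hq n; exact: le_trans h _.
  - move=> y.
    have := @cvg_within_continuous R 'rV[R]_N (nbhs y) _ _ _ _ (fun y => (y, t0)) (y, t0) phic.
    apply => //.
      by exact: (cvg_pair cvg_id (cvg_cst _)).
    exact: nearW.
  - by move=> n y; apply: phi_B; have [] := hq n.
  - by move=> y; exact: phi_B.
  - move=> n y; have [_ h2 h3 h4 _] := hq n; apply: hC => // [i|].
      exact: lt_le_trans (h4 i) _.
    exact: lt_le_trans h3 _.
  - by move=> y; apply: hC => // [i|]; rewrite subrr normr0.
  - move=> y_ y yc; rewrite /sdiff; apply: cvgB; last exact: phicvg.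
    by apply: cvgMl; apply: cvgD; apply: phicvg; [exact: cvgD|exact: cvgB].
move=> /cvgr_dist_lt/(_ _ e0)/filter_ex[n]; rewrite distrC ltNge => /negP; apply.
by have [] := hq n.
Qed.

End cylinder_consistency.

Section limits.
Context {R : realType}.

Lemma cvg_at_right_ball (g : R -> R) (l e : R) : g h @[h --> 0^'+] --> l -> 0 < e ->
  exists2 d, 0 < d & forall h, 0 < h < d -> `|g h - l| < e.
Proof.
move=> /cvgrPdist_lt/[apply]; rewrite near_withinE => /nbhs_ballP[d /= d0 hd].
exists d => // h /andP[h0 hd']; rewrite distrC; apply: hd => //.
by rewrite /ball /= sub0r normrN gtr0_norm.
Qed.

Lemma limf_einf_ge (T : choiceType) (X : filteredType T) (f : X -> R) (F : set (set X)) (L : R) :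
  (forall e, 0 < e -> F [set q | L - e <= f q]) -> (L%:E <= limf_einf (EFin \o f) F)%E.
Proof.
move=> h; apply/lee_subgt0Pr => e e0; rewrite limf_einfE.
apply: (@le_trans _ _ (ereal_inf [set (EFin \o f) x | x in [set q | L - e <= f q]])).
  by apply: le_ereal_inf_tmp => _ [q /= hq <-]; rewrite -EFinB lee_fin.
by apply: ereal_sup_ubound; exists [set q | L - e <= f q] => //; exact: h.
Qed.

Lemma limf_esup_le (T : choiceType) (X : filteredType T) (f : X -> R) (F : set (set X)) (L : R) :
  (forall e, 0 < e -> F [set q | f q <= L + e]) -> (limf_esup (EFin \o f) F <= L%:E)%E.
Proof.
move=> h; apply/lee_addgt0Pr => e e0; rewrite limf_esupE.
apply: (@le_trans _ _ (ereal_sup [set (EFin \o f) x | x in [set q | f q <= L + e]])).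
  by apply: ereal_inf_lbound; exists [set q | f q <= L + e] => //; exact: h.
by apply: ge_ereal_sup => _ [q /= hq <-]; rewrite -EFinD lee_fin.
Qed.

Lemma scheme_limit_ball N (T t0 d : R) (x0 : 'rV[R]_N) (P : set (R * R * 'rV[R]_N * R)) :
  0 < d -> (forall h t (x : 'rV[R]_N) xi, 0 < h < d -> 0 <= t <= T -> `|t - t0| < d ->
    (forall i, `|x 0 i - x0 0 i| < d) -> `|xi| < d -> P (h, t, x, xi)) ->
  scheme_limit T t0 x0 P.
Proof.
move=> d0 hP; rewrite /scheme_limit; apply/nbhs_ballP; exists d => //.
move=> [[[h t] x] xi] /= [[[/= h1 h2] [_ h3]] h4] [h0 tT].
apply: hP => //.
- by rewrite h0/=; move: h1; rewrite /ball/= sub0r normrN gtr0_norm.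
- by rewrite distrC.
- by move=> i; rewrite distrC; exact: h3.
- by move: h4; rewrite /ball/= sub0r normrN.
Qed.

(** The neighbourhoods are not deleted, so [x] itself enters every supremum. *)
Lemma usc_envelope_ge N (u : 'rV[R]_N -> R) x : ((u x)%:E <= usc_envelope u x)%E.
Proof.
rewrite /usc_envelope limf_esupE; apply: le_ereal_inf_tmp => _ [V xV <-].
by apply: ereal_sup_ubound; exists x => //; exact: nbhs_singleton.
Qed.

Lemma lsc_envelope_le N (u : 'rV[R]_N -> R) x : (lsc_envelope u x <= (u x)%:E)%E.
Proof.
rewrite /lsc_envelope limf_einfE; apply: ge_ereal_sup => _ [V xV <-].
by apply: ereal_inf_lbound; exists x => //; exact: nbhs_singleton.
Qed.

End limits.

Section time_derivative.
Context {R : realType} {N : nat}.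
Variables (T : R) (phi : 'rV[R]_N * R -> R).
Hypothesis phi_C1 : C1_cylinder T phi.

(** Strictly inside the interval the limit of [dt_quot] relative to $[0,T]$ is a two-sided
    derivative: an increment smaller than [s] and [T - s] keeps the time in $[0,T]$. *)
Lemma is_derive_dt (x : 'rV[R]_N) (s : R) : 0 < s < T ->
  is_derive s (1 : R) (fun u : R => phi (x, u)) (dt T phi (x, s)).
Proof.
move=> sT; have /andP[s0 s1] := sT; have [_ _ + _ _] := phi_C1 => /(_ (x, s)).
rewrite /cylinder /= !ltW// => /(_ erefl) /cvgrPdist_lt cl.
have dl : h^-1 *: (((fun u : R => phi (x, u)) \o shift s) (h *: 1) - phi (x, s)) @[h --> (0 : R)^'] -->
    dt T phi (x, s).
  apply/cvgrPdist_lt => e e0; have := cl e e0.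
  rewrite !near_withinE => /nbhs_ballP[d /= d0 hd].
  apply/nbhs_ballP.
  exists (Num.min d (Num.min s (T - s))); first by rewrite /= !lt_min d0 s0 subr_gt0.
  move=> h; rewrite /ball /= sub0r normrN !lt_min => /and3P[h1 h2 h3] h0.
  have := hd (h + s); rewrite /dt_quot /= addrK -[h *: 1]/(h * 1) mulr1; apply.
  - by rewrite /ball /= opprD addrCA subrr addr0 normrN.
  - by rewrite -subr_eq0 addrK.
  - by rewrite in_itv/=; move: h2 h3; rewrite !ltr_norml => /andP[? ?] /andP[? ?]; apply/andP; split; lra.
split; first by apply/cvg_ex; exists (dt T phi (x, s)); exact: dl.
by apply/cvg_lim => //; exact: dl.
Qed.

(** The mean value theorem on $[t-k,t]$ uses the derivative only in the open interval, so $t-k=0$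
    and $t=T$ are covered. Halving [d] leaves room for the backward step [k]. *)
Lemma dt_quot_consistent (x0 : 'rV[R]_N) (t0 e : R) : 0 <= t0 <= T -> 0 < e ->
  exists2 d : R, 0 < d & forall (x : 'rV[R]_N) t k, 0 < k -> k < d -> k <= t -> t <= T ->
    `|t - t0| < d -> (forall i, `|x 0 i - x0 0 i| < d) ->
  `|(phi (x, t) - phi (x, t - k)) / k - dt T phi (x0, t0)| < e.
Proof.
move=> t0T e0; have [phic _ _ _ cdt] := phi_C1.
have [d d0 hd] := @within_continuous_ball _ _ _ _ (x0, t0) _ cdt t0T e0.
exists (d / 2); first by rewrite divr_gt0.
move=> x t k k0 kd kt tT td xd.
have tk : t - k < t by rewrite ltrBlDr ltrDl.
have sub s : t - k <= s <= t -> 0 <= s <= T.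
  by move=> /andP[h1 h2]; apply/andP; split; lra.
have cphi : {within `[t - k, t], continuous (fun u => phi (x, u))}.
  apply/subspace_continuousP => s; rewrite /= in_itv/= => hs.
  have := @cvg_within_continuous R R (within `[t - k, t] (nbhs s)) _ _ _ _
    (fun u => (x, u)) (x, s) phic.
  apply.
  - exact: sub.
  - exact: (cvg_pair (cvg_cst x) (@cvg_within _ (nbhs s) _ `[t - k, t])).
  - by rewrite near_withinE; apply: nearW => u /=; rewrite in_itv/=; exact: sub.
have dphi s : s \in `]t - k, t[ -> is_derive s (1 : R) (fun u => phi (x, u)) (dt T phi (x, s)).
  by rewrite in_itv/= => /andP[h1 h2]; apply: is_derive_dt; apply/andP; split; lra.
have [c ct ->] := MVT tk dphi cphi.
rewrite opprB addrCA subrr addr0 mulfK ?gt_eqF//.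
move: ct; rewrite in_itv/= => /andP[c1 c2].
apply: hd => /= [|i|].
- by apply: sub; rewrite !ltW.
- by apply: lt_trans (xd i) _; rewrite ltr_pdivrMr// mulr_natr mulr2n ltrDl.
- by move: td; rewrite !ltr_norml => /andP[? ?]; apply/andP; split; lra.
Qed.

End time_derivative.

(** * The scheme in its two time regimes *)

Section scheme_consistency.
Context {R : realType} {N : nat}.
Variables (sigma T LF : R) (F : R -> R) (f : 'rV[R]_N * R -> R) (u0 : 'rV[R]_N -> R).
Variables (tau eta : R -> R) (phi : 'rV[R]_N * R -> R) (x0 : 'rV[R]_N) (t0 : R).
Hypothesis sigma_bnd : 0 < sigma < 2.
Hypothesis F_incr_lip : forall l1 l2 : R, F l1 - F l2 <= LF * Num.max 0 (l1 - l2).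
Hypothesis f_cont : {within cylinder T, continuous f}.
Hypothesis u0_cont : continuous u0.
Hypothesis tau_gt0 : forall h : R, 0 < h -> 0 < tau h.
Hypothesis tau_cvg : tau h @[h --> 0^'+] --> 0.
Hypothesis phi_C2 : C2_cylinder T phi.
Hypothesis phi_Cb : Cb_cylinder T phi.
Hypothesis eta_ge0 : forall h : R, 0 < h -> 0 <= eta h.
Hypothesis eta_cvg : eta h / tau h @[h --> 0^'+] --> 0.
Hypothesis t0_in : 0 <= t0 <= T.

(** The one-sided bound is applied in both orders; the absolute value is taken because the sign of
    [LF] is not prescribed. *)
Lemma lipschitz_of_incr a b : `|F a - F b| <= `|LF| * `|a - b|.
Proof.
have key c d : F c - F d <= `|LF| * `|c - d|.
  apply: le_trans (F_incr_lip c d) _.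
  apply: (@le_trans _ _ (`|LF| * Num.max 0 (c - d))).
    by apply: ler_wpM2r; [rewrite le_max lexx|exact: ler_norm].
  by apply: ler_wpM2l => //; rewrite ge_max normr_ge0 ler_norm.
by rewrite ler_norml key andbT lerNl opprB distrC key.
Qed.

(* [s] will be [eta h] or [- eta h]. *)
Definition shifted_scheme h (x : 'rV[R]_N) t xi s :=
  scheme sigma F f u0 tau h x t (phi (x, t) + xi + s) (fun p => phi p + xi).

(** Four errors of at most a quarter each: the time quotient, the nonlinear term, the source [f],
    and [s / tau h], which is where $\eta_h/\tau\to0$ enters. Half of [d] is reserved for the shift
    from [t] to [t - tau h]. *)
Lemma scheme_consistent_interior (e : R) : 0 < e -> exists2 d : R, 0 < d &
  forall h t (x : 'rV[R]_N) xi s, 0 < h < d -> 0 <= t <= T -> `|t - t0| < d ->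
    (forall i, `|x 0 i - x0 0 i| < d) -> `|s| <= eta h -> tau h <= t ->
  `|shifted_scheme h x t xi s - equation sigma T F f phi (x0, t0)| < e.
Proof.
move=> e0; have e4 : 0 < e / 4 by rewrite divr_gt0.
have [phi_C1 _ _] := phi_C2.
have [B phiB] : exists B, forall p, cylinder T p -> `|phi p| <= B.
  by have [_ /pinfty_ex_gt0[B _ hB]] := phi_Cb; exists B.
have [d1 d1_gt0 hd1] := dt_quot_consistent phi_C1 x0 t0_in e4.
(* Adding one keeps the divisor positive when [LF] is 0. *)
have L1 : 0 < `|LF| + 1 by rewrite ltr_wpDl.
have eL : 0 < e / 4 / (`|LF| + 1) by rewrite divr_gt0.
have [d2 d2_gt0 hd2] := disc_frac_lap_consistent x0 phi_C2 phiB t0_in sigma_bnd eL.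
have [d3 d3_gt0 hd3] := @within_continuous_ball _ _ _ _ (x0, t0) _ f_cont t0_in e4.
have [d4 d4_gt0 hd4] := cvg_at_right_ball eta_cvg e4.
pose d := Num.min d1 (Num.min d2 d3).
have d_gt0 : 0 < d by rewrite !lt_min d1_gt0 d2_gt0.
have dd2 : 0 < d / 2 by rewrite divr_gt0.
have [d5 d5_gt0 hd5] := cvg_at_right_ball tau_cvg dd2.
have [dd1 [ddd2 dd3]] : d <= d1 /\ d <= d2 /\ d <= d3.
  by rewrite /d !ge_min !lexx ?orbT.
exists (Num.min (d / 2) (Num.min d4 d5)); first by rewrite !lt_min dd2 d4_gt0.
move=> h t x xi s; rewrite !lt_min => /and4P[h0 hd h4 h5] /andP[t_ge0 tT] /and3P[td _ _] xd sh tht.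
have tau0 := tau_gt0 h0.
have taud : tau h < d / 2.
  by have := hd5 h; rewrite h0 h5 subr0 gtr0_norm// => ->.
have xdd i : `|x 0 i - x0 0 i| < d / 2 by have := xd i; rewrite !lt_min => /andP[].
have half : d / 2 < d by rewrite ltr_pdivrMr// mulr_natr mulr2n ltrDl.
have tsT : 0 <= t - tau h <= T.
  by rewrite subr_ge0 tht/= (le_trans _ tT)// gerBl ltW.
have tsd : `|t - tau h - t0| < d.
  rewrite addrAC [ltRHS]splitr; apply: le_lt_trans (ler_normB _ _) _.
  by apply: ltrD => //; rewrite gtr0_norm.
have k1 : `|(phi (x, t) - phi (x, t - tau h)) / tau h - dt T phi (x0, t0)| < e / 4.
  apply: hd1 => // [||i].
  - by apply: lt_trans taud _; exact: lt_le_trans half _.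
  - by apply: lt_trans td _; exact: lt_le_trans half _.
  - by apply: lt_trans (xdd i) _; exact: lt_le_trans half _.
have k2 : `|F (disc_frac_lap sigma h (fun y => phi (y, t - tau h)) x) -
    F (frac_lap sigma (fun y => phi (y, t0)) x0)| < e / 4.
  apply: le_lt_trans (lipschitz_of_incr _ _) _.
  apply: (@le_lt_trans _ _ ((`|LF| + 1) * `|disc_frac_lap sigma h (fun y => phi (y, t - tau h)) x -
    frac_lap sigma (fun y => phi (y, t0)) x0|)).
    by apply: ler_wpM2r => //; rewrite lerDl.
  rewrite mulrC -ltr_pdivlMr//; apply: hd2 => // [||i].
  - by rewrite h0/=; apply: lt_trans hd _; exact: lt_le_trans half _.
  - exact: lt_le_trans tsd _.
  - by apply: lt_trans (xdd i) _; exact: lt_le_trans half _.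
have k3 : `|f (x, t - tau h) - f (x0, t0)| < e / 4.
  apply: hd3 => //= [i|].
    by apply: lt_trans (xdd i) _; exact: lt_le_trans half _.
  exact: lt_le_trans tsd _.
have k4 : `|s / tau h| < e / 4.
  have := hd4 h; rewrite h0 h4 subr0 => /(_ erefl).
  apply: le_lt_trans; rewrite !normrM (ger0_norm (eta_ge0 h0)).
  by apply: ler_wpM2r.
rewrite /shifted_scheme /scheme tht /equation /=.
(* The operator annihilates constants, and [xi] also cancels in the time quotient, so its size is
   irrelevant in this regime. *)
have -> : disc_frac_lap sigma h (fun y => phi (y, t - tau h) + xi) x =
    disc_frac_lap sigma h (fun y => phi (y, t - tau h)) x.
  rewrite /disc_frac_lap; congr (family_sum _ _); apply/funext => j; congr (_ * _).
  by ring.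
have -> : (phi (x, t) + xi + s - (phi (x, t - tau h) + xi)) / tau h =
    (phi (x, t) - phi (x, t - tau h)) / tau h + s / tau h by rewrite -mulrDl; congr (_ / _); ring.
move: k1 k2 k3 k4; move: (F _) (F _) (f _) (f _) (s / _) (_ / tau h) (dt _ _ _) => a1 a2 a3 a4 a5 a6 a7.
rewrite !ltr_norml => /andP[p1 q1] /andP[p2 q2] /andP[p3 q3] /andP[p4 q4].
by apply/andP; split; lra.
Qed.

(** In the initial layer the scheme is a plain difference, so [xi] and [s] enter undivided and must
    be small themselves; for [s] this follows from $\eta_h<\tau<e/4$ for small $h$. *)
Lemma scheme_consistent_initial (e : R) : t0 = 0 -> 0 < e -> exists2 d : R, 0 < d &
  forall h t (x : 'rV[R]_N) xi s, 0 < h < d -> 0 <= t <= T -> `|t - t0| < d ->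
    (forall i, `|x 0 i - x0 0 i| < d) -> `|xi| < d -> `|s| <= eta h -> t < tau h ->
  `|shifted_scheme h x t xi s - (phi (x0, 0) - u0 x0)| < e.
Proof.
move=> t00 e0; have e4 : 0 < e / 4 by rewrite divr_gt0.
have [phic _] := phi_Cb.
have [d1 d1_gt0 hd1] := @within_continuous_ball _ _ _ _ (x0, t0) _ phic t0_in e4.
have [d2 d2_gt0 hd2] : exists2 d : R, 0 < d & forall x : 'rV[R]_N,
    (forall i, `|x 0 i - x0 0 i| < d) -> `|u0 x - u0 x0| < e / 4.
  have /cvgrPdist_lt/(_ _ e4)/nbhs_ballP[d /= d_gt0 hd] := @u0_cont x0.
  exists d => // x xd; rewrite distrC; apply: hd.
  by split => // i j; rewrite ord1 /ball /= distrC.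
have [d3 d3_gt0 hd3] := cvg_at_right_ball eta_cvg ltr01.
have [d4 d4_gt0 hd4] := cvg_at_right_ball tau_cvg e4.
exists (Num.min (e / 4) (Num.min (Num.min d1 d2) (Num.min d3 d4))).
  by rewrite !lt_min e4 d1_gt0 d2_gt0 d3_gt0.
move=> h t x xi s; rewrite !lt_min => /and5P[h0 _ _ h3 h4] tT /and3P[_ /andP[td _] _] xd /andP[xie _] sh tht.
have {}h3 : h < d3 by move: h3 h4; case: (_ < _).
have tau0 := tau_gt0 h0.
have k1 : `|phi (x, t) - phi (x0, t0)| < e / 4.
  by apply: hd1 => //= i; have := xd i; rewrite !lt_min => /and3P[_ /andP[]].
have k2 : `|u0 x - u0 x0| < e / 4.
  by apply: hd2 => i; have := xd i; rewrite !lt_min => /and3P[_ /andP[]].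
have k3 : `|s| < e / 4.
  apply: le_lt_trans sh _; have := hd3 h; rewrite h0 h3 subr0 => /(_ erefl).
  rewrite ger0_norm; last by rewrite divr_ge0 ?eta_ge0// ltW.
  rewrite ltr_pdivrMr// mul1r => /lt_trans; apply.
  by have := hd4 h; rewrite h0 subr0 gtr0_norm//; apply.
rewrite /shifted_scheme /scheme leNgt tht /= -t00.
move: k1 k2 k3 xie; move: (phi _) (phi _) (u0 _) (u0 _) => a1 a2 a3 a4.
rewrite !ltr_norml => /andP[p1 q1] /andP[p2 q2] /andP[p3 q3] /andP[p4 q4].
by apply/andP; split; lra.
Qed.

Lemma tau_small : 0 < t0 -> exists2 d : R, 0 < d &
  forall h t, 0 < h < d -> `|t - t0| < d -> tau h <= t.
Proof.
move=> t0_gt0; have t2 : 0 < t0 / 2 by rewrite divr_gt0.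
have [d d_gt0 hd] := cvg_at_right_ball tau_cvg t2.
exists (Num.min d (t0 / 2)); first by rewrite lt_min d_gt0.
move=> h t; rewrite !lt_min => /and3P[h0 hd' _] /andP[_].
have := hd h; rewrite h0 hd' subr0 => /(_ erefl).
by rewrite !ltr_norml => /andP[? ?] /andP[? ?]; lra.
Qed.

(** For $t_0>0$ the time eventually exceeds [tau h] and only the interior regime occurs. For $t_0=0$
    every neighbourhood meets both regimes, so [P] has to hold near both limit values; this is the
    origin of the minimum and the maximum in the result. *)
Lemma scheme_near (P : set R) (e : R) : 0 < e ->
  (forall v, `|v - equation sigma T F f phi (x0, t0)| < e -> P v) ->
  (~~ (0 < t0) -> forall v, `|v - (phi (x0, 0) - u0 x0)| < e -> P v) ->
  forall s : R -> R, (forall h, 0 < h -> `|s h| <= eta h) ->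
  scheme_limit T t0 x0 (fun q => P (shifted_scheme q.1.1.1 q.1.2 q.1.1.2 q.2 (s q.1.1.1))).
Proof.
move=> e0 PE Pi s seta; have [d d_gt0 hd] := scheme_consistent_interior e0.
have [t0_gt0|t0_le0] := boolP (0 < t0).
  have [d' d'_gt0 hd'] := tau_small t0_gt0.
  apply: (@scheme_limit_ball _ _ _ _ (Num.min d d')); first by rewrite lt_min d_gt0.
  move=> h t x xi; rewrite !lt_min => /and3P[h0 h1 h2] tT /andP[t1 t2] xd _ /=.
  apply: PE; apply: hd => //; first by rewrite h0.
  - by move=> i; have := xd i; rewrite lt_min => /andP[].
  - exact: seta.
  - by apply: hd' => //; rewrite h0.
have t00 : t0 = 0.
  by apply/eqP; rewrite eq_le leNgt t0_le0/=; case/andP: t0_in.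
have [d' d'_gt0 hd'] := scheme_consistent_initial t00 e0.
apply: (@scheme_limit_ball _ _ _ _ (Num.min d d')); first by rewrite lt_min d_gt0.
move=> h t x xi; rewrite !lt_min => /and3P[h0 h1 h2] tT /andP[t1 t2] xd /andP[xi1 xi2] /=.
have [tht|tht] := leP (tau h) t.
  apply: PE; apply: hd => //; first by rewrite h0.
  - by move=> i; have := xd i; rewrite lt_min => /andP[].
  - exact: seta.
apply: (Pi t0_le0); apply: hd' => //; first by rewrite h0.
- by move=> i; have := xd i; rewrite lt_min => /andP[].
- exact: seta.
Qed.

End scheme_consistency.

Theorem lemma3p8 (R : realType) (N : nat) (sigma T LF : R) (F : R -> R)
    (f : 'rV[R]_N * R -> R) (u0 : 'rV[R]_N -> R) (tau eta : R -> R)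
    (phi : 'rV[R]_N * R -> R) (x0 : 'rV[R]_N) (t0 : R)
    (N_gt0 : (0 < N)%N) (sigma_bnd : 0 < sigma < 2) (T_gt0 : 0 < T)
    (F_incr_lip : forall l1 l2 : R, F l1 - F l2 <= LF * Num.max 0 (l1 - l2))
    (f_Cb : Cb_cylinder T f)
    (u0_cont : continuous u0) (u0_bnd : [bounded u0 x | x in [set: 'rV[R]_N]])
    (tau_gt0 : forall h : R, 0 < h -> 0 < tau h)
    (tau_div : forall h : R, 0 < h -> exists n : nat, T / tau h = n%:R)
    (tau_cvg : tau h @[h --> 0^'+] --> 0)
    (phi_C2 : C2_cylinder T phi) (phi_Cb : Cb_cylinder T phi)
    (eta_ge0 : forall h : R, 0 < h -> 0 <= eta h)
    (eta_cvg : eta h / tau h @[h --> 0^'+] --> 0)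
    (t0_in : 0 <= t0 <= T) :
  let S := scheme sigma F f u0 tau in
  let E := equation sigma T F f phi in
  let S_minus (q : R * R * 'rV[R]_N * R) : R :=
    let: (h, t, x, xi) := q in
    S h x t (phi (x, t) + xi - eta h) (fun p => phi p + xi) in
  let S_plus (q : R * R * 'rV[R]_N * R) : R :=
    let: (h, t, x, xi) := q in
    S h x t (phi (x, t) + xi + eta h) (fun p => phi p + xi) in
  (limf_einf (EFin \o S_minus) (scheme_limit T t0 x0) >=
     if (0 < t0)%R then (E (x0, t0))%:E
     else Order.min ((phi (x0, 0%R))%:E - usc_envelope u0 x0) (E (x0, 0%R))%:E)%E
  /\
  (limf_esup (EFin \o S_plus) (scheme_limit T t0 x0) <=
     if (0 < t0)%R then (E (x0, t0))%:E
     else Order.max ((phi (x0, 0%R))%:E - lsc_envelope u0 x0) (E (x0, 0%R))%:E)%E.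
Proof.
move=> S E S_minus S_plus; have [f_cont _] := f_Cb.
have near P e e0 PE Pi := @scheme_near _ _ sigma T LF F f u0 tau eta phi x0 t0 sigma_bnd
  F_incr_lip f_cont u0_cont tau_gt0 tau_cvg phi_C2 phi_Cb eta_ge0 eta_cvg t0_in P e e0 PE Pi.
have t0E : ~~ (0 < t0) -> t0 = 0.
  by move=> t0_le0; apply/eqP; rewrite eq_le leNgt t0_le0/=; case/andP: t0_in.
pose v := phi (x0, 0) - u0 x0.
split.
(* The bound is proved with [u0 x0] in place of the envelope; since the upper envelope lies above
   [u0], this value [m] dominates the required one. *)
- pose m := if 0 < t0 then E (x0, t0) else Num.min v (E (x0, t0)).
  have mE : m <= E (x0, t0) by rewrite /m; case: ifP => // _; rewrite ge_min lexx orbT.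
  apply: (@le_trans _ _ m%:E).
    rewrite /m; case: ifPn => // /t0E t00; rewrite -t00 EFin_min le_min; apply/andP; split.
      by rewrite ge_min /v -t00 EFinB; apply/orP; left; apply: leeB => //; exact: usc_envelope_ge.
    by rewrite ge_min lexx orbT.
  apply: limf_einf_ge => e e0.
  have := near (fun w => m - e <= w) e e0 _ _ (fun h => - eta h).
  rewrite /scheme_limit => h; apply: filterS (h _ _ _) => [[[[h' t] x] xi] //|w|t0_le0 w|h' h0].
  + by rewrite ltr_distl => /andP[/ltW wE _]; apply: le_trans wE; exact: lerB.
  + rewrite ltr_distl => /andP[/ltW wE _]; apply: le_trans wE; apply: lerB => //.
    by rewrite /m (negbTE t0_le0) ge_min lexx.
  + by rewrite normrN ger0_norm// eta_ge0.
(* Symmetrically, the lower envelope lies below [u0], so the required bound is at least [m]. *)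
- pose m := if 0 < t0 then E (x0, t0) else Num.max v (E (x0, t0)).
  have mE : E (x0, t0) <= m by rewrite /m; case: ifP => // _; rewrite le_max lexx orbT.
  apply: (@le_trans _ _ m%:E); last first.
    rewrite /m; case: ifPn => // /t0E t00; rewrite -t00 EFin_max ge_max; apply/andP; split.
      by rewrite le_max /v -t00 EFinB; apply/orP; left; apply: leeB => //; exact: lsc_envelope_le.
    by rewrite le_max lexx orbT.
  apply: limf_esup_le => e e0.
  have := near (fun w => w <= m + e) e e0 _ _ eta.
  rewrite /scheme_limit => h; apply: filterS (h _ _ _) => [[[[h' t] x] xi] //|w|t0_le0 w|h' h0].
  + by rewrite ltr_distl => /andP[_ /ltW wE]; apply: le_trans wE _; exact: lerD.
  + rewrite ltr_distl => /andP[_ /ltW wE]; apply: le_trans wE _; apply: lerD => //.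
    by rewrite /m (negbTE t0_le0) le_max lexx.
  + by rewrite ger0_norm// eta_ge0.
Qed.
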